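(* Let $T>0$, let $r\ge 3$ be an integer, and let $\eta_0,u_0$ be real constants with $1+\eta_0>0$, $u_0>0$, $u_0>\sqrt{1+\eta_0}$. Let $\eta^0,u^0$ be given functions on $[0,1]$ and let $(\eta,u)$ be a sufficiently smooth solution on $[0,1]\times[0,T]$ of the initial-boundary-value problem $$\eta_t+u_0\eta_x+(1+\eta_0)u_x+(\eta u)_x=0,\qquad u_t+\eta_x+u_0u_x+uu_x=0,\qquad 0\le x\le 1,\ 0\le t\le T,$$ $$\eta(x,0)=\eta^0(x)-\eta_0,\quad u(x,0)=u^0(x)-u_0,\quad 0\le x\le 1;\qquad \eta(0,t)=0,\quad u(0,t)=0,\quad 0\le t\le T.$$ Assume that there exist positive constants $\alpha,\beta$ such that for all $(x,t)\in[0,1]\times[0,T]$ $$1+\eta+\eta_0\ge\beta,\qquad u+u_0\ge 2\alpha,\qquad 1+\eta+\eta_0\le (u+u_0-\alpha)\bigl(u+u_0-\tfrac{2\alpha}{3}\bigr).$$ Fix $\kappa\ge 1$. Then there exist $h_0>0$ and $C>0$ (independent of the partition and of $h$) such that for every partition $0=x_1<x_2<\dots<x_{N+1}=1$ with $h:=\max_i(x_{i+1}-x_i)\le h_0$ and $h\le\kappa\min_i(x_{i+1}-x_i)$, the following holds. With $\mathring{S}_h$ the finite element space defined in the context and $P$ the $L^2(0,1)$-orthogonal projection onto $\mathring{S}_h$, the semidiscrete initial-value problem of finding $\eta_h,u_h:[0,T]\to\mathring{S}_h$ such that for $0\le t\le T$ $$(\eta_{ht},\phi)+(u_0\eta_{hx},\phi)+((1+\eta_0)u_{hx},\phi)+((\eta_hu_h)_x,\phi)=0\quad\forall\phi\in\mathring{S}_h,$$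 $$(u_{ht},\phi)+(\eta_{hx},\phi)+(u_0u_{hx},\phi)+(u_hu_{hx},\phi)=0\quad\forall\phi\in\mathring{S}_h,$$ $$\eta_h(0)=P(\eta^0(\cdot)-\eta_0),\qquad u_h(0)=P(u^0(\cdot)-u_0),$$ has a unique solution $(\eta_h,u_h)$ on $[0,T]$, and it satisfies $$\max_{0\le t\le T}\bigl(\|\eta(t)-\eta_h(t)\|+\|u(t)-u_h(t)\|\bigr)\le C h^{r-1}.$$
   Context: $(\cdot,\cdot)$ and $\|\cdot\|$ denote the inner product and norm of $L^2(0,1)$; subscripts $x,t$ denote partial derivatives. $\mathbb{P}_{r-1}$ is the set of polynomials of degree $\le r-1$. For a partition $0=x_1<\dots<x_{N+1}=1$ of $[0,1]$, $$\mathring{S}_h=\{\phi\in C^{r-2}[0,1]:\ \phi(0)=0,\ \phi|_{[x_j,x_{j+1}]}\in\mathbb{P}_{r-1},\ 1\le j\le N\}.$$ The partitions are quasiuniform, i.e. $\max_i(x_{i+1}-x_i)\le\kappa\min_i(x_{i+1}-x_i)$ with a fixed constant $\kappa$. ''Sufficiently smooth'' means: there is an integer $m$ depending only on $r$ such that the result holds whenever $\eta,u\in C^m([0,1]\times[0,T])$. The constants $h_0$ and $C$ may depend on $\eta,u,T,r,\kappa,\alpha,\beta,\eta_0,u_0$, but not on $h$ or on the particular partition. A solution of the semidiscrete problem is understood to be a pair of continuously differentiable functions of $t$ with values in the finite-dimensional space $\mathring{S}_h$. *)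

(* Defs.v *)
From Stdlib Require Import Reals List RList Lra.
From Coquelicot Require Import Coquelicot.
Open Scope R_scope.

(* Functions on [0,1], on [0,T] and on [0,1] x [0,T] are total functions on R
   or on R x R.  Every notion below depends only on their values on the closed
   interval or rectangle; in particular derivatives at endpoints are
   one-sided. *)

Definition interval (a b : R) : R -> Prop := fun x => a <= x <= b.

(* Coquelicot's [is_derive] with [locally x] replaced by [within D (locally x)]. *)
Definition is_derive_on (D : R -> Prop) (f : R -> R) (x l : R) : Prop :=
  filterdiff f (within D (locally x)) (fun h => scal h l).

(* Meaningful only when the derivative relative to D exists and is unique;
   see [is_derive_on_unique] and [Derive_on_unique]. *)
Definition Derive_on (D : R -> Prop) (f : R -> R) (x : R) : R :=
  iota (is_derive_on D f x).

Lemma is_derive_on_unique (a b : R) (f : R -> R) (x l1 l2 : R) :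
  a < b -> interval a b x ->
  is_derive_on (interval a b) f x l1 -> is_derive_on (interval a b) f x l2 ->
  l1 = l2.
Proof.
intros Hab Hx [_ H1] [_ H2].
assert (Hlim : is_filter_lim (within (interval a b) (locally x)) x).
{ intros P HP. now apply filter_le_within. }
specialize (H1 x Hlim). specialize (H2 x Hlim).
destruct (Req_dec l1 l2) as [E | E]; [ exact E | exfalso ].
assert (Hd : 0 < Rabs (l1 - l2)) by (apply Rabs_pos_lt; lra).
assert (He : 0 < Rabs (l1 - l2) / 4) by lra.
specialize (H1 (mkposreal _ He)). specialize (H2 (mkposreal _ He)).
destruct (filter_and _ _ H1 H2) as [d Hball].
assert (Hy : exists y, interval a b y /\ 0 < Rabs (y - x) < d).
{ pose proof (cond_pos d) as Hd0. unfold interval in *.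
  destruct (Rlt_dec x b) as [Hxb | Hxb].
  - exists (x + Rmin (b - x) (d / 2)).
    assert (0 < Rmin (b - x) (d / 2)) by (apply Rmin_glb_lt; lra).
    pose proof (Rmin_l (b - x) (d / 2)). pose proof (Rmin_r (b - x) (d / 2)).
    replace (x + Rmin (b - x) (d / 2) - x) with (Rmin (b - x) (d / 2)) by ring.
    rewrite Rabs_pos_eq; lra.
  - exists (x - Rmin (x - a) (d / 2)).
    assert (0 < Rmin (x - a) (d / 2)) by (apply Rmin_glb_lt; lra).
    pose proof (Rmin_l (x - a) (d / 2)). pose proof (Rmin_r (x - a) (d / 2)).
    replace (x - Rmin (x - a) (d / 2) - x) with (- Rmin (x - a) (d / 2)) by ring.
    rewrite Rabs_Ropp, Rabs_pos_eq; lra. }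
destruct Hy as [y [Hy [Hy0 Hyd]]].
destruct (Hball y Hyd Hy) as [B1 B2].
unfold norm, minus, plus, opp, scal, mult in B1, B2. simpl in B1, B2.
unfold abs, mult in B1, B2. simpl in B1, B2.
change (y + - x) with (y - x) in *.
assert (Rabs (l1 - l2) * Rabs (y - x) <= Rabs (l1 - l2) / 2 * Rabs (y - x)).
{ rewrite <- Rabs_mult.
  replace ((l1 - l2) * (y - x)) with
    ((f y + - f x + - ((y - x) * l2)) - (f y + - f x + - ((y - x) * l1))) by ring.
  eapply Rle_trans; [ apply Rabs_triang | ].
  rewrite Rabs_Ropp. lra. }
pose proof (Rmult_lt_0_compat _ _ Hd Hy0). lra.
Qed.

Lemma Derive_on_unique (a b : R) (f : R -> R) (x l : R) :
  a < b -> interval a b x ->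
  is_derive_on (interval a b) f x l -> Derive_on (interval a b) f x = l.
Proof.
intros Hab Hx H.
apply (@iota_unique R_AbsRing R_CompleteNormedModule); [ | exact H ].
intros y Hy. exact (is_derive_on_unique a b f x y l Hab Hx Hy H).
Qed.

Fixpoint Ck_on (k : nat) (a b : R) (f : R -> R) : Prop :=
  continuous_on (interval a b) f /\
  match k with
  | O => True
  | S k' => exists g : R -> R,
      (forall x, interval a b x -> is_derive_on (interval a b) f x (g x)) /\
      Ck_on k' a b g
  end.

(* C^m([0,1] x [0,T]); f x t has its space variable first. *)
Fixpoint Ck_rect (m : nat) (T : R) (f : R -> R -> R) : Prop :=
  continuous_on (fun p : R * R => interval 0 1 (fst p) /\ interval 0 T (snd p))
    (fun p : R * R => f (fst p) (snd p)) /\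
  match m with
  | O => True
  | S m' => exists fx ft : R -> R -> R,
      (forall x t, interval 0 1 x -> interval 0 T t ->
         is_derive_on (interval 0 1) (fun y => f y t) x (fx x t) /\
         is_derive_on (interval 0 T) (fun s => f x s) t (ft x t)) /\
      Ck_rect m' T fx /\ Ck_rect m' T ft
  end.

(* The integrands met below are bounded and continuous on ]0,1[, so the Riemann
   integral agrees with the Lebesgue one. *)
Definition inner (f g : R -> R) : R := RInt (fun x => f x * g x) 0 1.

Definition L2norm (f : R -> R) : R := sqrt (inner f f).

(* d/dx on [0,1] *)
Definition Dx (f : R -> R) : R -> R := Derive_on (interval 0 1) f.

(* The nodes are xs 1, ..., xs (N+1); other values of xs are irrelevant. *)
Definition is_partition (N : nat) (xs : nat -> R) : Prop :=
  (1 <= N)%nat /\ xs 1%nat = 0 /\ xs (N + 1)%nat = 1 /\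
  forall j, (1 <= j <= N)%nat -> xs j < xs (j + 1)%nat.

Definition steps (N : nat) (xs : nat -> R) : list R :=
  map (fun j => xs (j + 1)%nat - xs j) (seq 1 N).

Definition max_step (N : nat) (xs : nat -> R) : R := MaxRlist (steps N xs).
Definition min_step (N : nat) (xs : nat -> R) : R := MinRlist (steps N xs).

(* The space of splines of order r vanishing at 0. *)
Definition Sh (r N : nat) (xs : nat -> R) (phi : R -> R) : Prop :=
  Ck_on (r - 2) 0 1 phi /\ phi 0 = 0 /\
  forall j, (1 <= j <= N)%nat ->
    exists c : nat -> R, forall x, interval (xs j) (xs (j + 1)%nat) x ->
      phi x = sum_n (fun k => c k * x ^ k) (r - 1).

Definition is_L2_projection (S : (R -> R) -> Prop) (f p : R -> R) : Prop :=
  S p /\ forall phi, S phi -> inner (fun x => f x - p x) phi = 0.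

(* v is a continuously differentiable map from [0,T] to the finite-dimensional
   space S of functions on [0,1], normed by L2norm, and vt is its derivative;
   here v t is the function at time t, with the time variable first. *)
Definition is_C1_in_time (S : (R -> R) -> Prop) (T : R) (v vt : R -> R -> R)
  : Prop :=
  (forall t, interval 0 T t -> S (v t) /\ S (vt t)) /\
  (forall t, interval 0 T t ->
     filterlim (fun s => L2norm (fun x => (v s x - v t x) / (s - t) - vt t x))
       (within (fun s => interval 0 T s /\ s <> t) (locally t)) (locally 0)) /\
  (forall t, interval 0 T t ->
     filterlim (fun s => L2norm (fun x => vt s x - vt t x))
       (within (interval 0 T) (locally t)) (locally 0)).

Definition is_ibvp_solution (T eta_0 u_0 : R) (eta_init u_init : R -> R)
    (eta u : R -> R -> R) : Prop :=
  (forall x t, interval 0 1 x -> interval 0 T t ->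
     let dx f := Dx (fun y => f y t) x in
     let dt f := Derive_on (interval 0 T) (fun s => f x s) t in
     dt eta + u_0 * dx eta + (1 + eta_0) * dx u
       + dx (fun y s => eta y s * u y s) = 0 /\
     dt u + dx eta + u_0 * dx u + u x t * dx u = 0) /\
  (forall x, interval 0 1 x ->
     eta x 0 = eta_init x - eta_0 /\ u x 0 = u_init x - u_0) /\
  (forall t, interval 0 T t -> eta 0 t = 0 /\ u 0 t = 0).

Definition is_semidiscrete_solution (S : (R -> R) -> Prop) (T eta_0 u_0 : R)
    (eta_init u_init : R -> R) (eta_h u_h : R -> R -> R) : Prop :=
  exists eta_ht u_ht : R -> R -> R,
    is_C1_in_time S T eta_h eta_ht /\ is_C1_in_time S T u_h u_ht /\
    (forall t, interval 0 T t -> forall phi, S phi ->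
       inner (eta_ht t) phi
         + inner (fun x => u_0 * Dx (eta_h t) x) phi
         + inner (fun x => (1 + eta_0) * Dx (u_h t) x) phi
         + inner (Dx (fun x => eta_h t x * u_h t x)) phi = 0 /\
       inner (u_ht t) phi
         + inner (Dx (eta_h t)) phi
         + inner (fun x => u_0 * Dx (u_h t) x) phi
         + inner (fun x => u_h t x * Dx (u_h t) x) phi = 0) /\
    is_L2_projection S (fun x => eta_init x - eta_0) (eta_h 0) /\
    is_L2_projection S (fun x => u_init x - u_0) (u_h 0).

(* Main.v *)
(* Put rho = eta - P eta, theta = P eta - eta_h, sigma = u - P u, xi = P u - u_h,
   H = 1 + eta_0 + eta, U = u_0 + u.  Testing the two error equations with theta and
   with P (H xi) turns the flux terms into the derivative of
   U theta^2 / 2 + H theta xi + H U xi^2 / 2, whose boundary value at x = 1 is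
   nonnegative because H <= U^2 (the flow is supercritical), plus terms bounded by
   |theta|^2 + |xi|^2 + h^(2r-2).  This uses the inverse inequalities, the
   approximation estimate |(eta - P eta)_x| = O(h^(r-1)), the superapproximation
   estimate |P (H xi) - H xi| = O(h) |xi|, and the smallness O(h) of theta and xi in
   the maximum norm; Gronwall's inequality for |theta|^2 + (H xi, xi) concludes.

   To have a global solution beforehand, (theta, xi) is replaced in the vector field by
   its retraction onto the L2 ball of radius h^(3/2).  On that ball the inverse
   inequality gives the maximum norm bound O(h), so the estimate above holds for the
   truncated system on all of [0,T]; as r >= 3 it then shows that the truncation is
   inactive once h is small.

   Approximation and superapproximation both come from one explicit construction in
   the span of the truncated powers: a polynomial of degree < r is a combination of
   the powers (x - t_l)^(r-1) at r consecutive nodes t_l, and truncating these powers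
   switches the polynomial on within r mesh intervals. *)

Require Import Defs.
From Stdlib Require Import Reals List RList Lra Lia Psatz Compare_dec Factorial.
From Coquelicot Require Import Coquelicot.
Open Scope R_scope.

(** The function [H xi] is the test function because the weight [H] symmetrizes the coupling: the
    terms with [theta xi_x] and [xi theta_x] join into an exact derivative. Passing to its
    projection costs nothing in the time derivative, since [xi_t] is itself a spline, but leaves a
    defect in the flux. The defect meets derivatives of splines, of size [1/h], which is why a full
    factor [h] is needed in the superapproximation. Quadratic terms such as [theta_x xi] suffer the
    same loss; a maximum norm of size [h] absorbs it, and since that norm costs [h^(-1/2)] against
    the L2 norm, the radius has to be [h^(3/2)].

    The retraction multiplies theta and xi in the flux, but not in the test functions, by one scalar
    [s] in [0,1]. Being constant in space, [s] merely scales the boundary form, so the sign at x = 1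
    survives the truncation.

    The discrete initial data are projections, so theta and xi start from zero and the projection
    errors are the only source. The space derivative of these errors is estimated as it stands,
    which accounts for the rate [h^(r-1)]. *)

Fixpoint rsum (n : nat) (f : nat -> R) : R :=
  match n with O => 0 | S k => rsum k f + f k end.

Lemma rsum_ext n f g :
  (forall i, (i < n)%nat -> f i = g i) -> rsum n f = rsum n g.
Proof.
induction n as [|n IH]; simpl; intros H; [reflexivity|].
rewrite IH by (intros; apply H; lia). now rewrite H by lia.
Qed.

Lemma rsum_plus n f g :
  rsum n (fun i => f i + g i) = rsum n f + rsum n g.
Proof. induction n as [|n IH]; simpl; [ring|rewrite IH; ring]. Qed.

Lemma rsum_scal n c f : rsum n (fun i => c * f i) = c * rsum n f.
Proof. induction n as [|n IH]; simpl; [ring|rewrite IH; ring]. Qed.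

Lemma rsum_minus n f g :
  rsum n (fun i => f i - g i) = rsum n f - rsum n g.
Proof. induction n as [|n IH]; simpl; [ring|rewrite IH; ring]. Qed.

Lemma rsum_eq0 n f : (forall i, (i < n)%nat -> f i = 0) -> rsum n f = 0.
Proof.
induction n as [|n IH]; simpl; intros H; [reflexivity|].
rewrite IH by (intros; apply H; lia). rewrite H by lia. ring.
Qed.

Lemma rsum_le n f g :
  (forall i, (i < n)%nat -> f i <= g i) -> rsum n f <= rsum n g.
Proof.
induction n as [|n IH]; simpl; intros H; [lra|].
assert (rsum n f <= rsum n g) by (apply IH; intros; apply H; lia).
specialize (H n ltac:(lia)). lra.
Qed.

Lemma rsum_const n c : rsum n (fun _ => c) = INR n * c.
Proof.
induction n as [|n IH]; [simpl; ring|]. rewrite S_INR. simpl. rewrite IH. ring.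
Qed.

Lemma rsum_nonneg n f : (forall i, (i < n)%nat -> 0 <= f i) -> 0 <= rsum n f.
Proof.
intros H. replace 0 with (rsum n (fun _ => 0)) by (apply rsum_eq0; auto).
now apply rsum_le.
Qed.

Lemma rsum_abs n f : Rabs (rsum n f) <= rsum n (fun i => Rabs (f i)).
Proof.
induction n as [|n IH]; simpl; [rewrite Rabs_R0; lra|].
eapply Rle_trans; [apply Rabs_triang|lra].
Qed.

Lemma rsum_abs_bound n f B :
  (forall i, (i < n)%nat -> Rabs (f i) <= B) -> Rabs (rsum n f) <= INR n * B.
Proof.
intros H. eapply Rle_trans; [apply rsum_abs|].
rewrite <- rsum_const. now apply rsum_le.
Qed.

Lemma rsum_term_le n f i :
  (forall i, (i < n)%nat -> 0 <= f i) -> (i < n)%nat -> f i <= rsum n f.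
Proof.
induction n as [|n IH]; simpl; intros H Hi; [lia|].
assert (0 <= rsum n f) by (apply rsum_nonneg; intros; apply H; lia).
destruct (Nat.eq_dec i n) as [->|E]; [lra|].
assert (f i <= rsum n f) by (apply IH; [intros; apply H; lia|lia]).
specialize (H n ltac:(lia)). lra.
Qed.

Lemma rsum_swap n m (f : nat -> nat -> R) :
  rsum n (fun i => rsum m (fun j => f i j)) =
  rsum m (fun j => rsum n (fun i => f i j)).
Proof.
induction n as [|n IH]; simpl.
- symmetry. now apply rsum_eq0.
- rewrite IH. now rewrite <- rsum_plus.
Qed.

Lemma rsum_single n i f :
  (i < n)%nat -> (forall j, (j < n)%nat -> j <> i -> f j = 0) -> rsum n f = f i.
Proof.
induction n as [|n IH]; simpl; intros Hi H; [lia|].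
destruct (Nat.eq_dec i n) as [->|E].
- rewrite rsum_eq0; [ring|]. intros j Hj. apply H; lia.
- rewrite IH by (try lia; intros; apply H; lia). rewrite (H n) by lia. ring.
Qed.

Lemma rsum_split n m f :
  rsum (n + m) f = rsum n f + rsum m (fun i => f (n + i)%nat).
Proof.
induction m as [|m IH]; simpl; [rewrite Nat.add_0_r; ring|].
rewrite Nat.add_succ_r. simpl. rewrite IH. ring.
Qed.

Lemma rsum_sqr_le n f : (rsum n f) ^ 2 <= INR n * rsum n (fun i => f i ^ 2).
Proof.
induction n as [|n IH]; [simpl; lra|].
rewrite S_INR. cbn [rsum].
set (s := rsum n f) in *. set (q := rsum n (fun i => f i ^ 2)) in *.
destruct n as [|n'].
- unfold s, q. simpl. nra.
- set (k := INR (S n')) in *.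
  assert (Hk : 0 < k) by (apply lt_0_INR; lia).
  assert (2 * s * f (S n') <= q + k * f (S n') ^ 2).
  { assert (0 <= (s - k * f (S n')) ^ 2) by apply pow2_ge_0.
    apply Rmult_le_reg_l with k; [exact Hk|]. nra. }
  nra.
Qed.

(** * Moment problems and polynomials *)

(* The row of moment [m+1] minus [t n] times that of moment [m] no longer
   involves the point [t n], and is again a moment problem. *)
Lemma moments_solve (n : nat) (A delta : R) : 0 <= A -> 0 < delta ->
  exists C, 0 <= C /\ forall t : nat -> R,
  (forall j, (j < n)%nat -> Rabs (t j) <= A) ->
  (forall i j, (i < n)%nat -> (j < n)%nat -> i <> j ->
     delta <= Rabs (t i - t j)) ->
  forall (b : nat -> R) B, 0 <= B ->
  (forall m, (m < n)%nat -> Rabs (b m) <= B) ->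
  exists d : nat -> R, (forall j, (j < n)%nat -> Rabs (d j) <= C * B) /\
    forall m, (m < n)%nat -> rsum n (fun j => d j * t j ^ m) = b m.
Proof.
intros HA Hd. induction n as [|n [C [HC IH]]].
- exists 0. split; [lra|]. intros. exists (fun _ => 0). split; intros; lia.
- set (C1 := C * (1 + A) / delta).
  assert (HC1 : 0 <= C1).
  { unfold C1, Rdiv. apply Rmult_le_pos; [nra|].
    left. now apply Rinv_0_lt_compat. }
  assert (Hn := pos_INR n).
  exists (1 + (1 + INR n) * C1). split; [nra|].
  intros t Ht Hs b B HB Hb.
  destruct (IH t) with (b := fun m => b (S m) - t n * b m) (B := (1 + A) * B)
    as [d' [Hd' Hm]].
  + intros; apply Ht; lia.
  + intros; apply Hs; lia.
  + nra.
  + intros m Hmn. eapply Rle_trans; [apply Rabs_triang|].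
    rewrite Rabs_Ropp, Rabs_mult.
    assert (Rabs (b (S m)) <= B) by (apply Hb; lia).
    assert (Rabs (b m) <= B) by (apply Hb; lia).
    assert (Rabs (t n) <= A) by (apply Ht; lia).
    assert (Rabs (t n) * Rabs (b m) <= A * B)
      by (apply Rmult_le_compat; auto using Rabs_pos).
    lra.
  + assert (Hnz : forall j, (j < n)%nat -> t j - t n <> 0).
    { intros j Hj E. specialize (Hs j n ltac:(lia) ltac:(lia) ltac:(lia)).
      rewrite E, Rabs_R0 in Hs. lra. }
    assert (Hdj : forall j, (j < n)%nat -> Rabs (d' j / (t j - t n)) <= C1 * B).
    { intros j Hj. rewrite Rabs_div by auto.
      assert (H1 := Hs j n ltac:(lia) ltac:(lia) ltac:(lia)).
      assert (H2 := Hd' j Hj). assert (H3 := Rabs_pos (d' j)).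
      unfold C1, Rdiv. replace (C * (1 + A) * / delta * B)
        with ((C * ((1 + A) * B)) * / delta) by ring.
      apply Rmult_le_compat; auto.
      - left. apply Rinv_0_lt_compat. lra.
      - apply Rinv_le_contravar; lra. }
    set (e := fun j => d' j / (t j - t n)) in *.
    (* The quotients [e j] turn the reduced problem into the recursion from moment [m] to moment
       [m + 1]. The last weight is chosen to make moment 0 correct, and the recursion then carries
       the equality to all later moments. *)
    exists (fun j => if Nat.eq_dec j n then b O - rsum n e else e j).
    assert (Hrs : forall g, rsum n (fun j =>
       (if Nat.eq_dec j n then b O - rsum n e else e j) * g j)
       = rsum n (fun j => e j * g j)).
    { intros g. apply rsum_ext. intros i Hi.
      destruct (Nat.eq_dec i n); [lia|reflexivity]. }
    split.
    * intros j Hj. destruct (Nat.eq_dec j n) as [E|E].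
      -- eapply Rle_trans; [apply Rabs_triang|]. rewrite Rabs_Ropp.
         assert (Rabs (b O) <= B) by (apply Hb; lia).
         assert (Rabs (rsum n e) <= INR n * (C1 * B)) by now apply rsum_abs_bound.
         assert (0 <= C1 * B) by nra. lra.
      -- assert (Rabs (e j) <= C1 * B) by (apply Hdj; lia).
         assert (0 <= INR n * (C1 * B)) by (apply Rmult_le_pos; nra). lra.
    * assert (Hall : forall m, (m < S n)%nat ->
        rsum n (fun j => e j * t j ^ m) + (b O - rsum n e) * t n ^ m = b m).
      { induction m as [|m IHm]; intros Hmn.
        - simpl. rewrite (rsum_ext n _ e) by (intros; ring). ring.
        - specialize (IHm ltac:(lia)). specialize (Hm m ltac:(lia)).
          assert (E : rsum n (fun j => e j * t j ^ S m) =
            rsum n (fun j => d' j * t j ^ m)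
            + t n * rsum n (fun j => e j * t j ^ m)).
          { rewrite <- rsum_scal, <- rsum_plus. apply rsum_ext.
            intros j Hj. unfold e. simpl. field. auto. }
          rewrite E, Hm. simpl. rewrite <- IHm. ring. }
      intros m Hmn. cbn [rsum]. rewrite Hrs.
      destruct (Nat.eq_dec n n); [|lia]. now apply Hall.
Qed.

(** * Continuous functions and integrals *)

(** Continuity is asked on all of R, so that integrals need no side conditions; data known only on
    an interval enter after composition with [clamp]. *)
Definition cont (f : R -> R) : Prop := forall x, continuous f x.

Lemma cont_eps (f : R -> R) x : continuous f x <->
  forall eps, 0 < eps -> exists d, 0 < d /\
    forall y, Rabs (y - x) < d -> Rabs (f y - f x) < eps.
Proof.
split.
- intros H eps He.
  destruct (H (fun z => Rabs (z - f x) < eps)) as [d Hd].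
  + exists (mkposreal eps He). intros z Hz. exact Hz.
  + exists d. split; [apply cond_pos|]. intros y Hy. apply Hd. exact Hy.
- intros H P [eps HP].
  destruct (H eps (cond_pos eps)) as [d [Hd H1]].
  exists (mkposreal d Hd). intros y Hy. apply HP. apply H1. exact Hy.
Qed.

Lemma cont_const c : cont (fun _ => c).
Proof. intros x. apply continuous_const. Qed.
Lemma cont_id : cont (fun x => x).
Proof. intros x. apply continuous_id. Qed.
Lemma cont_plus (f g : R -> R) : cont f -> cont g -> cont (fun x => f x + g x).
Proof. intros Hf Hg x. exact (continuous_plus f g x (Hf x) (Hg x)). Qed.
Lemma cont_opp (f : R -> R) : cont f -> cont (fun x => - f x).
Proof. intros Hf x. exact (continuous_opp f x (Hf x)). Qed.
Lemma cont_minus (f g : R -> R) : cont f -> cont g -> cont (fun x => f x - g x).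
Proof. intros Hf Hg x. exact (continuous_minus f g x (Hf x) (Hg x)). Qed.
Lemma cont_mult (f g : R -> R) : cont f -> cont g -> cont (fun x => f x * g x).
Proof. intros Hf Hg x. exact (continuous_mult f g x (Hf x) (Hg x)). Qed.
Lemma cont_div (f : R -> R) c : cont f -> cont (fun x => f x / c).
Proof. intros Hf. apply cont_mult; [exact Hf|apply cont_const]. Qed.
Lemma cont_pow (f : R -> R) n : cont f -> cont (fun x => f x ^ n).
Proof.
intros Hf. induction n as [|n IH]; simpl; [apply cont_const|].
now apply cont_mult.
Qed.
Lemma cont_rsum n (f : nat -> R -> R) :
  (forall i, (i < n)%nat -> cont (f i)) -> cont (fun x => rsum n (fun i => f i x)).
Proof.
induction n as [|n IH]; simpl; intros H; [apply cont_const|].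
apply cont_plus; [apply IH; intros; apply H; lia|apply H; lia].
Qed.
Lemma cont_comp (f g : R -> R) : cont f -> cont g -> cont (fun x => f (g x)).
Proof. intros Hf Hg x. apply (continuous_comp g f); auto. Qed.
Lemma cont_lip (f : R -> R) L : (forall x y, Rabs (f x - f y) <= L * Rabs (x - y)) -> cont f.
Proof.
intros H x. apply cont_eps. intros eps He.
assert (HL : 0 <= L).
{ specialize (H 1 0). replace (1 - 0) with 1 in H by ring. rewrite Rabs_R1 in H.
  assert (P := Rabs_pos (f 1 - f 0)). lra. }
exists (eps / (L + 1)). split; [apply Rdiv_lt_0_compat; lra|].
intros y Hy. specialize (H y x). assert (P := Rabs_pos (y - x)).
apply Rmult_lt_compat_r with (r := L + 1) in Hy; [|lra].
unfold Rdiv in Hy. rewrite Rmult_assoc, Rinv_l, Rmult_1_r in Hy by lra. nra.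
Qed.

Ltac cont1 := match goal with
  | H : cont ?f |- cont ?f => exact H
  | H : cont ?f |- cont (fun x => ?f x) => exact H
  | |- cont (fun _ => ?c) => apply (cont_const c)
  | |- cont (fun x => x) => apply cont_id
  | |- cont (fun x => _ + _) => apply cont_plus
  | |- cont (fun x => - _) => apply cont_opp
  | |- cont (fun x => _ - _) => apply cont_minus
  | |- cont (fun x => _ * _) => apply cont_mult
  | |- cont (fun x => _ / _) => apply cont_div
  | |- cont (fun x => _ ^ _) => apply cont_pow
  | |- cont (Rmult ?c) => apply (cont_mult (fun _ => c) (fun x => x))
  | |- cont (Rplus ?c) => apply (cont_plus (fun _ => c) (fun x => x))
  | |- cont (Rminus ?c) => apply (cont_minus (fun _ => c) (fun x => x))
  | |- cont (fun x => rsum _ _) => apply cont_rsum; intros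
  end.
Ltac cont := repeat cont1; try assumption.

Lemma cont_ex_RInt (f : R -> R) a b : cont f -> ex_RInt f a b.
Proof. intros H. apply (ex_RInt_continuous (V := R_CompleteNormedModule)). intros; apply H. Qed.

Lemma RI_ext (f g : R -> R) a b : a <= b -> (forall x, a < x < b -> f x = g x) ->
  RInt f a b = RInt g a b.
Proof.
intros Hab H. apply RInt_ext. rewrite Rmin_left, Rmax_right by lra. exact H.
Qed.

Lemma RI_plus (f g : R -> R) a b : cont f -> cont g ->
  RInt (fun x => f x + g x) a b = RInt f a b + RInt g a b.
Proof. intros Hf Hg. apply (RInt_plus f g); now apply cont_ex_RInt. Qed.

Lemma RI_scal (f : R -> R) c a b : cont f ->
  RInt (fun x => c * f x) a b = c * RInt f a b.
Proof. intros Hf. apply (RInt_scal f); now apply cont_ex_RInt. Qed.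

Lemma RI_minus (f g : R -> R) a b : cont f -> cont g ->
  RInt (fun x => f x - g x) a b = RInt f a b - RInt g a b.
Proof. intros Hf Hg. apply (RInt_minus f g); now apply cont_ex_RInt. Qed.

Lemma RI_opp (f : R -> R) a b : cont f -> RInt (fun x => - f x) a b = - RInt f a b.
Proof. intros Hf. apply (RInt_opp f); now apply cont_ex_RInt. Qed.

Lemma RI_const (c a b : R) : RInt (fun _ => c) a b = (b - a) * c.
Proof. exact (RInt_const (V := R_CompleteNormedModule) a b c). Qed.

Lemma RI_rsum n (f : nat -> R -> R) a b :
  (forall i, (i < n)%nat -> cont (f i)) ->
  RInt (fun x => rsum n (fun i => f i x)) a b = rsum n (fun i => RInt (f i) a b).
Proof.
induction n as [|n IH]; simpl; intros H.
- rewrite RI_const. ring.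
- rewrite RI_plus.
  + rewrite IH; [reflexivity|]. intros; apply H; lia.
  + apply cont_rsum. intros; apply H; lia.
  + apply H; lia.
Qed.

Lemma RI_le (f g : R -> R) a b : a <= b -> cont f -> cont g ->
  (forall x, a < x < b -> f x <= g x) -> RInt f a b <= RInt g a b.
Proof. intros. apply RInt_le; auto using cont_ex_RInt. Qed.

Lemma RI_nonneg (f : R -> R) a b : a <= b -> cont f ->
  (forall x, a < x < b -> 0 <= f x) -> 0 <= RInt f a b.
Proof. intros. apply RInt_ge_0; auto using cont_ex_RInt. Qed.

Lemma RI_Chasles (f : R -> R) a b c : cont f -> RInt f a b + RInt f b c = RInt f a c.
Proof. intros. apply (RInt_Chasles f); auto using cont_ex_RInt. Qed.

Lemma RI_abs_le (f : R -> R) a b M : a <= b -> cont f ->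
  (forall x, a <= x <= b -> Rabs (f x) <= M) -> Rabs (RInt f a b) <= (b - a) * M.
Proof. intros. apply abs_RInt_le_const; auto using cont_ex_RInt. Qed.

Lemma is_derive_RI (f : R -> R) a x : cont f -> is_derive (fun y => RInt f a y) x (f x).
Proof.
intros Hf. apply (is_derive_RInt f (fun y => RInt f a y) a x).
- exists (mkposreal 1 Rlt_0_1). intros y _.
  apply (RInt_correct (V := R_CompleteNormedModule)), cont_ex_RInt, Hf.
- apply Hf.
Qed.

Lemma is_derive_cont (f : R -> R) (df : R -> R) : (forall x, is_derive f x (df x)) -> cont f.
Proof. intros H x. apply (ex_derive_continuous (V := R_NormedModule)). exists (df x). apply H. Qed.

Lemma cont_RI (f : R -> R) a : cont f -> cont (fun y => RInt f a y).
Proof. intros Hf. apply is_derive_cont with f. intros; now apply is_derive_RI. Qed.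

Lemma MVT_open (F f : R -> R) a b : a < b -> cont F ->
  (forall x, a < x < b -> is_derive F x (f x)) ->
  exists c, a <= c <= b /\ F b - F a = f c * (b - a).
Proof.
intros Hab HF Hd. destruct (MVT_gen F a b f) as [c Hc].
- rewrite Rmin_left, Rmax_right by lra. exact Hd.
- intros x _. apply continuity_pt_filterlim, HF.
- rewrite Rmin_left, Rmax_right in Hc by lra. now exists c.
Qed.

(** The derivative is required only inside the interval because functions extended by [clamp] may
    have kinks at the endpoints. The difference of [F] and the integral has zero derivative inside,
    so the mean value theorem suffices. *)
Lemma FTC_open (F f : R -> R) a b : a <= b -> cont F -> cont f ->
  (forall x, a < x < b -> is_derive F x (f x)) -> RInt f a b = F b - F a.
Proof.
intros Hab HF Hf Hd.
destruct (Req_dec a b) as [<-|E].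
{ rewrite (RInt_point (V := R_CompleteNormedModule) a f). unfold zero; simpl. ring. }
destruct (MVT_open (fun x => RInt f a x - F x) (fun _ => 0) a b) as [c [_ Hc]].
- lra.
- cont. now apply cont_RI.
- intros x Hx. replace 0 with (f x - f x) by ring.
  apply (is_derive_minus (fun x => RInt f a x) F); [now apply is_derive_RI|auto].
- rewrite (RInt_point (V := R_CompleteNormedModule) a f) in Hc. unfold zero in Hc; simpl in Hc. lra.
Qed.

Lemma quadratic_nonneg_disc A B C : 0 <= C ->
  (forall l, 0 <= A + 2 * l * B + l ^ 2 * C) -> B ^ 2 <= A * C.
Proof.
intros HC H. destruct (Req_dec C 0) as [->|E].
- destruct (Req_dec B 0) as [->|EB]; [nra|]. exfalso.
  (* With [C = 0] the form is affine in [l]; at this point it takes the value -1. *)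
  specialize (H (- (A + 1) / (2 * B))).
  replace (A + 2 * (- (A + 1) / (2 * B)) * B + (- (A + 1) / (2 * B)) ^ 2 * 0)
    with (-1) in H by (field; lra). lra.
- specialize (H (- B / C)).
  replace (A + 2 * (- B / C) * B + (- B / C) ^ 2 * C) with ((A * C - B ^ 2) / C) in H
    by (field; lra).
  apply Rmult_le_compat_r with (r := C) in H; [|lra].
  unfold Rdiv in H. rewrite Rmult_assoc, Rinv_l in H by lra. lra.
Qed.

Lemma RI_CS (f g : R -> R) a b : a <= b -> cont f -> cont g ->
  (RInt (fun x => f x * g x) a b) ^ 2
  <= RInt (fun x => f x ^ 2) a b * RInt (fun x => g x ^ 2) a b.
Proof.
intros Hab Hf Hg. apply quadratic_nonneg_disc.
- apply RI_nonneg; [auto|cont|]. intros; apply pow2_ge_0.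
- intros l.
  replace (RInt (fun x => f x ^ 2) a b + 2 * l * RInt (fun x => f x * g x) a b
     + l ^ 2 * RInt (fun x => g x ^ 2) a b)
   with (RInt (fun x => (f x + l * g x) ^ 2) a b).
  + apply RI_nonneg; [auto|cont|]. intros; apply pow2_ge_0.
  + rewrite <- RI_scal by cont. rewrite <- RI_scal by cont.
    rewrite <- RI_plus by cont. rewrite <- RI_plus by cont.
    apply RI_ext; [exact Hab|]. intros; ring.
Qed.

Lemma RI_sqr_eq0 (f : R -> R) a b : a < b -> cont f -> RInt (fun x => f x ^ 2) a b = 0 ->
  forall x, a <= x <= b -> f x = 0.
Proof.
intros Hab Hf H0.
assert (Hop : forall x, a < x < b -> f x = 0).
{ intros x Hx. destruct (Req_dec (f x) 0) as [E|E]; [exact E|exfalso].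
  destruct (proj1 (cont_eps f x) (Hf x) (Rabs (f x) / 2)) as [d [Hd H]].
  { assert (P := Rabs_pos_lt _ E). lra. }
  set (e := Rmin (d / 2) (Rmin (x - a) (b - x))).
  assert (He : 0 < e) by (unfold e; repeat apply Rmin_glb_lt; lra).
  assert (He1 : e <= d / 2) by apply Rmin_l.
  assert (He2 : e <= x - a) by (eapply Rle_trans; [apply Rmin_r|apply Rmin_l]).
  assert (He3 : e <= b - x) by (eapply Rle_trans; [apply Rmin_r|apply Rmin_r]).
  assert (C2 : cont (fun x => f x ^ 2)) by cont.
  assert (Hpos : forall u v, u <= v -> 0 <= RInt (fun x => f x ^ 2) u v).
  { intros u v Huv. apply RI_nonneg; auto. intros; apply pow2_ge_0. }
  assert (Hm : (x + e - (x - e)) * ((Rabs (f x) / 2) ^ 2)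
     <= RInt (fun x => f x ^ 2) (x - e) (x + e)).
  { rewrite <- RI_const. apply RI_le; [lra|cont|cont|].
    intros y Hy. rewrite <- (pow2_abs (f y)). apply pow_incr. split.
    - assert (P := Rabs_pos (f x)). lra.
    - assert (Hy' : Rabs (y - x) < d) by (apply Rabs_def1; lra).
      specialize (H y Hy').
      assert (T := Rabs_triang (f y) (f x - f y)).
      replace (f y + (f x - f y)) with (f x) in T by ring.
      rewrite (Rabs_minus_sym (f x)) in T. lra. }
  assert (0 < (x + e - (x - e)) * ((Rabs (f x) / 2) ^ 2)).
  { apply Rmult_lt_0_compat; [lra|]. apply pow_lt.
    assert (P := Rabs_pos_lt _ E). lra. }
  assert (Hx1 := Hpos a (x - e) ltac:(lra)). assert (Hx2 := Hpos (x + e) b ltac:(lra)).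
  rewrite <- (RI_Chasles _ a (x - e) b C2) in H0.
  rewrite <- (RI_Chasles _ (x - e) (x + e) b C2) in H0. lra. }
intros x Hx. destruct (Req_dec (f x) 0) as [E|E]; [exact E|exfalso].
destruct (proj1 (cont_eps f x) (Hf x) (Rabs (f x))) as [d [Hd H]].
{ now apply Rabs_pos_lt. }
(* Here [x] may be an endpoint. It is approached from the interior by moving the small fraction [l]
   of the way towards the midpoint. *)
assert (Hy : exists y, a < y < b /\ Rabs (y - x) < d).
{ set (m := (a + b) / 2). set (l := Rmin (1 / 2) (d / (2 * (b - a)))).
  assert (Hl : 0 < l).
  { unfold l. apply Rmin_glb_lt; [lra|]. apply Rdiv_lt_0_compat; lra. }
  assert (l <= 1 / 2) by apply Rmin_l.
  assert (Hl2 : l <= d / (2 * (b - a))) by apply Rmin_r.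
  assert (l * (b - a) <= d / 2).
  { apply Rmult_le_compat_r with (r := b - a) in Hl2; [|lra].
    replace (d / (2 * (b - a)) * (b - a)) with (d / 2) in Hl2 by (field; lra). lra. }
  exists (x + l * (m - x)). split.
  - unfold m in *. nra.
  - replace (x + l * (m - x) - x) with (l * (m - x)) by ring.
    rewrite Rabs_mult, (Rabs_pos_eq l) by lra.
    assert (Rabs (m - x) <= b - a) by (apply Rabs_le; unfold m; lra).
    nra. }
destruct Hy as [y [Hy1 Hy2]]. specialize (H y Hy2). rewrite (Hop y Hy1) in H.
replace (0 - f x) with (- f x) in H by ring. rewrite Rabs_Ropp in H. lra.
Qed.

(** * Derivative rules, two-sided and relative to an interval *)

Lemma is_derive_rsum n (f df : nat -> R -> R) x :
  (forall i, (i < n)%nat -> is_derive (f i) x (df i x)) ->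
  is_derive (fun x => rsum n (fun i => f i x)) x (rsum n (fun i => df i x)).
Proof.
induction n as [|n IH]; simpl; intros H.
- apply (is_derive_const 0).
- apply (is_derive_plus (fun x => rsum n (fun i => f i x)) (f n)).
  + apply IH. intros; apply H; lia.
  + apply H; lia.
Qed.

Lemma is_derive_Rmult (f g : R -> R) (x a b : R) :
  is_derive f x a -> is_derive g x b ->
  is_derive (fun y => f y * g y) x (a * g x + f x * b).
Proof.
intros Hf Hg. apply (is_derive_mult f g x a b Hf Hg). intros; apply Rmult_comm.
Qed.

Lemma is_derive_Rscal (f : R -> R) (x c l : R) :
  is_derive f x l -> is_derive (fun y => c * f y) x (c * l).
Proof. intros H. exact (is_derive_scal f x c l H). Qed.

Lemma is_derive_Rplus (f g : R -> R) (x a b : R) :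
  is_derive f x a -> is_derive g x b -> is_derive (fun y => f y + g y) x (a + b).
Proof. intros Hf Hg. exact (is_derive_plus f g x a b Hf Hg). Qed.

Lemma is_derive_Rminus (f g : R -> R) (x a b : R) :
  is_derive f x a -> is_derive g x b -> is_derive (fun y => f y - g y) x (a - b).
Proof. intros Hf Hg. exact (is_derive_minus f g x a b Hf Hg). Qed.

Lemma is_derive_eq (f : R -> R) (x l l' : R) : is_derive f x l -> l = l' -> is_derive f x l'.
Proof. now intros H <-. Qed.

Lemma is_derive_eps (f : R -> R) (x l : R) : is_derive f x l <->
  forall eps, 0 < eps -> exists d, 0 < d /\ forall y, Rabs (y - x) < d ->
    Rabs (f y - f x - (y - x) * l) <= eps * Rabs (y - x).
Proof.
split.
- intros [_ H] eps He.
  destruct (H x (fun P HP => HP) (mkposreal eps He)) as [d Hd].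
  exists d. split; [apply cond_pos|]. intros y Hy. exact (Hd y Hy).
- intros H. split; [apply (is_linear_scal_l (K := R_AbsRing) (V := R_NormedModule) l)|].
  intros y Hy. apply (is_filter_lim_locally_unique (V := R_NormedModule)) in Hy. subst y. intros eps.
  destruct (H eps (cond_pos eps)) as [d [Hd H1]].
  exists (mkposreal d Hd). intros y Hy. exact (H1 y Hy).
Qed.

Lemma interval_proper a b x : a < b -> interval a b x ->
  ProperFilter (within (interval a b) (locally x)).
Proof.
intros Hab Hx. split.
- intros P [d HP]. assert (Hd := cond_pos d). unfold interval in *.
  exists x. apply HP; [apply ball_center|auto].
- apply within_filter. apply locally_filter.
Qed.

Lemma is_derive_on_eps (a b : R) (f : R -> R) (x l : R) : a < b -> interval a b x ->
  is_derive_on (interval a b) f x l <->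
  forall eps, 0 < eps -> exists d, 0 < d /\
    forall y, interval a b y -> Rabs (y - x) < d ->
    Rabs (f y - f x - (y - x) * l) <= eps * Rabs (y - x).
Proof.
intros Hab Hx. split.
- intros [_ H] eps He.
  destruct (H x (fun P HP => filter_le_within _ P HP) (mkposreal eps He)) as [d Hd].
  exists d. split; [apply cond_pos|]. intros y Hy1 Hy. exact (Hd y Hy Hy1).
- intros H. split; [apply (is_linear_scal_l (K := R_AbsRing) (V := R_NormedModule) l)|].
  intros y Hy.
  assert (y = x).
  { symmetry. assert (Hp := interval_proper a b x Hab Hx).
    apply (is_filter_lim_unique (V := R_NormedModule) (F := within (interval a b) (locally x))).
    - intros P HP. now apply filter_le_within.
    - exact Hy. }
  subst y. intros eps.
  destruct (H eps (cond_pos eps)) as [d [Hd H1]].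
  exists (mkposreal d Hd). intros y Hy1 Hy2. exact (H1 y Hy2 Hy1).
Qed.

Lemma is_derive_on_of a b (f : R -> R) x l : a < b -> interval a b x ->
  is_derive f x l -> is_derive_on (interval a b) f x l.
Proof.
intros Hab Hx H. apply is_derive_on_eps; auto. intros eps He.
destruct (proj1 (is_derive_eps f x l) H eps He) as [d [Hd H1]].
exists d. split; auto.
Qed.

Lemma is_derive_on_open a b (f : R -> R) x l : a < x < b ->
  is_derive_on (interval a b) f x l -> is_derive f x l.
Proof.
intros Hx H. apply is_derive_eps. intros eps He.
assert (Hx' : interval a b x) by (unfold interval; lra).
destruct (proj1 (is_derive_on_eps a b f x l ltac:(lra) Hx') H eps He) as [d [Hd H1]].
exists (Rmin d (Rmin (x - a) (b - x))). split; [repeat apply Rmin_glb_lt; lra|].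
intros y Hy.
assert (Rabs (y - x) < d) by (eapply Rlt_le_trans; [exact Hy|apply Rmin_l]).
assert (Rabs (y - x) < x - a).
{ eapply Rlt_le_trans; [exact Hy|]. eapply Rle_trans; [apply Rmin_r|apply Rmin_l]. }
assert (Rabs (y - x) < b - x).
{ eapply Rlt_le_trans; [exact Hy|]. eapply Rle_trans; [apply Rmin_r|apply Rmin_r]. }
assert (A1 := Rabs_def2 _ _ H2). assert (A2 := Rabs_def2 _ _ H3).
apply H1; [unfold interval; lra|auto].
Qed.

Lemma is_derive_on_ext a b (f g : R -> R) x l : a < b -> interval a b x ->
  (forall y, interval a b y -> f y = g y) ->
  is_derive_on (interval a b) f x l -> is_derive_on (interval a b) g x l.
Proof.
intros Hab Hx E H. apply is_derive_on_eps; auto. intros eps He.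
destruct (proj1 (is_derive_on_eps a b f x l Hab Hx) H eps He) as [d [Hd H1]].
exists d. split; auto. intros y Hy Hyd. rewrite <- !E by auto. auto.
Qed.

Lemma is_derive_on_lin a b (f g : R -> R) x l m c : a < b -> interval a b x ->
  is_derive_on (interval a b) f x l -> is_derive_on (interval a b) g x m ->
  is_derive_on (interval a b) (fun y => f y + c * g y) x (l + c * m).
Proof.
intros Hab Hx Hf Hg. apply is_derive_on_eps; auto. intros eps He.
assert (Hc := Rabs_pos c).
assert (He' : 0 < eps / 2 / (Rabs c + 1)) by (repeat apply Rdiv_lt_0_compat; lra).
destruct (proj1 (is_derive_on_eps a b f x l Hab Hx) Hf (eps / 2)) as [d [Hd H1]];
  [lra|].
destruct (proj1 (is_derive_on_eps a b g x m Hab Hx) Hg _ He') as [d' [Hd' H2]].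
exists (Rmin d d'). split; [now apply Rmin_glb_lt|]. intros y Hy Hyd.
specialize (H1 y Hy (Rlt_le_trans _ _ _ Hyd (Rmin_l _ _))).
specialize (H2 y Hy (Rlt_le_trans _ _ _ Hyd (Rmin_r _ _))).
replace (f y + c * g y - (f x + c * g x) - (y - x) * (l + c * m))
 with ((f y - f x - (y - x) * l) + c * (g y - g x - (y - x) * m)) by ring.
eapply Rle_trans; [apply Rabs_triang|]. rewrite Rabs_mult.
assert (Hle : Rabs c * Rabs (g y - g x - (y - x) * m) <= eps / 2 * Rabs (y - x)).
{ apply Rle_trans with (Rabs c * (eps / 2 / (Rabs c + 1) * Rabs (y - x))).
  - apply Rmult_le_compat_l; auto.
  - assert (P := Rabs_pos (y - x)).
    replace (Rabs c * (eps / 2 / (Rabs c + 1) * Rabs (y - x)))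
      with (eps / 2 * Rabs (y - x) * (Rabs c / (Rabs c + 1))) by (field; lra).
    rewrite <- (Rmult_1_r (eps / 2 * Rabs (y - x))) at 2.
    apply Rmult_le_compat_l; [nra|].
    apply Rmult_le_reg_r with (Rabs c + 1); [lra|].
    unfold Rdiv. rewrite Rmult_assoc, Rinv_l by lra. lra. }
lra.
Qed.

(** The nearest-point map onto [a,b]. Composition with it extends a function from [a,b] to R,
    keeping continuity and bounds. *)
Definition clamp (a b x : R) : R := Rmax a (Rmin b x).

Lemma clamp_in a b x : a <= b -> a <= clamp a b x <= b.
Proof.
intros H. unfold clamp. split; [apply Rmax_l|].
apply Rmax_lub; [lra|apply Rmin_l].
Qed.

Lemma clamp_id a b x : a <= x <= b -> clamp a b x = x.
Proof. intros H. unfold clamp. rewrite Rmin_right by lra. apply Rmax_right. lra. Qed.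

Lemma clamp_lip a b x y : Rabs (clamp a b x - clamp a b y) <= Rabs (x - y).
Proof.
unfold clamp, Rmax, Rmin.
repeat destruct Rle_dec; unfold Rabs; repeat destruct Rcase_abs; lra.
Qed.

Lemma cont_clamp a b : cont (clamp a b).
Proof. apply cont_lip with 1. intros. rewrite Rmult_1_l. apply clamp_lip. Qed.

Lemma continuous_on_clamp a b (f : R -> R) : a <= b -> continuous_on (interval a b) f ->
  cont (fun x => f (clamp a b x)).
Proof.
intros Hab H x. apply cont_eps. intros eps He.
destruct (H (clamp a b x) (clamp_in a b x Hab)
  (fun z => Rabs (z - f (clamp a b x)) < eps)) as [d Hd].
{ exists (mkposreal eps He). intros z Hz. exact Hz. }
exists d. split; [apply cond_pos|]. intros y Hy. apply Hd; [|now apply clamp_in].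
eapply Rle_lt_trans; [apply clamp_lip|exact Hy].
Qed.

Lemma continuous_on_of_cont a b (f g : R -> R) : cont g ->
  (forall x, interval a b x -> f x = g x) -> continuous_on (interval a b) f.
Proof.
intros Hg E x Hx P [eps HP].
destruct (proj1 (cont_eps g x) (Hg x) eps (cond_pos eps)) as [d [Hd H]].
exists (mkposreal d Hd). intros y Hy Hy2. apply HP. rewrite !E by auto.
apply H. exact Hy.
Qed.

Lemma cont_bounded (f : R -> R) a b : a <= b -> cont f ->
  exists M, 0 <= M /\ forall x, a <= x <= b -> Rabs (f x) <= M.
Proof.
intros Hab H. destruct (bounded_continuity f a b) as [M HM].
- intros x _. apply H.
- exists M. split.
  + specialize (HM a ltac:(lra)). assert (P := norm_ge_0 (f a)). lra.
  + intros x Hx. left. exact (HM x Hx).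
Qed.

(** * Functions of two variables *)

Definition cont2 (f : R -> R -> R) : Prop := forall x y, continuity_2d_pt f x y.

Lemma cont2_mult (f g : R -> R -> R) : cont2 f -> cont2 g -> cont2 (fun x y => f x y * g x y).
Proof. intros Hf Hg x y. apply continuity_2d_pt_mult; auto. Qed.
Lemma cont2_plus (f g : R -> R -> R) : cont2 f -> cont2 g -> cont2 (fun x y => f x y + g x y).
Proof. intros Hf Hg x y. apply continuity_2d_pt_plus; auto. Qed.
Lemma cont2_1 (f : R -> R) : cont f -> cont2 (fun x _ => f x).
Proof.
intros Hf x y eps. destruct (proj1 (cont_eps f x) (Hf x) eps (cond_pos eps)) as [d [Hd H]].
exists (mkposreal d Hd). intros u v Hu _. now apply H.
Qed.
Lemma cont2_const c : cont2 (fun _ _ => c).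
Proof. apply (cont2_1 (fun _ => c)), cont_const. Qed.
Lemma cont2_x (f : R -> R -> R) y : cont2 f -> cont (fun x => f x y).
Proof.
intros Hf x. apply cont_eps. intros eps He. destruct (Hf x y (mkposreal eps He)) as [d Hd].
exists d. split; [apply cond_pos|]. intros z Hz. apply (Hd z y Hz).
rewrite Rminus_diag, Rabs_R0. apply cond_pos.
Qed.
Lemma cont2_y (f : R -> R -> R) x : cont2 f -> cont (fun y => f x y).
Proof.
intros Hf y. apply cont_eps. intros eps He. destruct (Hf x y (mkposreal eps He)) as [d Hd].
exists d. split; [apply cond_pos|]. intros z Hz. apply (Hd x z); [|exact Hz].
rewrite Rminus_diag, Rabs_R0. apply cond_pos.
Qed.

(** Compactness enters through uniform continuity: the one-variable bound holds on the line [y = c],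
    and every further strip of width [e / 2] raises it by at most 1. *)
Lemma cont2_bounded (f : R -> R -> R) a b c d : a <= b -> c <= d -> cont2 f ->
  exists M, 0 <= M /\
    forall x y, a <= x <= b -> c <= y <= d -> Rabs (f x y) <= M.
Proof.
intros Hab Hcd Hf.
destruct (uniform_continuity_2d f a b c d (fun x y _ _ => Hf x y) (mkposreal 1 Rlt_0_1))
  as [e He]. simpl in He.
assert (Hep := cond_pos e).
destruct (cont_bounded (fun x => f x c) a b Hab (cont2_x f c Hf)) as [M0 [HM0 HM]].
assert (Hk : forall k x y, a <= x <= b -> c <= y <= d -> y <= c + INR k * (e / 2) ->
  Rabs (f x y) <= M0 + INR k).
{ induction k as [|k IH]; intros x y Hx Hy Hyk.
  - simpl in Hyk. replace y with c by lra. specialize (HM x Hx). simpl in *. lra.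
  - rewrite S_INR in *. destruct (Rle_dec y (c + INR k * (e / 2))) as [H|H].
    + specialize (IH x y Hx Hy H). lra.
    + set (y' := c + INR k * (e / 2)) in *.
      assert (Hy' : c <= y' <= d).
      { assert (0 <= INR k * (e / 2)) by (apply Rmult_le_pos; [apply pos_INR|lra]).
        unfold y' in *; lra. }
      specialize (IH x y' Hx Hy' ltac:(unfold y'; lra)).
      assert (H1 : Rabs (f x y - f x y') < 1).
      { apply He; auto.
        - rewrite Rminus_diag, Rabs_R0. lra.
        - apply Rabs_def1; unfold y' in *; lra. }
      assert (Tr := Rabs_triang (f x y - f x y') (f x y')).
      replace (f x y - f x y' + f x y') with (f x y) in Tr by ring. lra. }
destruct (nfloor_ex ((d - c) / (e / 2))) as [k Hk2].
{ apply Rle_div_r; lra. }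
exists (M0 + INR (S k)). split.
- assert (P := pos_INR (S k)). lra.
- intros x y Hx Hy. apply Hk; auto. rewrite S_INR.
  assert (H : (d - c) / (e / 2) < INR k + 1) by tauto.
  apply Rlt_div_l in H; lra.
Qed.

Lemma cont_RI_param (g : R -> R -> R) : cont2 g -> cont (fun t => RInt (fun x => g x t) 0 1).
Proof.
intros Hg t. apply cont_eps. intros eps He.
assert (He2 : 0 < eps / 2) by lra.
destruct (uniform_continuity_2d g 0 1 (t - 1) (t + 1) (fun x y _ _ => Hg x y)
  (mkposreal _ He2)) as [e H]. simpl in H. assert (Hep := cond_pos e).
exists (Rmin 1 e). split; [apply Rmin_glb_lt; lra|].
intros s Hs.
assert (Hs1 : Rabs (s - t) < 1) by (eapply Rlt_le_trans; [exact Hs|apply Rmin_l]).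
assert (Hs2 : Rabs (s - t) < e) by (eapply Rlt_le_trans; [exact Hs|apply Rmin_r]).
assert (A := Rabs_def2 _ _ Hs1).
rewrite <- RI_minus by now apply cont2_x.
apply Rle_lt_trans with ((1 - 0) * (eps / 2)); [|lra].
apply RI_abs_le; [lra| |].
- apply cont_minus; now apply cont2_x.
- intros x Hx. left. apply H; try lra. rewrite Rminus_diag, Rabs_R0. lra.
Qed.

(** For each [x] the mean value theorem in time writes the difference quotient as [gt] at an
    intermediate time; uniform continuity makes this close to [gt x t] at the same rate for all
    [x]. *)
Lemma is_derive_RI_param (g gt : R -> R -> R) T : cont2 g -> cont2 gt ->
  (forall x t, 0 <= x <= 1 -> 0 < t < T -> is_derive (fun s => g x s) t (gt x t)) ->
  forall t, 0 < t < T ->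
  is_derive (fun t => RInt (fun x => g x t) 0 1) t (RInt (fun x => gt x t) 0 1).
Proof.
intros Hg Hgt Hd t Ht. apply is_derive_eps. intros eps He.
destruct (uniform_continuity_2d gt 0 1 0 T (fun x y _ _ => Hgt x y)
  (mkposreal _ He)) as [e H]. simpl in H. assert (Hep := cond_pos e).
exists (Rmin e (Rmin t (T - t))). split; [repeat apply Rmin_glb_lt; lra|].
intros s Hs.
assert (Hs1 : Rabs (s - t) < e) by (eapply Rlt_le_trans; [exact Hs|apply Rmin_l]).
assert (Hs2 : Rabs (s - t) < t).
{ eapply Rlt_le_trans; [exact Hs|]. eapply Rle_trans; [apply Rmin_r|apply Rmin_l]. }
assert (Hs3 : Rabs (s - t) < T - t).
{ eapply Rlt_le_trans; [exact Hs|]. eapply Rle_trans; [apply Rmin_r|apply Rmin_r]. }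
apply Rabs_def2 in Hs2. apply Rabs_def2 in Hs3.
rewrite <- RI_minus by now apply cont2_x.
rewrite <- RI_scal by now apply cont2_x.
assert (C1 : cont (fun x => g x s - g x t)) by (apply cont_minus; now apply cont2_x).
assert (C2 : cont (fun x => (s - t) * gt x t))
  by (apply cont_mult; [apply cont_const|now apply cont2_x]).
rewrite <- RI_minus by auto.
replace (eps * Rabs (s - t)) with ((1 - 0) * (eps * Rabs (s - t))) by ring.
apply RI_abs_le; [lra| |].
{ now apply cont_minus. }
intros x Hx.
destruct (Req_dec s t) as [->|Est].
{ rewrite !Rminus_diag, Rabs_R0. replace (0 - 0 * gt x t) with 0 by ring.
  rewrite Rabs_R0. lra. }
assert (Hc : exists c, 0 <= c <= T /\ Rabs (c - t) <= Rabs (s - t) /\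
  g x s - g x t = gt x c * (s - t)).
{ destruct (Rlt_dec t s) as [L|L].
  - destruct (MVT_open (fun s => g x s) (fun s => gt x s) t s L) as [c [Hc Ec]].
    + now apply cont2_y.
    + intros; apply Hd; lra.
    + exists c. split; [lra|]. split; [|exact Ec]. rewrite !Rabs_pos_eq; lra.
  - destruct (MVT_open (fun s => g x s) (fun s => gt x s) s t ltac:(lra)) as [c [Hc Ec]].
    + now apply cont2_y.
    + intros; apply Hd; lra.
    + exists c. split; [lra|]. split; [|lra]. rewrite !Rabs_left1; lra. }
destruct Hc as [c [Hc1 [Hc2 ->]]].
replace (gt x c * (s - t) - (s - t) * gt x t) with ((gt x c - gt x t) * (s - t)) by ring.
rewrite Rabs_mult. apply Rmult_le_compat_r; [apply Rabs_pos|].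
left. apply H; try lra. rewrite Rminus_diag, Rabs_R0. lra.
Qed.

Lemma continuous_on_clamp2 T (f : R -> R -> R) : 0 <= T ->
  continuous_on (fun p : R * R => interval 0 1 (fst p) /\ interval 0 T (snd p))
    (fun p : R * R => f (fst p) (snd p)) ->
  cont2 (fun x t => f (clamp 0 1 x) (clamp 0 T t)).
Proof.
intros HT H x t eps.
destruct (H (clamp 0 1 x, clamp 0 T t)
  (conj (clamp_in 0 1 x Rle_0_1) (clamp_in 0 T t HT))
  (fun z => Rabs (z - f (clamp 0 1 x) (clamp 0 T t)) < eps)) as [d Hd].
{ exists eps. intros z Hz. exact Hz. }
exists d. intros u v Hu Hv.
apply (Hd (clamp 0 1 u, clamp 0 T v)).
- split; simpl.
  + eapply Rle_lt_trans; [apply clamp_lip|exact Hu].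
  + eapply Rle_lt_trans; [apply clamp_lip|exact Hv].
- split; apply clamp_in; lra.
Qed.

Lemma gronwall (E dE : R -> R) (T C D : R) : 0 <= C -> 0 <= D -> cont E ->
  (forall t, 0 < t < T -> is_derive E t (dE t) /\ dE t <= C * E t + D) ->
  forall t, 0 <= t <= T -> E t <= (E 0 + D * t) * exp (C * t).
Proof.
intros HC HD HE Hd t Ht.
destruct (Req_dec t 0) as [->|E0].
{ rewrite !Rmult_0_r, exp_0. lra. }
(* The mean value theorem may return an endpoint, where the differential inequality is not known.
   Taking the minimum with 0 gives a function that is nonpositive everywhere and still equals the
   derivative inside. *)
destruct (MVT_open (fun s => E s * exp (- C * s) - D * s)
  (fun s => Rmin 0 (dE s * exp (- C * s) + E s * (- C * exp (- C * s)) - D)) 0 t)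
  as [c [Hc Ec]].
- lra.
- apply cont_minus; [apply cont_mult; [exact HE|]|cont].
  apply is_derive_cont with (fun s => - C * exp (- C * s)).
  intros s. auto_derive; [auto|ring].
- intros s Hs. assert (Hs' : 0 < s < T) by lra. destruct (Hd s Hs') as [H1 H2].
  assert (Hle : dE s * exp (- C * s) + E s * (- C * exp (- C * s)) - D <= 0).
  { assert (X1 := exp_pos (- C * s)).
    assert (X2 : exp (- C * s) <= 1).
    { rewrite <- exp_0. destruct (Req_dec C 0) as [->|EC].
      - right. f_equal. ring.
      - left. apply exp_increasing. nra. }
    assert (dE s * exp (- C * s) <= (C * E s + D) * exp (- C * s))
      by (apply Rmult_le_compat_r; lra).
    nra. }
  rewrite Rmin_right by exact Hle.
  eapply is_derive_eq.
  + apply is_derive_Rminus.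
    * apply is_derive_Rmult; [exact H1|].
      instantiate (1 := - C * exp (- C * s)). auto_derive; [auto|ring].
    * instantiate (1 := D). auto_derive; [auto|ring].
  + cbv beta. ring.
- assert (Hm := Rmin_l 0 (dE c * exp (- C * c) + E c * (- C * exp (- C * c)) - D)).
  set (m := Rmin _ _) in *.
  rewrite !Rmult_0_r, exp_0 in Ec.
  assert (m * (t - 0) <= 0) by nra.
  assert (Hle : E t * exp (- C * t) <= E 0 + D * t) by lra.
  apply Rmult_le_compat_r with (r := exp (C * t)) in Hle; [|left; apply exp_pos].
  rewrite Rmult_assoc, <- exp_plus in Hle.
  replace (- C * t + C * t) with 0 in Hle by ring. rewrite exp_0 in Hle. lra.
Qed.

(** * Polynomials in a scaled local variable *)

Lemma rsum_Sl n (f : nat -> R) : rsum (S n) f = f O + rsum n (fun i => f (S i)).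
Proof. induction n as [|n IH]; [simpl; ring|]. simpl in *. rewrite IH. ring. Qed.

Definition ispoly (r : nat) (f : R -> R) : Prop :=
  exists a : nat -> R, forall x, f x = rsum r (fun k => a k * x ^ k).

(** In the scaled variable the coefficients are of the same size as the values on a cell, with
    constants that do not depend on [h]. *)
Definition lp (r : nat) (a : nat -> R) (x0 h x : R) : R :=
  rsum r (fun k => a k * ((x - x0) / h) ^ k).

Definition dlp (r : nat) (a : nat -> R) (x0 h x : R) : R :=
  rsum r (fun k => a k * (INR k * ((x - x0) / h) ^ pred k / h)).

Lemma ispoly_lin r f g c : ispoly r f -> ispoly r g ->
  ispoly r (fun x => f x + c * g x).
Proof.
intros [a Ha] [b Hb]. exists (fun k => a k + c * b k). intros x.
rewrite Ha, Hb, <- rsum_scal, <- rsum_plus. apply rsum_ext. intros; ring.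
Qed.

Lemma ispoly_0 r : ispoly r (fun _ => 0).
Proof. exists (fun _ => 0). intros x. rewrite rsum_eq0; auto. intros; ring. Qed.

Lemma ispoly_ext r f g : (forall x, f x = g x) -> ispoly r f -> ispoly r g.
Proof. intros E [a Ha]. exists a. intros x. now rewrite <- E. Qed.

Lemma ispoly_scal r f c : ispoly r f -> ispoly r (fun x => c * f x).
Proof.
intros H. apply ispoly_ext with (fun x => 0 + c * f x); [intros; ring|].
apply (ispoly_lin r (fun _ => 0)); [apply ispoly_0|exact H].
Qed.

Lemma ispoly_rsum r n (f : nat -> R -> R) :
  (forall i, (i < n)%nat -> ispoly r (f i)) ->
  ispoly r (fun x => rsum n (fun i => f i x)).
Proof.
induction n as [|n IH]; simpl; intros H; [apply ispoly_0|].
apply ispoly_ext with (fun x => rsum n (fun i => f i x) + 1 * f n x);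
  [intros; ring|].
apply ispoly_lin; [apply IH; intros; apply H; lia|apply H; lia].
Qed.

Lemma ispoly_pow m : forall r al be, (m < r)%nat ->
  ispoly r (fun x => (al * x + be) ^ m).
Proof.
induction m as [|m IH]; intros r al be Hr.
- exists (fun k => if Nat.eq_dec k 0 then 1 else 0). intros x.
  rewrite (rsum_single r 0); [simpl; ring|exact Hr|].
  intros j _ Hj. destruct (Nat.eq_dec j 0); [lia|ring].
- destruct r as [|r]; [lia|].
  destruct (IH r al be) as [a Ha]; [lia|].
  exists (fun k => (match k with O => 0 | S k' => al * a k' end)
     + (if Nat.eq_dec k r then 0 else be * a k)). intros x.
  simpl pow. rewrite Ha.
  rewrite (rsum_ext (S r) _ (fun k =>
     (match k with O => 0 | S k' => al * a k' end) * x ^ k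
     + (if Nat.eq_dec k r then 0 else be * a k) * x ^ k)) by (intros; ring).
  rewrite rsum_plus, rsum_Sl. cbn [rsum].
  destruct (Nat.eq_dec r r); [|lia].
  rewrite (rsum_ext r (fun i => (if Nat.eq_dec i r then 0 else be * a i) * x ^ i)
     (fun i => be * (a i * x ^ i)))
    by (intros i Hi; destruct (Nat.eq_dec i r); [lia|ring]).
  rewrite (rsum_ext r (fun i => al * a i * x ^ S i) (fun i => (al * x) * (a i * x ^ i)))
    by (intros; simpl; ring).
  rewrite !rsum_scal. simpl. ring.
Qed.

Lemma ispoly_lp r a x0 h : h <> 0 -> ispoly r (lp r a x0 h).
Proof.
intros Hh. unfold lp. apply ispoly_rsum. intros k Hk. apply ispoly_scal.
apply ispoly_ext with (fun x => (/ h * x + (- x0 / h)) ^ k).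
- intros x. f_equal. field. exact Hh.
- now apply ispoly_pow.
Qed.

Lemma lp_of_ispoly r f x0 h : h <> 0 -> ispoly r f ->
  exists a, forall x, f x = lp r a x0 h x.
Proof.
intros Hh [c Hc].
destruct (ispoly_rsum r r (fun k y => c k * (h * y + x0) ^ k)) as [a Ha].
- intros k Hk. apply ispoly_scal, ispoly_pow. exact Hk.
- exists a. intros x. rewrite Hc. unfold lp. rewrite <- Ha.
  apply rsum_ext. intros k _. f_equal. f_equal. field. exact Hh.
Qed.

Lemma is_derive_lp r a x0 h x : is_derive (lp r a x0 h) x (dlp r a x0 h x).
Proof.
apply (is_derive_rsum r (fun k x => a k * ((x - x0) / h) ^ k)
  (fun k x => a k * (INR k * ((x - x0) / h) ^ pred k / h))).
intros k _. auto_derive; [auto|]. unfold Rdiv, Rminus. ring.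
Qed.

Lemma cont_lp r a x0 h : cont (lp r a x0 h).
Proof. apply is_derive_cont with (dlp r a x0 h). intros. apply is_derive_lp. Qed.

Lemma Rabs_pow_le1 y k : Rabs y <= 1 -> Rabs (y ^ k) <= 1.
Proof.
intros H. rewrite <- RPow_abs. rewrite <- (pow1 k). apply pow_incr.
split; [apply Rabs_pos|exact H].
Qed.

Lemma lp_bound r a x0 h A x : 0 < h -> (forall k, (k < r)%nat -> Rabs (a k) <= A) ->
  Rabs (x - x0) <= h -> Rabs (lp r a x0 h x) <= INR r * A.
Proof.
intros Hh Ha Hx. unfold lp. apply rsum_abs_bound. intros k Hk.
rewrite Rabs_mult. rewrite <- (Rmult_1_r A).
apply Rmult_le_compat; auto using Rabs_pos. apply Rabs_pow_le1.
rewrite Rabs_div, (Rabs_pos_eq h) by lra. apply Rle_div_l; lra.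
Qed.

Lemma dlp_bound r a x0 h A x : 0 < h -> (forall k, (k < r)%nat -> Rabs (a k) <= A) ->
  Rabs (x - x0) <= h -> Rabs (dlp r a x0 h x) <= INR r * (A * (INR r / h)).
Proof.
intros Hh Ha Hx. unfold dlp. apply rsum_abs_bound. intros k Hk.
rewrite Rabs_mult. apply Rmult_le_compat; auto using Rabs_pos.
rewrite Rabs_div, (Rabs_pos_eq h) by lra.
apply Rmult_le_compat_r; [left; now apply Rinv_0_lt_compat|].
rewrite Rabs_mult, (Rabs_pos_eq (INR k)) by apply pos_INR.
rewrite <- (Rmult_1_r (INR r)).
apply Rmult_le_compat; [apply pos_INR|apply Rabs_pos|apply le_INR; lia|].
apply Rabs_pow_le1. rewrite Rabs_div, (Rabs_pos_eq h) by lra. apply Rle_div_l; lra.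
Qed.

(* The values of the primitive of [p] are bounded by the L2 norm of [p], and its
   coefficients are recovered from its values at [r] fixed points. *)
Lemma poly_coef_L2 (r : nat) (kappa : R) : 1 <= kappa ->
  exists C, 0 <= C /\ forall h x0 l a, 0 < h -> h / kappa <= l <= h ->
  forall k, (k < r)%nat ->
  a k ^ 2 * h <= C * RInt (fun x => lp r a x0 h x ^ 2) x0 (x0 + l).
Proof.
intros Hka. destruct r as [|r'].
{ exists 0. split; [lra|]. intros; lia. }
set (r := S r'). set (rr := INR r).
assert (Hr : 0 < rr) by (apply lt_0_INR; unfold r; lia).
assert (Hkr : 0 < kappa * rr) by nra.
destruct (moments_solve r 1 (/ (kappa * rr))) as [C [HC Hmom]];
  [lra|now apply Rinv_0_lt_compat|].
(* The sample points [x0 + h * y m] stay inside the cell because [y m <= / kappa] while the cell has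
   length at least [h / kappa]; consecutive ones are separated by a fixed fraction of [h]. *)
set (y := fun m : nat => (INR m + 1) / (kappa * rr)).
assert (Hy0 : forall m, / (kappa * rr) <= y m).
{ intros m. unfold y, Rdiv. assert (P := pos_INR m).
  assert (0 < / (kappa * rr)) by now apply Rinv_0_lt_compat. nra. }
assert (Hyi : 0 < / (kappa * rr)) by now apply Rinv_0_lt_compat.
assert (Hy1 : forall m, (m < r)%nat -> y m <= / kappa).
{ intros m Hm. unfold y. apply Rle_div_l; [exact Hkr|].
  rewrite <- Rmult_assoc, Rinv_l, Rmult_1_l by lra.
  rewrite <- S_INR. apply le_INR. lia. }
assert (Hka1 : / kappa <= 1) by (rewrite <- Rinv_1; apply Rinv_le_contravar; lra).
specialize (Hmom y).
exists (rr ^ 2 * (rr * C) ^ 2 * (kappa * rr)). split.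
{ repeat apply Rmult_le_pos; try nra. }
intros h x0 l a Hh Hl k Hk.
(* The mean of the polynomial over [[x0, x0 + h * y m]] is a polynomial in [y m] with coefficients
   [a j / (j + 1)]. Weights with these moments annihilate every power except the [k]-th and so read
   off [a k]. *)
destruct Hmom with (b := fun m => if Nat.eq_dec m k then 1 else 0) (B := 1)
  as [d [Hd Hm]].
- intros m Hm. specialize (Hy1 m Hm). specialize (Hy0 m). apply Rabs_le. lra.
- intros i j _ _ Hij. unfold y.
  replace ((INR i + 1) / (kappa * rr) - (INR j + 1) / (kappa * rr))
    with ((INR i - INR j) * / (kappa * rr)) by (field; lra).
  rewrite Rabs_mult, (Rabs_pos_eq (/ _)) by lra.
  rewrite <- (Rmult_1_l (/ (kappa * rr))) at 1.
  apply Rmult_le_compat_r; [lra|].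
  destruct (Nat.lt_total i j) as [H|[H|H]]; [|lia|].
  + rewrite Rabs_minus_sym, Rabs_pos_eq.
    * rewrite <- minus_INR by lia. apply (le_INR 1). lia.
    * rewrite <- minus_INR by lia. apply pos_INR.
  + rewrite Rabs_pos_eq.
    * rewrite <- minus_INR by lia. apply (le_INR 1). lia.
    * rewrite <- minus_INR by lia. apply pos_INR.
- lra.
- intros m _. destruct (Nat.eq_dec m k); [rewrite Rabs_R1|rewrite Rabs_R0]; lra.
- set (I := RInt (fun x => lp r a x0 h x ^ 2) x0 (x0 + l)).
  assert (Hlp := cont_lp r a x0 h).
  assert (Hl0 : 0 < l).
  { apply Rlt_le_trans with (h / kappa); [apply Rdiv_lt_0_compat; lra|lra]. }
  assert (HI : 0 <= I).
  { apply RI_nonneg; [lra|cont|]. intros; apply pow2_ge_0. }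
  set (F := fun m => RInt (lp r a x0 h) x0 (x0 + h * y m)).
  assert (HF : forall m, F m = h * y m * rsum r (fun j => a j / (INR j + 1) * y m ^ j)).
  { intros m. unfold F.
    assert (0 <= h * y m) by (specialize (Hy0 m); nra).
    rewrite (FTC_open (fun x => h * rsum r (fun j => a j / (INR j + 1) *
      ((x - x0) / h) ^ (S j)))).
    - replace ((x0 - x0) / h) with 0 by (field; lra).
      rewrite (rsum_eq0 r (fun j => a j / (INR j + 1) * 0 ^ S j))
        by (intros; simpl; ring).
      rewrite Rmult_0_r, Rminus_0_r, Rmult_assoc. f_equal. rewrite <- rsum_scal.
      apply rsum_ext. intros j _.
      replace ((x0 + h * y m - x0) / h) with (y m) by (field; lra). simpl; ring.
    - lra.
    - cont.
    - exact Hlp.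
    - intros x _.
      apply is_derive_eq with (h * rsum r (fun j => / h * (a j * ((x - x0) / h) ^ j))).
      + apply is_derive_Rscal.
        apply (is_derive_rsum r (fun j x => a j / (INR j + 1) * ((x - x0) / h) ^ S j)
          (fun j x => / h * (a j * ((x - x0) / h) ^ j))).
        intros j _. assert (P := pos_INR j). auto_derive; [auto|].
        change (match j with O => 1 | S _ => INR j + 1 end) with (INR (S j)).
        rewrite S_INR. unfold Rminus, Rdiv. field. split; lra.
      + rewrite rsum_scal. unfold lp. field. lra. }
  assert (HFb : forall m, (m < r)%nat -> (F m / (h * y m)) ^ 2 * h <= kappa * rr * I).
  { intros m Hm'. specialize (Hy0 m). specialize (Hy1 m Hm').
    assert (Hym : 0 < y m) by lra. assert (Hhy : 0 < h * y m) by nra.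
    assert (Hyl : h * y m <= l).
    { apply Rle_trans with (h / kappa); [|lra]. unfold Rdiv.
      apply Rmult_le_compat_l; lra. }
    assert (CS : F m ^ 2 <= h * y m * I).
    { unfold F. assert (CS := RI_CS (fun _ => 1) (lp r a x0 h) x0 (x0 + h * y m)
        ltac:(lra) (cont_const 1) Hlp).
      rewrite (RI_ext (fun x => 1 * lp r a x0 h x) (lp r a x0 h)) in CS
        by (try lra; intros; ring).
      eapply Rle_trans; [exact CS|].
      rewrite (RI_ext (fun _ => 1 ^ 2) (fun _ => 1)) by (try lra; intros; ring).
      rewrite RI_const.
      replace ((x0 + h * y m - x0) * 1) with (h * y m) by ring.
      apply Rmult_le_compat_l; [lra|]. unfold I.
      rewrite <- (RI_Chasles _ x0 (x0 + h * y m) (x0 + l)) by cont.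
      assert (0 <= RInt (fun x => lp r a x0 h x ^ 2) (x0 + h * y m) (x0 + l)).
      { apply RI_nonneg; [lra|cont|]. intros; apply pow2_ge_0. }
      lra. }
    replace ((F m / (h * y m)) ^ 2 * h) with (F m ^ 2 * / (h * y m ^ 2))
      by (field; lra).
    apply Rle_trans with (h * y m * I * / (h * y m ^ 2)).
    - apply Rmult_le_compat_r; [|exact CS]. left. apply Rinv_0_lt_compat.
      apply Rmult_lt_0_compat; [lra|]. now apply pow_lt.
    - replace (h * y m * I * / (h * y m ^ 2)) with (/ y m * I) by (field; lra).
      apply Rmult_le_compat_r; [exact HI|].
      rewrite <- (Rinv_inv (kappa * rr)). apply Rinv_le_contravar; lra. }
  assert (Hak : a k / (INR k + 1) = rsum r (fun m => d m * (F m / (h * y m)))).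
  { rewrite (rsum_ext r _ (fun m => rsum r (fun j =>
       a j / (INR j + 1) * (d m * y m ^ j)))).
    2:{ intros m Hm'. rewrite HF.
        replace (d m * (h * y m * rsum r (fun j => a j / (INR j + 1) * y m ^ j)
          / (h * y m))) with (d m * rsum r (fun j => a j / (INR j + 1) * y m ^ j)).
        - rewrite <- rsum_scal. apply rsum_ext. intros; ring.
        - field. specialize (Hy0 m). split; lra. }
    rewrite rsum_swap.
    rewrite (rsum_ext r _ (fun j => a j / (INR j + 1) *
      (if Nat.eq_dec j k then 1 else 0))).
    2:{ intros j Hj. rewrite rsum_scal. f_equal. now apply Hm. }
    rewrite (rsum_single r k); [|exact Hk|].
    - destruct (Nat.eq_dec k k); [ring|lia].
    - intros j _ Hj. destruct (Nat.eq_dec j k); [lia|ring]. }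
  assert (Pk := pos_INR k).
  assert (Hk1 : INR k + 1 <= rr).
  { rewrite <- S_INR. apply le_INR. lia. }
  assert (E : a k = (INR k + 1) * rsum r (fun m => d m * (F m / (h * y m)))).
  { rewrite <- Hak. field. lra. }
  rewrite E, Rpow_mult_distr.
  assert (S1 : (rsum r (fun m => d m * (F m / (h * y m)))) ^ 2 * h
     <= (rr * C) ^ 2 * (kappa * rr * I)).
  { eapply Rle_trans.
    - apply Rmult_le_compat_r; [lra|]. apply rsum_sqr_le.
    - fold rr. rewrite Rmult_assoc, (Rmult_comm _ h), <- rsum_scal.
      replace ((rr * C) ^ 2 * (kappa * rr * I))
        with (rr * (rr * (C ^ 2 * (kappa * rr * I)))) by ring.
      apply Rmult_le_compat_l; [lra|]. unfold rr at 1. rewrite <- rsum_const.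
      apply rsum_le. intros m Hm'. rewrite Rpow_mult_distr.
      replace (h * (d m ^ 2 * (F m / (h * y m)) ^ 2))
        with (d m ^ 2 * ((F m / (h * y m)) ^ 2 * h)) by ring.
      specialize (Hd m Hm'). rewrite Rmult_1_r in Hd.
      apply Rmult_le_compat; [apply pow2_ge_0| | |now apply HFb].
      + apply Rmult_le_pos; [apply pow2_ge_0|lra].
      + rewrite <- (pow2_abs (d m)). apply pow_incr. split; [apply Rabs_pos|lra]. }
  rewrite Rmult_assoc.
  replace (rr ^ 2 * (rr * C) ^ 2 * (kappa * rr) * I)
    with (rr ^ 2 * ((rr * C) ^ 2 * (kappa * rr * I))) by ring.
  apply Rmult_le_compat; [apply pow2_ge_0| | |exact S1].
  + apply Rmult_le_pos; [apply pow2_ge_0|lra].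
  + apply pow_incr. lra.
Qed.

(** * Splines *)

(* The nodes beyond [X N = 1] are fictitious; they let the cutoff construction
   below work up to the right end of [0,1]. *)
Definition mesh (kappa h : R) (N : nat) (X : nat -> R) : Prop :=
  0 < h /\ (1 <= N)%nat /\ X O = 0 /\ X N = 1 /\
  forall j, h / kappa <= X (S j) - X j <= h.

Lemma mesh_steps kappa h N X i d : mesh kappa h N X ->
  INR d * (h / kappa) <= X (i + d)%nat - X i <= INR d * h.
Proof.
intros [_ [_ [_ [_ Hs]]]]. induction d as [|d IH].
- rewrite Nat.add_0_r. simpl. lra.
- rewrite Nat.add_succ_r, S_INR. specialize (Hs (i + d)%nat). lra.
Qed.

Lemma mesh_le kappa h N X i j : 0 < kappa -> mesh kappa h N X -> (i <= j)%nat ->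
  X i <= X j.
Proof.
intros Hk Hm Hij. replace j with (i + (j - i))%nat by lia.
assert (H := mesh_steps _ _ _ _ i (j - i) Hm). destruct Hm as [Hh _].
assert (0 <= INR (j - i) * (h / kappa)).
{ apply Rmult_le_pos; [apply pos_INR|]. left. now apply Rdiv_lt_0_compat. }
lra.
Qed.

Lemma mesh_lt kappa h N X j : 0 < kappa -> mesh kappa h N X -> X j < X (S j).
Proof.
intros Hk [Hh [_ [_ [_ Hs]]]]. specialize (Hs j).
assert (0 < h / kappa) by now apply Rdiv_lt_0_compat. lra.
Qed.

Lemma mesh_in kappa h N X j : 0 < kappa -> mesh kappa h N X -> (j <= N)%nat ->
  0 <= X j <= 1.
Proof.
intros Hk Hm Hj. assert (H := Hm). destruct H as [_ [_ [H0 [H1 _]]]].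
rewrite <- H0 at 1. rewrite <- H1. split; apply (mesh_le kappa h N); try assumption; lia.
Qed.

Lemma mesh_locate kappa h N X x : mesh kappa h N X -> 0 <= x <= 1 ->
  exists j, (j < N)%nat /\ X j <= x <= X (S j).
Proof.
intros [_ [HN [H0 [H1 _]]]] Hx.
assert (H : forall n, x <= X n -> (1 <= n)%nat ->
  exists j, (j < n)%nat /\ X j <= x <= X (S j)).
{ induction n as [|n IH]; intros Hxn Hn; [lia|].
  destruct (Rle_dec (X n) x) as [L|L]; [exists n; split; [lia|lra]|].
  destruct n as [|n]; [exfalso; lra|].
  destruct IH as [j [Hj Hj2]]; [lra|lia|]. exists j. split; [lia|exact Hj2]. }
apply H; [lra|exact HN].
Qed.

Lemma RI_mesh kappa h N X f : mesh kappa h N X -> cont f ->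
  RInt f 0 1 = rsum N (fun j => RInt f (X j) (X (S j))).
Proof.
intros [_ [_ [H0 [H1 _]]]] Hf. rewrite <- H1, <- H0. clear H1.
induction N as [|N IH]; simpl.
- apply (RInt_point (V := R_CompleteNormedModule)).
- rewrite <- IH. symmetry. now apply RI_Chasles.
Qed.

Definition tp (n : nat) (t x : R) : R := Rmax 0 (x - t) ^ n.

Lemma tp_left n t x : x <= t -> tp (S n) t x = 0.
Proof. intros H. unfold tp. rewrite Rmax_left by lra. simpl. ring. Qed.

Lemma tp_right n t x : t <= x -> tp n t x = (x - t) ^ n.
Proof. intros H. unfold tp. now rewrite Rmax_right by lra. Qed.

Lemma cont_tp n t : cont (tp n t).
Proof.
unfold tp. apply cont_pow. apply cont_lip with 1. intros x y. rewrite Rmult_1_l.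
unfold Rmax. repeat destruct Rle_dec; unfold Rabs; repeat destruct Rcase_abs; lra.
Qed.

Lemma is_derive_tp n t x :
  is_derive (tp (S (S n)) t) x (INR (S (S n)) * tp (S n) t x).
Proof.
destruct (Rtotal_order x t) as [H|[H|H]].
- rewrite tp_left by lra. rewrite Rmult_0_r.
  apply is_derive_ext_loc with (fun _ => 0).
  + exists (mkposreal (t - x) ltac:(lra)). intros y Hy.
    rewrite tp_left; [reflexivity|]. apply Rabs_def2 in Hy.
    unfold minus, plus, opp in Hy; simpl in Hy. lra.
  + apply (is_derive_const 0).
- subst t. rewrite tp_left by lra. rewrite Rmult_0_r.
  apply is_derive_eps. intros eps He. exists (Rmin eps 1).
  split; [apply Rmin_glb_lt; lra|]. intros y Hy.
  assert (H1 := Rmin_l eps 1). assert (H2 := Rmin_r eps 1).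
  rewrite (tp_left (S n) x x) by lra. rewrite Rmult_0_r, !Rminus_0_r.
  destruct (Rle_dec y x) as [L|L].
  + rewrite tp_left by lra. rewrite Rabs_R0.
    apply Rmult_le_pos; [lra|apply Rabs_pos].
  + rewrite tp_right by lra. rewrite (Rabs_pos_eq (y - x)) in * by lra.
    rewrite Rabs_pos_eq by (apply pow_le; lra).
    replace ((y - x) ^ S (S n)) with ((y - x) ^ n * (y - x) * (y - x)) by (simpl; ring).
    apply Rmult_le_compat_r; [lra|].
    assert (Q : (y - x) ^ n <= 1) by (rewrite <- (pow1 n); apply pow_incr; lra).
    assert (Q0 : 0 <= (y - x) ^ n) by (apply pow_le; lra).
    apply Rle_trans with (1 * (y - x)); [apply Rmult_le_compat_r|]; lra.
- apply is_derive_ext_loc with (fun y => (y - t) ^ S (S n)).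
  + exists (mkposreal (x - t) ltac:(lra)). intros y Hy.
    rewrite tp_right; [reflexivity|]. apply Rabs_def2 in Hy.
    unfold minus, plus, opp in Hy; simpl in Hy. lra.
  + apply is_derive_eq with (INR (S (S n)) * 1 * (x - t) ^ pred (S (S n))).
    * apply (is_derive_pow (fun y => y - t)). auto_derive; [auto|ring].
    * rewrite tp_right by lra. simpl pred. ring.
Qed.

(** First the monomials of degree 1 to [r - 1], without the constant, so that everything vanishes at
    0; then truncated powers with knots [X 1] to [X (N + r)]. The knots from [X N] on contribute
    nothing on [0,1] but are met by cutoffs that start near the right end. *)
Definition gen (r : nat) (X : nat -> R) (k : nat) (x : R) : R :=
  if le_lt_dec (r - 1) k then tp (r - 1) (X (S (k - (r - 1)))) x else x ^ S k.

Definition dimgen (r N : nat) : nat := (r - 1 + (N + r))%nat.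

(** An explicit span of functions on all of R, differentiable everywhere once [r >= 3]. Restricted
    to [0,1] it is the space [Sh], whose definition constrains values on [0,1] only. *)
Definition Spl (r N : nat) (X : nat -> R) (f : R -> R) : Prop :=
  exists c : nat -> R, forall x, f x = rsum (dimgen r N) (fun k => c k * gen r X k x).

Lemma Spl_lin r N X f g a : Spl r N X f -> Spl r N X g -> Spl r N X (fun x => f x + a * g x).
Proof.
intros [c Hc] [d Hd]. exists (fun k => c k + a * d k). intros x.
rewrite Hc, Hd, <- rsum_scal, <- rsum_plus. apply rsum_ext. intros; ring.
Qed.

Lemma Spl_0 r N X : Spl r N X (fun _ => 0).
Proof. exists (fun _ => 0). intros x. rewrite rsum_eq0; auto. intros; ring. Qed.

Lemma Spl_ext r N X f g : (forall x, f x = g x) -> Spl r N X f -> Spl r N X g.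
Proof. intros E [c Hc]. exists c. intros x. now rewrite <- E. Qed.

Lemma Spl_plus r N X f g : Spl r N X f -> Spl r N X g -> Spl r N X (fun x => f x + g x).
Proof.
intros Hf Hg. apply Spl_ext with (fun x => f x + 1 * g x); [intros; ring|].
now apply Spl_lin.
Qed.

Lemma Spl_scal r N X f a : Spl r N X f -> Spl r N X (fun x => a * f x).
Proof.
intros Hf. apply Spl_ext with (fun x => 0 + a * f x); [intros; ring|].
apply (Spl_lin r N X (fun _ => 0)); [apply Spl_0|exact Hf].
Qed.

Lemma Spl_rsum r N X n (f : nat -> R -> R) :
  (forall i, (i < n)%nat -> Spl r N X (f i)) ->
  Spl r N X (fun x => rsum n (fun i => f i x)).
Proof.
induction n as [|n IH]; simpl; intros H; [apply Spl_0|].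
apply (Spl_plus r N X (fun x => rsum n (fun i => f i x))).
- apply IH; intros; apply H; lia.
- apply H; lia.
Qed.

Lemma Spl_gen r N X k : (k < dimgen r N)%nat -> Spl r N X (gen r X k).
Proof.
intros Hk. exists (fun j => if Nat.eq_dec j k then 1 else 0). intros x.
rewrite (rsum_single _ k); [destruct (Nat.eq_dec k k); [ring|lia]|exact Hk|].
intros j _ Hj. destruct (Nat.eq_dec j k); [lia|ring].
Qed.

Lemma Spl_tp r N X j : (1 <= j <= N + r)%nat -> Spl r N X (tp (r - 1) (X j)).
Proof.
intros Hj. apply Spl_ext with (gen r X (r - 1 + (j - 1))).
- intros x. unfold gen. destruct le_lt_dec; [|lia].
  replace (S (r - 1 + (j - 1) - (r - 1))) with j by lia. reflexivity.
- apply Spl_gen. unfold dimgen. lia.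
Qed.

Lemma Spl_ispoly r N X f : ispoly r f -> f 0 = 0 -> Spl r N X f.
Proof.
intros [a Ha] H0. destruct r as [|r'].
{ apply Spl_ext with (fun _ => 0); [|apply Spl_0]. intros x. now rewrite Ha. }
assert (Ea : a O = 0).
{ rewrite Ha in H0. rewrite rsum_Sl in H0.
  rewrite (rsum_eq0 r') in H0 by (intros; simpl; ring). simpl in H0. lra. }
apply Spl_ext with (fun x => rsum r' (fun k => a (S k) * gen (S r') X k x)).
- intros x. rewrite Ha, rsum_Sl, Ea, Rmult_0_l, Rplus_0_l. apply rsum_ext.
  intros k Hk. unfold gen. destruct le_lt_dec; [lia|reflexivity].
- apply Spl_rsum. intros k Hk. apply Spl_scal, Spl_gen. unfold dimgen. lia.
Qed.

(** Generators with knots at [X (S i)] or later form the tail; all others are already polynomials to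
    the right of [X i]. The splitting holds on the whole half line and not merely on one cell, which
    is what the blending construction asks for. *)
Lemma Spl_tail r N X kappa h f i : (2 <= r)%nat -> 0 < kappa -> mesh kappa h N X ->
  Spl r N X f -> exists tail p, Spl r N X tail /\ ispoly r p /\
  (forall x, x <= X (S i) -> tail x = 0) /\
  (forall x, X i <= x -> f x = p x + tail x).
Proof.
intros Hr Hk Hm [c Hc].
set (late := fun k => if le_lt_dec (r - 1 + i) k then c k else 0).
set (early := fun k => if le_lt_dec (r - 1 + i) k then 0 else c k).
exists (fun x => rsum (dimgen r N) (fun k => late k * gen r X k x)).
exists (fun x => rsum (dimgen r N) (fun k => early k *
  (if le_lt_dec (r - 1) k then (x - X (S (k - (r - 1)))) ^ (r - 1) else x ^ S k))).
split; [now exists late|]. split; [|split].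
- apply ispoly_rsum. intros k _. unfold early.
  destruct (le_lt_dec (r - 1 + i) k); [apply ispoly_ext with (fun _ => 0);
    [intros; ring|apply ispoly_0]|].
  apply ispoly_scal. destruct le_lt_dec.
  + apply ispoly_ext with (fun x => (1 * x + - X (S (k - (r - 1)))) ^ (r - 1)).
    * intros x. f_equal. ring.
    * apply ispoly_pow. lia.
  + apply ispoly_ext with (fun x => (1 * x + 0) ^ S k).
    * intros x. f_equal. ring.
    * apply ispoly_pow. lia.
- intros x Hx. apply rsum_eq0. intros k _. unfold late, gen.
  destruct (le_lt_dec (r - 1 + i) k); [|ring].
  destruct le_lt_dec; [|lia]. replace (r - 1)%nat with (S (r - 2)) by lia.
  rewrite tp_left; [ring|]. eapply Rle_trans; [exact Hx|].
  apply (mesh_le kappa h N); [lra|assumption|lia].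
- intros x Hx. rewrite Hc, <- rsum_plus. apply rsum_ext. intros k _.
  unfold early, late, gen. destruct (le_lt_dec (r - 1 + i) k); [ring|].
  destruct le_lt_dec; [|ring]. rewrite tp_right; [ring|].
  eapply Rle_trans; [|exact Hx]. apply (mesh_le kappa h N); [lra|assumption|lia].
Qed.

Lemma Spl_local r N X kappa h f i : (2 <= r)%nat -> 0 < kappa -> mesh kappa h N X ->
  Spl r N X f -> exists a, forall x, X i <= x <= X (S i) -> f x = lp r a (X i) h x.
Proof.
intros Hr Hk Hm Hf.
destruct (Spl_tail r N X kappa h f i Hr Hk Hm Hf) as [tail [p [_ [Hp [Ht E]]]]].
assert (Hh : h <> 0) by (destruct Hm; lra).
destruct (lp_of_ispoly r p (X i) h Hh Hp) as [a Ha]. exists a. intros x Hx.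
rewrite E, Ht, Ha by lra. ring.
Qed.

(** A one-sided derivative on the closed cell already determines [l], so the formula is valid at the
    nodes as well. *)
Lemma local_derive r a x0 h f l u v x : u < v -> u <= x <= v ->
  (forall y, u <= y <= v -> f y = lp r a x0 h y) -> is_derive f x l ->
  l = dlp r a x0 h x.
Proof.
intros Huv Hx E Hd. apply (is_derive_on_unique u v f x); auto.
- now apply is_derive_on_of.
- apply is_derive_on_ext with (lp r a x0 h); auto.
  + intros y Hy. symmetry. now apply E.
  + apply is_derive_on_of; auto. apply is_derive_lp.
Qed.

(** * Cutoff of polynomials inside the spline space *)

Lemma C_ge1 n k : (k <= n)%nat -> 1 <= Binomial.C n k.
Proof.
revert k. induction n as [|n IH]; intros k Hk.
- replace k with O by lia. rewrite C_n_0. lra.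
- destruct k as [|k]; [rewrite C_n_0; lra|].
  destruct (Nat.eq_dec k n) as [->|E]; [rewrite C_n_n; lra|].
  rewrite <- pascal by lia. assert (1 <= Binomial.C n k) by (apply IH; lia).
  assert (1 <= Binomial.C n (S k)) by (apply IH; lia). lra.
Qed.

Lemma rsum_binomial n x y : (x + y) ^ n =
  rsum (S n) (fun k => Binomial.C n k * x ^ k * y ^ (n - k)).
Proof.
rewrite binomial. generalize (fun k => Binomial.C n k * x ^ k * y ^ (n - k)).
intros f. induction n as [|m IH]; [simpl; ring|]. rewrite tech5, IH. reflexivity.
Qed.

(* Any polynomial of degree < r is a combination of the powers
   (x - t_l)^(r-1) at r distinct nodes t_l; truncating those powers switches the
   polynomial on within r mesh intervals. *)
Lemma cutoff r kappa : (2 <= r)%nat -> 1 <= kappa ->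
  exists C, 0 <= C /\ forall h N X, mesh kappa h N X ->
  forall i a A, (1 <= i < N)%nat -> 0 <= A ->
  (forall k, (k < r)%nat -> Rabs (a k) <= A) ->
  exists zeta, Spl r N X zeta /\ (forall x, x <= X i -> zeta x = 0) /\
    (forall x, X (i + r)%nat <= x -> zeta x = lp r a (X i) h x) /\
    (forall x, X i <= x <= X (i + r)%nat ->
       Rabs (zeta x - lp r a (X i) h x) <= C * A).
Proof.
intros Hr Hk. set (n := (r - 1)%nat).
destruct (moments_solve r (INR r) (/ kappa)) as [C0 [HC0 Hmom]];
  [apply pos_INR|apply Rinv_0_lt_compat; lra|].
exists (INR r * (C0 * INR r ^ n)). split.
{ assert (P := pos_INR r). assert (0 <= INR r ^ n) by now apply pow_le.
  repeat apply Rmult_le_pos; auto. }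
intros h N X Hm i a A Hi HA Ha. assert (Hk0 : 0 < kappa) by lra.
assert (Hh : 0 < h) by now destruct Hm.
set (tau := fun l : nat => (X (i + S l)%nat - X i) / h).
assert (Htau : forall l, (l < r)%nat -> 0 <= tau l <= INR r).
{ intros l Hl. assert (H := mesh_steps _ _ _ _ i (S l) Hm). unfold tau.
  assert (P := pos_INR (S l)). assert (INR (S l) <= INR r) by (apply le_INR; lia).
  assert (0 < h / kappa) by now apply Rdiv_lt_0_compat.
  split; [apply Rle_div_r; [exact Hh|]; nra|apply Rle_div_l; [exact Hh|nra]]. }
(* By the binomial theorem the coefficient of [y ^ k] in the combination of the powers
   [(y - tau l) ^ n] is [C n k] times the moment of order [n - k] at the points [- tau l].
   Prescribing these moments reproduces the given polynomial. *)
destruct (Hmom (fun l => - tau l)) with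
  (b := fun m => a (n - m)%nat / Binomial.C n (n - m)) (B := A) as [e [He Hme]].
- intros l Hl. rewrite Rabs_Ropp, Rabs_pos_eq; apply Htau; exact Hl.
- intros l1 l2 H1 H2 H12.
  replace (- tau l1 - - tau l2) with ((X (i + S l2)%nat - X (i + S l1)%nat) / h)
    by (unfold tau; field; lra).
  rewrite Rabs_div, (Rabs_pos_eq h) by lra. apply Rle_div_r; [lra|].
  assert (G : forall p q, (p < q)%nat -> h / kappa <= X (i + S q)%nat - X (i + S p)%nat).
  { intros p q Hpq. assert (H := mesh_steps _ _ _ _ (i + S p) (q - p) Hm).
    replace (i + S p + (q - p))%nat with (i + S q)%nat in H by lia.
    assert (1 <= INR (q - p)) by (apply (le_INR 1); lia).
    assert (0 < h / kappa) by now apply Rdiv_lt_0_compat. nra. }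
  replace (/ kappa * h) with (h / kappa) by (unfold Rdiv; ring).
  assert (0 < h / kappa) by now apply Rdiv_lt_0_compat.
  destruct (Nat.lt_total l1 l2) as [L|[L|L]]; [|lia|].
  + specialize (G _ _ L). rewrite Rabs_pos_eq; lra.
  + specialize (G _ _ L). rewrite Rabs_left1; lra.
- exact HA.
- intros m Hmr. assert (HC1 : 1 <= Binomial.C n (n - m)) by (apply C_ge1; lia).
  rewrite Rabs_div, (Rabs_pos_eq (Binomial.C _ _)) by lra.
  assert (Rabs (a (n - m)%nat) <= A) by (apply Ha; unfold n; lia).
  apply Rle_div_l; [lra|]. nra.
- assert (Hpoly : forall x, rsum r (fun l => e l * ((x - X i) / h + - tau l) ^ n)
    = lp r a (X i) h x).
  { intros x. set (y := (x - X i) / h).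
    rewrite (rsum_ext r _ (fun l => rsum r (fun k =>
      (Binomial.C n k * y ^ k) * (e l * (- tau l) ^ (n - k))))).
    2:{ intros l _. rewrite rsum_binomial, <- rsum_scal.
        replace (S n) with r by (unfold n; lia). apply rsum_ext. intros; ring. }
    rewrite rsum_swap. unfold lp. apply rsum_ext. intros k Hkr.
    rewrite rsum_scal, (Hme (n - k)%nat) by (unfold n; lia).
    replace (n - (n - k))%nat with k by (unfold n; lia).
    assert (1 <= Binomial.C n k) by (apply C_ge1; unfold n; lia). fold y. field. lra. }
  set (zeta := fun x => rsum r (fun l => e l / h ^ n * tp n (X (i + S l)%nat) x)).
  assert (Hhn : 0 < h ^ n) by now apply pow_lt.
  assert (Hn : n = S (r - 2)) by (unfold n; lia).
  assert (Hz : forall x l, e l / h ^ n * (x - X (i + S l)%nat) ^ n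
     = e l * ((x - X i) / h + - tau l) ^ n).
  { intros x l. unfold tau.
    replace ((x - X i) / h + - ((X (i + S l)%nat - X i) / h))
      with ((x - X (i + S l)%nat) / h) by (field; lra).
    unfold Rdiv. rewrite (Rpow_mult_distr _ (/ h)), pow_inv. field. lra. }
  exists zeta. split; [|split; [|split]].
  + apply Spl_rsum. intros l Hl. apply Spl_scal. apply Spl_tp. lia.
  + intros x Hx. apply rsum_eq0. intros l Hl. rewrite Hn, tp_left; [ring|].
    eapply Rle_trans; [exact Hx|]. apply (mesh_le kappa h N); [lra|assumption|lia].
  + intros x Hx. rewrite <- Hpoly. apply rsum_ext. intros l Hl.
    rewrite tp_right; [apply Hz|]. eapply Rle_trans; [|exact Hx].
    apply (mesh_le kappa h N); [lra|assumption|lia].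
  + intros x Hx. rewrite <- Hpoly. unfold zeta. rewrite <- rsum_minus.
    rewrite Rmult_assoc. apply rsum_abs_bound. intros l Hl. rewrite <- Hz.
    (* A power that is already switched on agrees with its polynomial; one still switched off
       contributes the full polynomial value, which is bounded because [x] lies within [tau l * h]
       of the node. *)
    destruct (Rle_dec (X (i + S l)%nat) x) as [L|L].
    * rewrite tp_right by exact L. rewrite Rminus_diag, Rabs_R0.
      assert (0 <= INR r ^ n) by (apply pow_le, pos_INR).
      repeat apply Rmult_le_pos; auto.
    * rewrite Hn, tp_left, <- Hn by lra. rewrite Rmult_0_r, Rminus_0_l, Rabs_Ropp.
      rewrite Hz, Rabs_mult. specialize (He l Hl).
      replace (C0 * INR r ^ n * A) with (C0 * A * INR r ^ n) by ring.
      apply Rmult_le_compat; auto using Rabs_pos.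
      rewrite <- RPow_abs. apply pow_incr. split; [apply Rabs_pos|].
      destruct (Htau l Hl) as [T1 T2].
      assert (0 <= (x - X i) / h) by (apply Rle_div_r; lra).
      assert ((x - X i) / h <= tau l).
      { unfold tau, Rdiv. apply Rmult_le_compat_r; [|lra].
        left. now apply Rinv_0_lt_compat. }
      rewrite Rabs_left1; lra.
Qed.

Lemma finite_choice {A : Type} (P : nat -> A -> Prop) (d : A) n :
  (forall i, (i < n)%nat -> exists y, P i y) ->
  exists f : nat -> A, forall i, (i < n)%nat -> P i (f i).
Proof.
induction n as [|n IH]; intros H; [exists (fun _ => d); intros; lia|].
destruct IH as [f Hf]; [intros; apply H; lia|].
destruct (H n ltac:(lia)) as [y Hy].
exists (fun i => if Nat.eq_dec i n then y else f i). intros i Hi.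
destruct (Nat.eq_dec i n) as [->|E]; [exact Hy|]. apply Hf. lia.
Qed.

Lemma rsum_rev n (f : nat -> R) : rsum n f = rsum n (fun i => f (n - 1 - i)%nat).
Proof.
induction n as [|n IH]; [reflexivity|].
rewrite (rsum_Sl n (fun i => f (S n - 1 - i)%nat)).
rewrite (rsum_ext n (fun i => f (S n - 1 - S i)%nat) (fun i => f (n - 1 - i)%nat))
  by (intros; f_equal; lia).
rewrite <- IH. simpl. rewrite !Nat.sub_0_r. ring.
Qed.

(** On cell [j] only the last [r] jumps are still being switched on, so after reversal of the sum
    only a window of [r] terms is left. For [l > j] the truncated difference [j - l] is 0, which can
    only enlarge the right-hand side. *)
Lemma rsum_window j r (g : nat -> R) : (forall i, 0 <= g i) ->
  rsum j (fun i => if le_lt_dec (S i + r) j then 0 else g (S i))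
  <= rsum r (fun l => g (j - l)%nat).
Proof.
intros Hg. rewrite rsum_rev.
rewrite (rsum_ext j _ (fun l => if le_lt_dec r l then 0 else g (j - l)%nat)).
2:{ intros l Hl. destruct (le_lt_dec (S (j - 1 - l) + r) j), (le_lt_dec r l);
      try lia; [reflexivity|]. f_equal. lia. }
destruct (le_lt_dec r j) as [H|H].
- match goal with |- rsum j ?f <= _ =>
    replace (rsum j f) with (rsum (r + (j - r)) f) by (f_equal; lia) end.
  rewrite rsum_split.
  rewrite (rsum_eq0 (j - r)) by (intros l Hl; destruct le_lt_dec; [reflexivity|lia]).
  rewrite Rplus_0_r. apply rsum_le. intros l Hl. destruct le_lt_dec; [lia|lra].
- match goal with |- _ <= rsum r ?f =>
    replace (rsum r f) with (rsum (j + (r - j)) f) by (f_equal; lia) end.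
  rewrite rsum_split.
  assert (0 <= rsum (r - j) (fun i => g (j - (j + i))%nat)) by now apply rsum_nonneg.
  assert (rsum j (fun l => if le_lt_dec r l then 0 else g (j - l)%nat)
    <= rsum j (fun l => g (j - l)%nat)); [|lra].
  apply rsum_le. intros l Hl. destruct le_lt_dec; [apply Hg|lra].
Qed.

(* Taking for [s j] the Taylor polynomials of a smooth function at the nodes gives
   the approximation estimate; taking [H (X j) * xi] with [xi] a spline gives the
   superapproximation estimate for [H * xi]. *)
Lemma blend r kappa : (2 <= r)%nat -> 1 <= kappa ->
  exists C, 0 <= C /\ forall h N X, mesh kappa h N X ->
  forall (s : nat -> R -> R) (al : nat -> R), (forall i, 0 <= al i) ->
  Spl r N X (s O) ->
  (forall i, (1 <= i < N)%nat -> exists tail a, Spl r N X tail /\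
     (forall x, x <= X i -> tail x = 0) /\
     (forall k, (k < r)%nat -> Rabs (a k) <= al i) /\
     (forall x, X i <= x -> s i x - s (i - 1)%nat x = lp r a (X i) h x + tail x)) ->
  exists phi, Spl r N X phi /\ forall j x, (j < N)%nat -> X j <= x <= X (S j) ->
    Rabs (phi x - s j x) <= C * rsum r (fun l => al (j - l)%nat).
Proof.
intros Hr Hk. destruct (cutoff r kappa Hr Hk) as [C [HC Hcut]].
exists C. split; [exact HC|]. intros h N X Hm s al Hal Hs0 Hs.
assert (Hk0 : 0 < kappa) by lra.
destruct (finite_choice (fun i z => Spl r N X z /\ (forall x, x <= X (S i) -> z x = 0) /\
  (forall x, X (S i + r)%nat <= x -> z x = s (S i) x - s i x) /\
  (forall x, X (S i) <= x <= X (S i + r)%nat ->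
     Rabs (z x - (s (S i) x - s i x)) <= C * al (S i))) (fun _ => 0) (N - 1))
  as [z Hz].
{ intros i Hi. destruct (Hs (S i)) as [tail [a [H1 [H2 [H3 H4]]]]]; [lia|].
  replace (S i - 1)%nat with i in H4 by lia.
  destruct (Hcut h N X Hm (S i) a (al (S i))) as [zeta [Z1 [Z2 [Z3 Z4]]]]; auto; [lia|].
  exists (fun x => zeta x + tail x). split; [now apply Spl_plus|].
  split; [|split].
  - intros x Hx. rewrite Z2, H2 by exact Hx. ring.
  - intros x Hx. rewrite H4, Z3; auto. eapply Rle_trans; [|exact Hx].
    apply (mesh_le kappa h N); [lra|assumption|lia].
  - intros x Hx. rewrite H4 by apply Hx.
    replace (zeta x + tail x - (lp r a (X (S i)) h x + tail x))
      with (zeta x - lp r a (X (S i)) h x) by ring. now apply Z4. }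
(* The first local function plus all jumps, each switched on gradually. Were every jump switched on
   at once, the sum would telescope to [s j] on cell [j]; the deviation stems from the unfinished
   switches. *)
exists (fun x => s O x + rsum (N - 1) (fun i => z i x)). split.
{ apply Spl_plus; [exact Hs0|]. apply Spl_rsum. intros i Hi. now apply Hz. }
intros j x Hj Hx.
assert (Hsj : s j x = s O x + rsum j (fun i => s (S i) x - s i x)).
{ clear. induction j as [|j IH]; simpl; [ring|]. rewrite IH at 1. ring. }
rewrite Hsj. replace (N - 1)%nat with (j + (N - 1 - j))%nat by lia.
rewrite rsum_split, (rsum_eq0 (N - 1 - j)).
2:{ intros i Hi. apply Hz; [lia|]. eapply Rle_trans; [apply Hx|].
    apply (mesh_le kappa h N); [lra|assumption|lia]. }
replace (s O x + (rsum j (fun i => z i x) + 0)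
  - (s O x + rsum j (fun i => s (S i) x - s i x)))
  with (rsum j (fun i => z i x - (s (S i) x - s i x))) by (rewrite rsum_minus; ring).
eapply Rle_trans; [apply rsum_abs|].
eapply Rle_trans; [|apply Rmult_le_compat_l; [exact HC|apply (rsum_window j r al Hal)]].
rewrite <- rsum_scal. apply rsum_le. intros i Hi.
destruct (Hz i ltac:(lia)) as [_ [_ [Z3 Z4]]].
destruct (le_lt_dec (S i + r) j) as [L|L].
- rewrite Z3, Rminus_diag, Rabs_R0; [lra|]. eapply Rle_trans; [|apply Hx].
  apply (mesh_le kappa h N); [lra|assumption|lia].
- apply Z4. split.
  + eapply Rle_trans; [|apply Hx]. apply (mesh_le kappa h N); [lra|assumption|lia].
  + eapply Rle_trans; [apply Hx|]. apply (mesh_le kappa h N); [lra|assumption|lia].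
Qed.

(** * Approximation of smooth functions by splines *)

Lemma abs_le_of_sqr a b : 0 <= b -> a ^ 2 <= b ^ 2 -> Rabs a <= b.
Proof.
intros Hb H. rewrite <- (Rabs_pos_eq b Hb). apply Rsqr_le_abs_0. unfold Rsqr. lra.
Qed.

Lemma sqr_le_of_abs a b : Rabs a <= b -> a ^ 2 <= b ^ 2.
Proof. intros H. rewrite <- (pow2_abs a). apply pow_incr. split; [apply Rabs_pos|lra]. Qed.

Lemma poly_coef_sup (r : nat) (kappa : R) : 1 <= kappa ->
  exists C, 0 <= C /\ forall h x0 l a B, 0 < h -> h / kappa <= l <= h -> 0 <= B ->
  (forall x, x0 <= x <= x0 + l -> Rabs (lp r a x0 h x) <= B) ->
  forall k, (k < r)%nat -> Rabs (a k) <= C * B.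
Proof.
intros Hk. destruct (poly_coef_L2 r kappa Hk) as [C [HC H]].
exists (sqrt C). split; [apply sqrt_pos|]. intros h x0 l a B Hh Hl HB Hb k Hkr.
specialize (H h x0 l a Hh Hl k Hkr).
assert (0 < h / kappa) by (apply Rdiv_lt_0_compat; lra).
assert (Hlp := cont_lp r a x0 h).
assert (HI : RInt (fun x => lp r a x0 h x ^ 2) x0 (x0 + l) <= h * B ^ 2).
{ apply Rle_trans with (RInt (fun _ => B ^ 2) x0 (x0 + l)).
  - apply RI_le; [lra|cont|cont|]. intros x Hx. apply sqr_le_of_abs, Hb. lra.
  - rewrite RI_const. assert (0 <= B ^ 2) by apply pow2_ge_0. nra. }
apply abs_le_of_sqr; [apply Rmult_le_pos; [apply sqrt_pos|exact HB]|].
rewrite Rpow_mult_distr, pow2_sqrt by exact HC.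
apply Rmult_le_reg_r with h; [exact Hh|].
eapply Rle_trans; [exact H|].
eapply Rle_trans; [apply Rmult_le_compat_l; [exact HC|exact HI]|]. lra.
Qed.

(** A function with its first [n] derivatives, differentiable inside (0,1) but continuous on R: the
    form in which clamped data are available. *)
Definition chain (n : nat) (D : nat -> R -> R) : Prop :=
  (forall k, (k <= n)%nat -> cont (D k)) /\
  forall k x, (k < n)%nat -> 0 < x < 1 -> is_derive (D k) x (D (S k) x).

Lemma chain_S n D : chain (S n) D -> chain n (fun k => D (S k)).
Proof. intros [H1 H2]. split; intros; [apply H1|apply H2]; auto; lia. Qed.

Lemma is_derive_taylor n (c : nat -> R) a x :
  is_derive (fun y => rsum (S n) (fun k => c k / INR (fact k) * (y - a) ^ k)) x
    (rsum n (fun k => c (S k) / INR (fact k) * (x - a) ^ k)).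
Proof.
eapply is_derive_eq.
- apply (is_derive_rsum (S n) (fun k y => c k / INR (fact k) * (y - a) ^ k)
   (fun k y => c k / INR (fact k) * (INR k * 1 * (y - a) ^ pred k))).
  intros k _. apply is_derive_Rscal. apply (is_derive_pow (fun y => y - a)).
  auto_derive; [auto|ring].
- rewrite rsum_Sl. simpl (INR 0). rewrite !Rmult_0_l, Rmult_0_r, Rplus_0_l.
  apply rsum_ext. intros k _. simpl pred. rewrite fact_simpl, mult_INR.
  field. split; [apply INR_fact_neq_0|apply not_0_INR; lia].
Qed.

(** The derivative of the remainder is the remainder of one order less for the derivative, so the
    mean value theorem and induction suffice. The factor [1 / n!] is given up, being absorbed in
    later constants. *)
Lemma taylor_bound n : forall D M, chain n D -> 0 <= M ->
  (forall x, 0 <= x <= 1 -> Rabs (D n x) <= M) ->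
  forall a x, 0 <= a -> a <= x <= 1 ->
  Rabs (D O x - rsum n (fun k => D k a / INR (fact k) * (x - a) ^ k)) <= M * (x - a) ^ n.
Proof.
induction n as [|n IH]; intros D M HD HM HB a x Ha Hx.
- simpl. rewrite Rminus_0_r, Rmult_1_r. apply HB. lra.
- destruct (Req_dec a x) as [<-|E].
  + rewrite rsum_Sl, Rminus_diag.
    rewrite (rsum_eq0 n) by (intros; simpl; ring). simpl.
    replace (D O a - (D O a / 1 * 1 + 0)) with 0 by field. rewrite Rabs_R0. lra.
  + assert (HD' := HD). destruct HD' as [Hc Hd].
    assert (Hct : cont (fun y => rsum (S n) (fun k => D k a / INR (fact k) * (y - a) ^ k)))
      by cont.
    destruct (MVT_open
      (fun y => D O y - rsum (S n) (fun k => D k a / INR (fact k) * (y - a) ^ k))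
      (fun y => D 1%nat y - rsum n (fun k => D (S k) a / INR (fact k) * (y - a) ^ k))
      a x) as [c [Hcc Ec]].
    * lra.
    * apply cont_minus; [apply Hc; lia|exact Hct].
    * intros y Hy. apply is_derive_Rminus; [apply Hd; [lia|lra]|].
      apply (is_derive_taylor n (fun k => D k a)).
    * assert (E0 : D O a - rsum (S n) (fun k => D k a / INR (fact k) * (a - a) ^ k) = 0).
      { rewrite rsum_Sl, Rminus_diag, (rsum_eq0 n) by (intros; simpl; ring).
        simpl. field. }
      rewrite E0, Rminus_0_r in Ec. rewrite Ec, Rabs_mult, (Rabs_pos_eq (x - a)) by lra.
      assert (H := IH (fun k => D (S k)) M (chain_S _ _ HD) HM HB a c Ha ltac:(lra)).
      cbv beta in H. simpl pow.
      assert ((c - a) ^ n <= (x - a) ^ n) by (apply pow_incr; lra).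
      replace (M * ((x - a) * (x - a) ^ n)) with (M * (x - a) ^ n * (x - a)) by ring.
      apply Rmult_le_compat_r; [lra|]. eapply Rle_trans; [exact H|].
      now apply Rmult_le_compat_l.
Qed.

Lemma Rpow_div_h (c x h : R) k : h <> 0 -> c * h ^ k * (x / h) ^ k = c * x ^ k.
Proof.
intros Hh. unfold Rdiv. rewrite Rpow_mult_distr, pow_inv. field. now apply pow_nonzero.
Qed.

Lemma approx r kappa : (3 <= r)%nat -> 1 <= kappa ->
  exists C, 0 <= C /\ forall h N X, mesh kappa h N X ->
  forall D M, chain r D -> 0 <= M -> (forall x, 0 <= x <= 1 -> Rabs (D r x) <= M) ->
  D O 0 = 0 ->
  exists phi, Spl r N X phi /\
    (forall x, 0 <= x <= 1 -> Rabs (phi x - D O x) <= C * M * h ^ r) /\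
    (forall x l, 0 < x < 1 -> is_derive phi x l ->
       Rabs (l - D 1%nat x) <= C * M * h ^ (r - 1)).
Proof.
intros Hr Hk.
destruct (blend r kappa ltac:(lia) Hk) as [C1 [HC1 Hbl]].
destruct (poly_coef_sup r kappa Hk) as [C2 [HC2 Hco]].
set (rr := INR r). assert (Hrr : 0 <= rr) by apply pos_INR.
(* On the cell right of [X i] the Taylor polynomial at [X i] is used over a distance at most [h] and
   the one at the preceding node over at most [2 * h]. Their difference is thus bounded by
   [K * M * h ^ r]. *)
set (K := 1 + 2 ^ r).
assert (HK : 0 <= K) by (unfold K; assert (0 < 2 ^ r) by (apply pow_lt; lra); lra).
set (K1 := C1 * (rr * (C2 * K))).
assert (HK1 : 0 <= K1) by (unfold K1; repeat apply Rmult_le_pos; auto).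
set (K2 := rr * (C2 * K1 * rr) + 1).
assert (HK2 : 1 <= K2).
{ unfold K2. assert (0 <= rr * (C2 * K1 * rr)) by (repeat apply Rmult_le_pos; auto). lra. }
exists (1 + K1 + K2). split; [lra|].
intros h N X Hm D M HD HM HB H0. assert (Hk0 : 0 < kappa) by lra.
assert (Hh : 0 < h) by now destruct Hm.
assert (Hhr : 0 < h ^ r) by now apply pow_lt.
assert (Hhr1 : 0 < h ^ (r - 1)) by now apply pow_lt.
set (ac := fun j k : nat => D k (X j) / INR (fact k) * h ^ k).
set (s := fun j => lp r (ac j) (X j) h).
assert (Hs : forall j x, s j x = rsum r (fun k => D k (X j) / INR (fact k) * (x - X j) ^ k)).
{ intros j x. unfold s, lp. apply rsum_ext. intros k _. unfold ac.
  apply Rpow_div_h. lra. }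
assert (Hstep : forall j, h / kappa <= X (S j) - X j <= h) by apply Hm.
assert (HT : forall j x d, (j <= N)%nat -> X j <= x <= 1 -> x - X j <= d ->
  Rabs (D O x - s j x) <= M * d ^ r).
{ intros j x d Hj Hx Hd. rewrite Hs. destruct (mesh_in _ _ _ _ j Hk0 Hm Hj).
  eapply Rle_trans; [apply (taylor_bound r D M HD HM HB); lra|].
  apply Rmult_le_compat_l; [exact HM|]. apply pow_incr. lra. }
set (A := C2 * (K * M * h ^ r)).
assert (HA : 0 <= A) by (unfold A; repeat apply Rmult_le_pos; lra).
destruct (Hbl h N X Hm s (fun _ => A)) as [phi [Hphi Hpb]].
- intros _. exact HA.
- apply Spl_ispoly; [apply ispoly_lp; lra|]. rewrite Hs.
  assert (X0 : X O = 0) by apply Hm. rewrite X0.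
  rewrite rsum_eq0; [reflexivity|]. intros k _. destruct k as [|k]; simpl.
  + rewrite H0. unfold Rdiv. ring.
  + ring.
- intros i Hi.
  destruct (lp_of_ispoly r (fun x => s i x + (-1) * s (i - 1)%nat x) (X i) h) as [a Ha].
  + lra.
  + apply ispoly_lin; apply ispoly_lp; lra.
  + exists (fun _ => 0), a. split; [apply Spl_0|]. split; [auto|]. split.
    * apply (Hco h (X i) (X (S i) - X i) a); auto.
      { repeat apply Rmult_le_pos; lra. }
      intros x Hx. rewrite <- Ha.
      assert (HSi : X (S i) <= 1) by (apply (mesh_in _ _ _ _ (S i) Hk0 Hm); lia).
      assert (T1 := HT i x h ltac:(lia) ltac:(lra)
        ltac:(specialize (Hstep i); lra)).
      assert (E : S (i - 1) = i) by lia.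
      assert (L1 := Hstep (i - 1)%nat). rewrite E in L1.
      assert (0 < h / kappa) by now apply Rdiv_lt_0_compat.
      assert (T2 := HT (i - 1)%nat x (2 * h) ltac:(lia) ltac:(lra)
        ltac:(specialize (Hstep i); lra)).
      rewrite Rpow_mult_distr in T2.
      replace (s i x + -1 * s (i - 1)%nat x)
        with ((D O x - s (i - 1)%nat x) - (D O x - s i x)) by ring.
      eapply Rle_trans; [apply Rabs_triang|]. rewrite Rabs_Ropp.
      unfold K. nra.
    * intros x _. rewrite <- Ha. ring.
- assert (Hps : forall j x, (j < N)%nat -> X j <= x <= X (S j) ->
    Rabs (phi x - s j x) <= K1 * M * h ^ r).
  { intros j x Hj Hx. eapply Rle_trans; [now apply Hpb|].
    rewrite rsum_const. unfold K1, A. fold rr. right. ring. }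
  exists phi. split; [exact Hphi|]. split.
  + intros x Hx. destruct (mesh_locate _ _ _ _ x Hm Hx) as [j [Hj Hxj]].
    specialize (Hps j x Hj Hxj).
    assert (T := HT j x h ltac:(lia) ltac:(lra) ltac:(specialize (Hstep j); lra)).
    replace (phi x - D O x) with ((phi x - s j x) - (D O x - s j x)) by ring.
    eapply Rle_trans; [apply Rabs_triang|]. rewrite Rabs_Ropp.
    assert (0 <= M * h ^ r) by nra. nra.
  + intros x l Hx Hl. destruct (mesh_locate _ _ _ _ x Hm ltac:(lra)) as [j [Hj Hxj]].
    assert (Hlt := mesh_lt kappa h N X j Hk0 Hm).
    destruct (Spl_local r N X kappa h phi j ltac:(lia) Hk0 Hm Hphi) as [a Ha].
    rewrite (local_derive r a (X j) h phi l (X j) (X (S j)) x Hlt Hxj Ha Hl).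
    (* On the cell, [phi - s j] is a polynomial of size [h ^ r]. Its scaled coefficients have that
       size too, so differentiating it loses one power of [h]. *)
    destruct (lp_of_ispoly r (fun y => lp r a (X j) h y + (-1) * s j y) (X j) h)
      as [b Hb]; [lra|apply ispoly_lin; apply ispoly_lp; lra|].
    assert (Hbk : forall k, (k < r)%nat -> Rabs (b k) <= C2 * (K1 * M * h ^ r)).
    { apply (Hco h (X j) (X (S j) - X j) b); auto.
      { repeat apply Rmult_le_pos; lra. }
      intros y Hy. rewrite <- Hb, <- Ha by lra.
      replace (phi y + -1 * s j y) with (phi y - s j y) by ring. apply Hps; [auto|lra]. }
    assert (Edl : dlp r b (X j) h x = dlp r a (X j) h x - dlp r (ac j) (X j) h x).
    { symmetry. apply (local_derive r b (X j) h
        (fun y => lp r a (X j) h y + (-1) * s j y) _ (X j) (X (S j)) x Hlt Hxj).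
      - intros; apply Hb.
      - apply is_derive_eq with (dlp r a (X j) h x + (-1) * dlp r (ac j) (X j) h x).
        + apply is_derive_Rplus; [apply is_derive_lp|].
          apply is_derive_Rscal, is_derive_lp.
        + ring. }
    assert (Hdb := dlp_bound r b (X j) h _ x Hh Hbk
      ltac:(apply Rabs_le; specialize (Hstep j); lra)).
    assert (Hj0 := mesh_in _ _ _ _ j Hk0 Hm ltac:(lia)).
    assert (Hds : Rabs (D 1%nat x - dlp r (ac j) (X j) h x) <= M * h ^ (r - 1)).
    { assert (E1 : dlp r (ac j) (X j) h x =
        rsum (r - 1) (fun k => D (S k) (X j) / INR (fact k) * (x - X j) ^ k)).
      { symmetry. apply (local_derive r (ac j) (X j) h (s j) _ (X j) (X (S j)) x Hlt Hxj);
          [reflexivity|].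
        apply is_derive_ext with
          (fun x => rsum (S (r - 1)) (fun k => D k (X j) / INR (fact k) * (x - X j) ^ k)).
        - intros y. rewrite Hs. f_equal. lia.
        - apply (is_derive_taylor (r - 1) (fun k => D k (X j))). }
      rewrite E1.
      assert (HD' : chain (r - 1) (fun k => D (S k))).
      { apply chain_S. replace (S (r - 1)) with r by lia. exact HD. }
      eapply Rle_trans.
      - apply (taylor_bound (r - 1) (fun k => D (S k)) M HD' HM).
        + replace (S (r - 1)) with r by lia. exact HB.
        + lra.
        + lra.
      - apply Rmult_le_compat_l; [exact HM|]. apply pow_incr.
        specialize (Hstep j). lra. }
    replace (dlp r a (X j) h x - D 1%nat x)
      with (dlp r b (X j) h x - (D 1%nat x - dlp r (ac j) (X j) h x))
      by (rewrite Edl; ring).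
    eapply Rle_trans; [apply Rabs_triang|]. rewrite Rabs_Ropp.
    fold rr in Hdb.
    replace (rr * (C2 * (K1 * M * h ^ r) * (rr / h)))
      with ((K2 - 1) * (M * h ^ (r - 1))) in Hdb.
    2:{ unfold K2. replace (h ^ r) with (h ^ (r - 1) * h).
        - field. lra.
        - replace r with (S (r - 1)) at 2 by lia. simpl. ring. }
    assert (0 <= M * h ^ (r - 1)) by nra. nra.
Qed.

(** * Inverse and superapproximation estimates *)

Lemma Spl_deriv r N X f : (3 <= r)%nat -> Spl r N X f ->
  exists df, cont df /\ forall x, is_derive f x (df x).
Proof.
intros Hr [c Hc].
set (dg := fun k x => if le_lt_dec (r - 1) k
  then INR (r - 1) * tp (r - 2) (X (S (k - (r - 1)))) x else INR (S k) * x ^ k).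
exists (fun x => rsum (dimgen r N) (fun k => c k * dg k x)). split.
- apply cont_rsum. intros k _. apply cont_mult; [apply cont_const|].
  unfold dg. destruct le_lt_dec; cont. apply cont_tp.
- intros x. apply is_derive_ext with (fun x => rsum (dimgen r N) (fun k => c k * gen r X k x)).
  + intros y. now rewrite Hc.
  + apply (is_derive_rsum _ (fun k x => c k * gen r X k x) (fun k x => c k * dg k x)).
    intros k _. apply is_derive_Rscal. unfold gen, dg. destruct le_lt_dec.
    * replace (r - 1)%nat with (S (S (r - 3))) by lia.
      replace (r - 2)%nat with (S (r - 3)) by lia. apply is_derive_tp.
    * apply is_derive_eq with (INR (S k) * 1 * x ^ pred (S k)).
      -- apply (is_derive_pow (fun y => y)). apply (is_derive_id x).
      -- simpl pred. ring.
Qed.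

Lemma Spl_cont r N X f : (3 <= r)%nat -> Spl r N X f -> cont f.
Proof.
intros Hr Hf. destruct (Spl_deriv r N X f Hr Hf) as [df [_ H]].
now apply is_derive_cont with df.
Qed.

(** The bound of the scaled coefficients by the local L2 norm gives both estimates: values cost half
    a power of [h], and each differentiation costs another full power. *)
Lemma inverse_local r kappa : (3 <= r)%nat -> 1 <= kappa ->
  exists C, 0 <= C /\ forall h N X, mesh kappa h N X -> forall xi, Spl r N X xi ->
  forall j x, (j < N)%nat -> X j <= x <= X (S j) ->
    xi x ^ 2 * h <= C * RInt (fun x => xi x ^ 2) (X j) (X (S j)) /\
    forall l, is_derive xi x l ->
      l ^ 2 * h ^ 3 <= C * RInt (fun x => xi x ^ 2) (X j) (X (S j)).
Proof.
intros Hr Hk. destruct (poly_coef_L2 r kappa Hk) as [C [HC Hco]].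
set (rr := INR r). assert (Hrr : 1 <= rr) by (apply (le_INR 1); lia).
exists (rr ^ 4 * C). split; [apply Rmult_le_pos; [apply pow_le; lra|lra]|].
intros h N X Hm xi Hxi j x Hj Hx.
assert (Hk0 : 0 < kappa) by lra. assert (Hh : 0 < h) by now destruct Hm.
assert (Hlt := mesh_lt kappa h N X j Hk0 Hm).
assert (Hst : h / kappa <= X (S j) - X j <= h) by apply Hm.
destruct (Spl_local r N X kappa h xi j ltac:(lia) Hk0 Hm Hxi) as [a Ha].
set (I := RInt (fun x => xi x ^ 2) (X j) (X (S j))).
assert (Cx := Spl_cont r N X xi Hr Hxi).
assert (HI : 0 <= I) by (apply RI_nonneg; [lra|cont|intros; apply pow2_ge_0]).
assert (Hak : forall k, (k < r)%nat -> a k ^ 2 * h <= C * I).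
{ intros k Hkr. eapply Rle_trans; [apply (Hco h (X j) (X (S j) - X j) a Hh Hst k Hkr)|].
  right. f_equal. replace (X j + (X (S j) - X j)) with (X (S j)) by ring.
  apply RI_ext; [lra|]. intros y Hy. now rewrite Ha by lra. }
set (A := sqrt (C * I / h)).
assert (HA0 : 0 <= C * I / h).
{ apply Rle_div_r; [exact Hh|]. rewrite Rmult_0_l. now apply Rmult_le_pos. }
assert (HA : A ^ 2 * h = C * I) by (unfold A; rewrite pow2_sqrt by exact HA0; field; lra).
assert (HAp : 0 <= A) by apply sqrt_pos.
assert (HaA : forall k, (k < r)%nat -> Rabs (a k) <= A).
{ intros k Hkr. apply abs_le_of_sqr; [exact HAp|]. specialize (Hak k Hkr). nra. }
assert (Hxh : Rabs (x - X j) <= h) by (apply Rabs_le; lra).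
assert (R2 : rr ^ 2 <= rr ^ 4) by (apply Rle_pow; [lra|lia]).
assert (HCI : 0 <= C * I) by now apply Rmult_le_pos.
split.
- rewrite Ha by exact Hx.
  assert (B := sqr_le_of_abs _ _ (lp_bound r a (X j) h A x Hh HaA Hxh)). fold rr in B.
  apply Rle_trans with ((rr * A) ^ 2 * h); [apply Rmult_le_compat_r; lra|].
  replace ((rr * A) ^ 2 * h) with (rr ^ 2 * (A ^ 2 * h)) by ring. rewrite HA.
  rewrite Rmult_assoc. now apply Rmult_le_compat_r.
- intros l Hl. rewrite (local_derive r a (X j) h xi l (X j) (X (S j)) x Hlt Hx Ha Hl).
  assert (B := sqr_le_of_abs _ _ (dlp_bound r a (X j) h A x Hh HaA Hxh)). fold rr in B.
  assert (0 < h ^ 3) by now apply pow_lt.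
  apply Rle_trans with ((rr * (A * (rr / h))) ^ 2 * h ^ 3); [apply Rmult_le_compat_r; lra|].
  replace ((rr * (A * (rr / h))) ^ 2 * h ^ 3) with (rr ^ 4 * (A ^ 2 * h)) by (field; lra).
  rewrite HA. lra.
Qed.

Lemma RI_mesh_le kappa h N X i f : 0 < kappa -> mesh kappa h N X -> (i < N)%nat ->
  cont f -> (forall x, 0 <= f x) -> RInt f (X i) (X (S i)) <= RInt f 0 1.
Proof.
intros Hk Hm Hi Hf Hp. rewrite (RI_mesh kappa h N X f Hm Hf).
apply (rsum_term_le N (fun j => RInt f (X j) (X (S j)))); [|exact Hi].
intros j Hj. apply RI_nonneg; auto. left. now apply (mesh_lt kappa h N X).
Qed.

(** For the L2 norm of the derivative the local bounds are integrated cell by cell and summed: the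
    length of the cell restores one factor [h] in the squared bound, so the derivative costs [1/h]
    and not [h^(-3/2)]. *)
Lemma inverse_estimates r kappa : (3 <= r)%nat -> 1 <= kappa ->
  exists C, 0 <= C /\ forall h N X, mesh kappa h N X -> forall xi dxi, Spl r N X xi ->
  cont dxi -> (forall x, is_derive xi x (dxi x)) ->
  (forall x, 0 <= x <= 1 -> xi x ^ 2 * h <= C * RInt (fun x => xi x ^ 2) 0 1) /\
  (forall x, 0 <= x <= 1 -> dxi x ^ 2 * h ^ 3 <= C * RInt (fun x => xi x ^ 2) 0 1) /\
  h ^ 2 * RInt (fun x => dxi x ^ 2) 0 1 <= C * RInt (fun x => xi x ^ 2) 0 1.
Proof.
intros Hr Hk. destruct (inverse_local r kappa Hr Hk) as [C [HC H]].
exists C. split; [exact HC|]. intros h N X Hm xi dxi Hxi Hd1 Hd2.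
assert (Cx := Spl_cont r N X xi Hr Hxi). assert (Hk0 : 0 < kappa) by lra.
assert (Hh : 0 < h) by now destruct Hm.
assert (Hle : forall j, (j < N)%nat -> RInt (fun x => xi x ^ 2) (X j) (X (S j))
   <= RInt (fun x => xi x ^ 2) 0 1).
{ intros j Hj. apply (RI_mesh_le kappa h N); auto; [cont|]. intros; apply pow2_ge_0. }
split; [|split].
- intros x Hx. destruct (mesh_locate _ _ _ _ x Hm Hx) as [j [Hj Hxj]].
  destruct (H h N X Hm xi Hxi j x Hj Hxj) as [H1 _].
  eapply Rle_trans; [exact H1|]. apply Rmult_le_compat_l; auto.
- intros x Hx. destruct (mesh_locate _ _ _ _ x Hm Hx) as [j [Hj Hxj]].
  destruct (H h N X Hm xi Hxi j x Hj Hxj) as [_ H1].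
  eapply Rle_trans; [apply (H1 _ (Hd2 x))|]. apply Rmult_le_compat_l; auto.
- rewrite (RI_mesh kappa h N X (fun x => dxi x ^ 2)) by (auto; cont).
  rewrite (RI_mesh kappa h N X (fun x => xi x ^ 2)) by (auto; cont).
  rewrite <- !rsum_scal. apply rsum_le. intros j Hj.
  assert (Hlt := mesh_lt kappa h N X j Hk0 Hm).
  assert (Hst : h / kappa <= X (S j) - X j <= h) by apply Hm.
  set (I := RInt (fun x => xi x ^ 2) (X j) (X (S j))).
  assert (HI : 0 <= I) by (apply RI_nonneg; [lra|cont|intros; apply pow2_ge_0]).
  assert (HCI : 0 <= C * I) by now apply Rmult_le_pos.
  assert (H3 : 0 < h ^ 3) by now apply pow_lt.
  apply Rle_trans with (h ^ 2 * RInt (fun _ => C * I / h ^ 3) (X j) (X (S j))).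
  + apply Rmult_le_compat_l; [apply pow2_ge_0|]. apply RI_le; [lra|cont|cont|].
    intros x Hx. apply (proj1 (Rle_div_r _ _ _ H3)).
    apply (H h N X Hm xi Hxi j x Hj); [lra|apply Hd2].
  + rewrite RI_const.
    replace (h ^ 2 * ((X (S j) - X j) * (C * I / h ^ 3)))
      with ((X (S j) - X j) / h * (C * I)) by (field; lra).
    rewrite <- (Rmult_1_l (C * I)) at 2. apply Rmult_le_compat_r; [exact HCI|].
    apply Rle_div_l; lra.
Qed.

(** Truncated subtraction repeats the term [g 0] for the first indices, whence the factor
    [l + 1]. *)
Lemma rsum_shift_le N l (g : nat -> R) : (1 <= N)%nat -> (forall i, 0 <= g i) ->
  rsum N (fun j => g (j - l)%nat) <= (INR l + 1) * rsum N g.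
Proof.
intros HN Hg. induction l as [|l IH].
- simpl. rewrite (rsum_ext N _ g) by (intros; f_equal; lia). lra.
- rewrite S_INR. destruct N as [|N]; [lia|].
  rewrite rsum_Sl. simpl (0 - S l)%nat.
  rewrite (rsum_ext N _ (fun i => g (i - l)%nat)) by (intros; f_equal; lia).
  assert (rsum N (fun i => g (i - l)%nat) <= rsum (S N) (fun i => g (i - l)%nat)).
  { simpl. specialize (Hg (N - l)%nat). lra. }
  assert (g O <= rsum (S N) g) by (apply rsum_term_le; [auto|lia]). lra.
Qed.

(** On each cell [H] is replaced by its nodal value. The jump at [X i] is then [xi] times a
    difference of neighbouring values of [H], at most [L * h]. Its polynomial part is measured by
    the L2 norm of [xi] on the next cell, and the rest is carried along as the tail, so no
    derivative of [xi] is involved. *)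
Lemma superapprox r kappa : (3 <= r)%nat -> 1 <= kappa ->
  exists C, 0 <= C /\ forall h N X, mesh kappa h N X ->
  forall H L xi, cont H -> 0 <= L ->
  (forall x y, 0 <= x <= 1 -> 0 <= y <= 1 -> Rabs (H x - H y) <= L * Rabs (x - y)) ->
  Spl r N X xi -> exists phi, Spl r N X phi /\
  RInt (fun x => (phi x - H x * xi x) ^ 2) 0 1 <=
    C * (L * h) ^ 2 * RInt (fun x => xi x ^ 2) 0 1.
Proof.
intros Hr Hk.
destruct (blend r kappa ltac:(lia) Hk) as [C1 [HC1 Hbl]].
destruct (poly_coef_L2 r kappa Hk) as [C2 [HC2 Hco]].
set (rr := INR r). assert (Hrr : 0 <= rr) by apply pos_INR.
exists (2 * C1 ^ 2 * rr * (rr * rr) * C2 + 2). split.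
{ assert (0 <= 2 * C1 ^ 2 * rr * (rr * rr) * C2); [|lra].
  repeat apply Rmult_le_pos; try lra; apply pow2_ge_0. }
intros h N X Hm H L xi HcH HL Hlip Hxi. assert (Hk0 : 0 < kappa) by lra.
assert (Hh : 0 < h) by now destruct Hm.
assert (HN : (1 <= N)%nat) by apply Hm.
assert (Cx := Spl_cont r N X xi Hr Hxi).
assert (Hst : forall j, h / kappa <= X (S j) - X j <= h) by apply Hm.
assert (Hlt := fun j => mesh_lt kappa h N X j Hk0 Hm).
set (I := fun j : nat => RInt (fun x => xi x ^ 2) (X j) (X (S j)) : R).
assert (HI : forall j, 0 <= I j).
{ intros j. apply RI_nonneg; [specialize (Hlt j); lra|cont|intros; apply pow2_ge_0]. }
set (al := fun j => L * h * sqrt (C2 * I j / h)).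
assert (HCI : forall j, 0 <= C2 * I j / h).
{ intros j. apply Rle_div_r; [exact Hh|]. rewrite Rmult_0_l. now apply Rmult_le_pos. }
assert (Hal : forall j, 0 <= al j).
{ intros j. repeat apply Rmult_le_pos; try lra. apply sqrt_pos. }
destruct (Hbl h N X Hm (fun j x => H (X j) * xi x) al Hal) as [phi [Hphi Hpb]].
- now apply Spl_scal.
- intros i Hi.
  destruct (Spl_tail r N X kappa h xi i ltac:(lia) Hk0 Hm Hxi)
    as [tail [p [Ht [Hp [Ht0 E]]]]].
  destruct (lp_of_ispoly r p (X i) h ltac:(lra) Hp) as [a Ha].
  set (d := H (X i) - H (X (i - 1)%nat)).
  assert (Hd : Rabs d <= L * h).
  { unfold d. assert (Q1 := mesh_in _ _ _ _ i Hk0 Hm ltac:(lia)).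
    assert (Q2 := mesh_in _ _ _ _ (i - 1) Hk0 Hm ltac:(lia)).
    eapply Rle_trans; [now apply Hlip|]. apply Rmult_le_compat_l; [exact HL|].
    specialize (Hst (i - 1)%nat). specialize (Hlt (i - 1)%nat).
    replace (S (i - 1)) with i in * by lia. rewrite Rabs_pos_eq; lra. }
  exists (fun x => d * tail x), (fun k => d * a k).
  split; [now apply Spl_scal|]. split; [|split].
  + intros x Hx. rewrite Ht0; [ring|]. specialize (Hlt i). lra.
  + intros k Hkr. rewrite Rabs_mult. unfold al.
    apply Rmult_le_compat; auto using Rabs_pos.
    apply abs_le_of_sqr; [apply sqrt_pos|]. rewrite pow2_sqrt by apply HCI.
    apply (proj1 (Rle_div_r _ _ _ Hh)).
    eapply Rle_trans; [apply (Hco h (X i) (X (S i) - X i) a Hh (Hst i) k Hkr)|].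
    right. f_equal. replace (X i + (X (S i) - X i)) with (X (S i)) by ring.
    apply RI_ext; [specialize (Hlt i); lra|]. intros y Hy.
    rewrite <- Ha, E, (Ht0 y) by lra. f_equal. ring.
  + intros x Hx. rewrite E, Ha by exact Hx. unfold lp.
    rewrite (rsum_ext r (fun k => d * a k * ((x - X i) / h) ^ k)
      (fun k => d * (a k * ((x - X i) / h) ^ k))) by (intros; ring).
    rewrite rsum_scal. unfold d. ring.
- exists phi. split; [exact Hphi|].
  assert (Cp := Spl_cont r N X phi Hr Hphi).
  set (G := fun j => rsum r (fun l => al (j - l)%nat ^ 2)).
  assert (Hj : forall j, (j < N)%nat ->
    RInt (fun x => (phi x - H x * xi x) ^ 2) (X j) (X (S j)) <=
    2 * C1 ^ 2 * rr * h * G j + 2 * (L * h) ^ 2 * I j).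
  { intros j Hj. specialize (Hlt j). specialize (Hst j).
    assert (HG : 0 <= G j) by (apply rsum_nonneg; intros; apply pow2_ge_0).
    apply Rle_trans with (RInt (fun x => 2 * C1 ^ 2 * rr * G j
      + 2 * (L * h) ^ 2 * xi x ^ 2) (X j) (X (S j))).
    - apply RI_le; [lra|cont|cont|]. intros x Hx.
      assert (B1 : (phi x - H (X j) * xi x) ^ 2 <= C1 ^ 2 * (rr * G j)).
      { eapply Rle_trans; [apply sqr_le_of_abs, Hpb; [exact Hj|lra]|].
        rewrite Rpow_mult_distr. apply Rmult_le_compat_l; [apply pow2_ge_0|].
        apply rsum_sqr_le. }
      assert (B2 : ((H (X j) - H x) * xi x) ^ 2 <= (L * h) ^ 2 * xi x ^ 2).
      { rewrite Rpow_mult_distr. apply Rmult_le_compat_r; [apply pow2_ge_0|].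
        apply sqr_le_of_abs.
        assert (Q1 := mesh_in _ _ _ _ j Hk0 Hm ltac:(lia)).
        assert (Q2 := mesh_in _ _ _ _ (S j) Hk0 Hm ltac:(lia)).
        eapply Rle_trans; [apply Hlip; lra|]. apply Rmult_le_compat_l; [exact HL|].
        rewrite Rabs_left1; lra. }
      replace (phi x - H x * xi x)
        with ((phi x - H (X j) * xi x) + (H (X j) - H x) * xi x) by ring.
      set (u := phi x - H (X j) * xi x) in *. set (v := (H (X j) - H x) * xi x) in *.
      assert ((u + v) ^ 2 <= 2 * u ^ 2 + 2 * v ^ 2)
        by (assert (0 <= (u - v) ^ 2) by apply pow2_ge_0; nra).
      nra.
    - rewrite RI_plus by cont. rewrite RI_const, RI_scal by cont. fold (I j).
      apply Rplus_le_compat_r.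
      replace (2 * C1 ^ 2 * rr * h * G j) with (h * (2 * C1 ^ 2 * rr * G j)) by ring.
      apply Rmult_le_compat_r; [|lra].
      repeat apply Rmult_le_pos; try lra; apply pow2_ge_0. }
  rewrite (RI_mesh kappa h N X (fun x => (phi x - H x * xi x) ^ 2)) by (auto; cont).
  rewrite (RI_mesh kappa h N X (fun x => xi x ^ 2)) by (auto; cont).
  change (fun j => RInt (fun x => xi x ^ 2) (X j) (X (S j))) with I.
  eapply Rle_trans; [apply rsum_le; exact Hj|].
  rewrite rsum_plus, !rsum_scal.
  (* After exchanging the sums, each of the [r] shifts of the window costs a factor [l + 1 <= r];
     hence [rr * rr]. *)
  assert (HG : rsum N G <= rr * (rr * ((L * h) ^ 2 * (C2 / h * rsum N I)))).
  { unfold G. rewrite rsum_swap. unfold rr at 1. rewrite <- rsum_const.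
    apply rsum_le. intros l Hl.
    eapply Rle_trans;
      [apply (rsum_shift_le N l (fun j => al j ^ 2) HN); intros; apply pow2_ge_0|].
    rewrite (rsum_ext N (fun j => al j ^ 2) (fun j => (L * h) ^ 2 * (C2 / h * I j))).
    - rewrite !rsum_scal.
      apply Rmult_le_compat_r.
      + repeat apply Rmult_le_pos; try apply pow2_ge_0; try lra.
        * left. now apply Rinv_0_lt_compat.
        * apply rsum_nonneg. auto.
      + rewrite <- S_INR. apply le_INR. lia.
    - intros j _. unfold al. rewrite Rpow_mult_distr, pow2_sqrt by apply HCI.
      field. lra. }
  set (s := rsum N I) in *.
  assert (E : 2 * C1 ^ 2 * rr * h * (rr * (rr * ((L * h) ^ 2 * (C2 / h * s))))
    = 2 * C1 ^ 2 * rr * (rr * rr) * C2 * (L * h) ^ 2 * s) by (field; lra).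
  assert (2 * C1 ^ 2 * rr * h * rsum N G <=
    2 * C1 ^ 2 * rr * h * (rr * (rr * ((L * h) ^ 2 * (C2 / h * s))))).
  { apply Rmult_le_compat_l; [|exact HG].
    repeat apply Rmult_le_pos; try lra; apply pow2_ge_0. }
  lra.
Qed.

(** * Identification of the spline space with [Sh] *)

(** Numbering starts at 0, so node [j] is [xs (j + 1)]. Past the right end the mesh continues with
    step [h], which respects both bounds on the steps. *)
Definition extended (N : nat) (xs : nat -> R) (h : R) (j : nat) : R :=
  if le_lt_dec j N then xs (j + 1)%nat else 1 + INR (j - N) * h.

Lemma partition_mesh N xs kappa : is_partition N xs -> 1 <= kappa ->
  max_step N xs <= kappa * min_step N xs ->
  mesh kappa (max_step N xs) N (extended N xs (max_step N xs)).
Proof.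
intros [HN [H0 [H1 Hs]]] Hk Hq. set (h := max_step N xs) in *.
assert (Hin : forall j, (j < N)%nat ->
  In (xs (S j + 1)%nat - xs (j + 1)%nat) (steps N xs)).
{ intros j Hj. unfold steps.
  replace (xs (S j + 1)%nat - xs (j + 1)%nat)
    with ((fun j => xs (j + 1)%nat - xs j) (j + 1)%nat)
    by (cbv beta; do 2 f_equal; lia).
  apply (in_map (fun j => xs (j + 1)%nat - xs j)). apply in_seq. lia. }
assert (Hst : forall j, (j < N)%nat ->
  0 < xs (S j + 1)%nat - xs (j + 1)%nat /\
  h / kappa <= xs (S j + 1)%nat - xs (j + 1)%nat <= h).
{ intros j Hj. specialize (Hin j Hj).
  assert (A := MaxRlist_P1 _ _ Hin). assert (B := MinRlist_P1 _ _ Hin).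
  assert (P := Hs (j + 1)%nat ltac:(lia)).
  replace (j + 1 + 1)%nat with (S j + 1)%nat in P by lia.
  split; [lra|]. split; [|exact A].
  apply Rle_div_l; [lra|]. fold (min_step N xs) in B.
  eapply Rle_trans; [exact Hq|]. rewrite Rmult_comm. apply Rmult_le_compat_r; lra. }
assert (Hh : 0 < h) by (specialize (Hst O ltac:(lia)); lra).
assert (Hhk : h / kappa <= h) by (apply Rle_div_l; nra).
assert (EN : extended N xs h N = 1).
{ unfold extended. destruct le_lt_dec; [exact H1|lia]. }
split; [exact Hh|]. split; [exact HN|]. split; [|split; [exact EN|]].
- unfold extended. destruct le_lt_dec; [exact H0|lia].
- intros j. destruct (le_lt_dec N j) as [L|L].
  + replace (extended N xs h (S j) - extended N xs h j) with h; [lra|].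
    unfold extended at 1. destruct le_lt_dec; [lia|].
    replace (S j - N)%nat with (S (j - N)) by lia. rewrite S_INR.
    destruct (Nat.eq_dec j N) as [->|E].
    * rewrite EN, Nat.sub_diag. simpl. ring.
    * unfold extended. destruct le_lt_dec; [lia|]. ring.
  + unfold extended. do 2 (destruct le_lt_dec; [|lia]). now apply Hst.
Qed.

Lemma extended_eq N xs h j : (j <= N)%nat -> extended N xs h j = xs (j + 1)%nat.
Proof. intros H. unfold extended. destruct le_lt_dec; [reflexivity|lia]. Qed.

Lemma Ck_on_lin k : forall f g c, Ck_on k 0 1 f -> Ck_on k 0 1 g ->
  Ck_on k 0 1 (fun x => f x + c * g x).
Proof.
induction k as [|k IH]; intros f g c [Cf Hf] [Cg Hg]; split;
  try (apply continuous_on_of_cont with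
    (fun x => f (clamp 0 1 x) + c * g (clamp 0 1 x));
   [assert (A := continuous_on_clamp 0 1 f Rle_0_1 Cf);
    assert (B := continuous_on_clamp 0 1 g Rle_0_1 Cg); cont
   |intros x Hx; now rewrite (clamp_id 0 1 x Hx)]).
- exact I.
- destruct Hf as [f' [Hf Kf]], Hg as [g' [Hg Kg]].
  exists (fun x => f' x + c * g' x). split; [|now apply IH].
  intros x Hx. apply is_derive_on_lin; auto. lra.
Qed.

Lemma Ck_on_0 k : Ck_on k 0 1 (fun _ => 0).
Proof.
induction k as [|k IH]; split;
  try (apply continuous_on_of_cont with (fun _ => 0); [cont|auto]).
- exact I.
- exists (fun _ => 0). split; [|exact IH]. intros x Hx.
  apply is_derive_on_of; [lra|exact Hx|]. apply (is_derive_const 0).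
Qed.

Lemma Ck_on_rsum k n (c : nat -> R) (f : nat -> R -> R) :
  (forall i, (i < n)%nat -> Ck_on k 0 1 (f i)) ->
  Ck_on k 0 1 (fun x => rsum n (fun i => c i * f i x)).
Proof.
induction n as [|n IH]; simpl; intros H; [apply Ck_on_0|].
apply (Ck_on_lin k (fun x => rsum n (fun i => c i * f i x))).
- apply IH; intros; apply H; lia.
- apply H; lia.
Qed.

Lemma Ck_on_ext k : forall f g, (forall x, f x = g x) -> Ck_on k 0 1 f -> Ck_on k 0 1 g.
Proof.
induction k as [|k IH]; intros f g E [Cf Hf]; split;
  try (apply continuous_on_of_cont with (fun x => f (clamp 0 1 x));
   [exact (continuous_on_clamp 0 1 f Rle_0_1 Cf)
   |intros x Hx; rewrite (clamp_id 0 1 x Hx); now rewrite E]).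
- exact I.
- destruct Hf as [f' [Hf Kf]]. exists f'. split; [|exact Kf]. intros x Hx.
  apply is_derive_on_ext with f; auto. lra.
Qed.

Lemma Ck_on_scal k f c : Ck_on k 0 1 f -> Ck_on k 0 1 (fun x => c * f x).
Proof.
intros H. apply Ck_on_ext with (fun x => 0 + c * f x); [intros; ring|].
apply (Ck_on_lin k (fun _ => 0)); [apply Ck_on_0|exact H].
Qed.

Lemma Ck_on_tp k : forall n t, (k < n)%nat -> Ck_on k 0 1 (tp n t).
Proof.
induction k as [|k IH]; intros n t Hn; split;
  try (apply continuous_on_of_cont with (tp n t); [apply cont_tp|auto]).
- exact I.
- exists (fun x => INR n * tp (n - 1) t x). split.
  + intros x Hx. apply is_derive_on_of; [lra|exact Hx|].
    replace n with (S (S (n - 2))) by lia.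
    replace (S (S (n - 2)) - 1)%nat with (S (n - 2)) by lia. apply is_derive_tp.
  + apply Ck_on_scal, IH. lia.
Qed.

Lemma Ck_on_pow k : forall n, Ck_on k 0 1 (fun x => x ^ n).
Proof.
induction k as [|k IH]; intros n; split;
  try (apply continuous_on_of_cont with (fun x => x ^ n); [cont|auto]).
- exact I.
- exists (fun x => INR n * x ^ pred n). split; [|now apply Ck_on_scal].
  intros x Hx. apply is_derive_on_of; [lra|exact Hx|].
  apply is_derive_eq with (INR n * 1 * x ^ pred n); [|ring].
  apply (is_derive_pow (fun y => y)). apply (is_derive_id x).
Qed.

Lemma sum_n_rsum (f : nat -> R) n : sum_n f n = rsum (S n) f.
Proof.
induction n as [|n IH]; [rewrite sum_O; simpl; symmetry; apply Rplus_0_l|].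
rewrite sum_Sn, IH. reflexivity.
Qed.

Lemma Spl_at0 r N X kappa h f : (2 <= r)%nat -> 0 < kappa -> mesh kappa h N X ->
  Spl r N X f -> f 0 = 0.
Proof.
intros Hr Hk Hm [c Hc]. rewrite Hc. apply rsum_eq0. intros k _. unfold gen.
destruct le_lt_dec.
- replace (r - 1)%nat with (S (r - 2)) by lia. rewrite tp_left; [ring|].
  assert (H0 : X O = 0) by apply Hm. rewrite <- H0.
  apply (mesh_le kappa h N); [lra|assumption|lia].
- simpl. ring.
Qed.

Lemma Spl_Ck r N X f : (2 <= r)%nat -> Spl r N X f -> Ck_on (r - 2) 0 1 f.
Proof.
intros Hr [c Hc].
apply Ck_on_ext with (fun x => rsum (dimgen r N) (fun k => c k * gen r X k x)).
- intros x. now rewrite Hc.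
- apply Ck_on_rsum. intros k _. unfold gen. destruct le_lt_dec.
  + apply Ck_on_ext with (tp (r - 1) (X (S (k - (r - 1))))); [reflexivity|].
    apply Ck_on_tp. lia.
  + apply Ck_on_pow.
Qed.

Lemma Spl_Sh r N xs kappa h f : (2 <= r)%nat -> 0 < kappa ->
  mesh kappa h N (extended N xs h) -> Spl r N (extended N xs h) f -> Sh r N xs f.
Proof.
intros Hr Hk Hm Hf. split; [|split].
- now apply (Spl_Ck r N (extended N xs h)).
- now apply (Spl_at0 r N (extended N xs h) kappa h).
- intros j Hj.
  destruct (Spl_local r N _ kappa h f (j - 1) Hr Hk Hm Hf) as [a Ha].
  assert (Hh : h <> 0) by (destruct Hm; lra).
  destruct (ispoly_lp r a (extended N xs h (j - 1)) h Hh) as [c Hc].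
  exists c. intros x Hx.
  rewrite !extended_eq in Ha by lia. rewrite !extended_eq in Hc by lia.
  replace (S (j - 1) + 1)%nat with (j + 1)%nat in Ha by lia.
  replace (j - 1 + 1)%nat with j in * by lia.
  rewrite Ha by exact Hx. rewrite Hc, sum_n_rsum.
  replace (S (r - 1)) with r by lia. reflexivity.
Qed.

Lemma is_derive_on_sub a b c d f x l : a <= c -> c < d -> d <= b ->
  interval c d x -> is_derive_on (interval a b) f x l ->
  is_derive_on (interval c d) f x l.
Proof.
intros H1 H2 H3 Hx H. assert (Hx' : interval a b x) by (unfold interval in *; lra).
apply is_derive_on_eps; auto. intros eps He.
destruct (proj1 (is_derive_on_eps a b f x l ltac:(lra) Hx') H eps He) as [e [He' H4]].
exists e. split; [exact He'|]. intros y Hy. apply H4. unfold interval in *; lra.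
Qed.

(** One-sided derivatives at [a] from both sides must agree, which kills the constant coefficient;
    the derivative of [psi] is again zero on the left and polynomial on the right, so induction on
    the smoothness applies. Across a node a spline of order [r] can therefore change only in the
    coefficient of degree [r - 1]. *)
Lemma smooth_junction n : forall r psi q a b, Ck_on n 0 1 psi -> 0 < a < b -> b <= 1 ->
  (forall x, 0 <= x <= a -> psi x = 0) ->
  (forall x, a <= x <= b -> psi x = rsum r (fun k => q k * (x - a) ^ k)) ->
  forall k, (k <= n)%nat -> (k < r)%nat -> q k = 0.
Proof.
induction n as [|n IH]; intros r psi q a b [Hc Hd] Hab Hb H0 Hq k Hk Hkr.
- assert (k = O) by lia. subst k. specialize (Hq a ltac:(lra)).
  rewrite H0 in Hq by lra. rewrite Rminus_diag in Hq.
  destruct r as [|r]; [lia|]. rewrite rsum_Sl in Hq.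
  rewrite (rsum_eq0 r) in Hq by (intros; simpl; ring). simpl in Hq. lra.
- destruct k as [|k].
  + specialize (Hq a ltac:(lra)). rewrite H0 in Hq by lra. rewrite Rminus_diag in Hq.
    destruct r as [|r]; [lia|]. rewrite rsum_Sl in Hq.
    rewrite (rsum_eq0 r) in Hq by (intros; simpl; ring). simpl in Hq. lra.
  + destruct Hd as [g [Hg Kg]]. destruct r as [|r]; [lia|].
    assert (E : INR (S k) * q (S k) = 0).
    { apply (IH r g (fun k => INR (S k) * q (S k)) a b Kg Hab Hb) with (k := k);
        [| |lia|lia].
      - intros x Hx. apply (is_derive_on_unique 0 a psi x); [lra|exact Hx| |].
        + apply (is_derive_on_sub 0 1); try lra; [exact Hx|].
          apply Hg. unfold interval; lra.
        + apply is_derive_on_ext with (fun _ => 0); [lra|exact Hx| |].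
          * intros y Hy. now rewrite H0.
          * apply is_derive_on_of; [lra|exact Hx|]. apply (is_derive_const 0).
      - intros x Hx. apply (is_derive_on_unique a b psi x); [lra|exact Hx| |].
        + apply (is_derive_on_sub 0 1); try lra; [exact Hx|].
          apply Hg. unfold interval; lra.
        + apply is_derive_on_ext with (fun x => rsum (S r) (fun k => q k * (x - a) ^ k));
            [lra|exact Hx| |].
          * intros y Hy. now rewrite Hq.
          * apply is_derive_on_of; [lra|exact Hx|].
            eapply is_derive_eq.
            -- apply (is_derive_rsum (S r) (fun k y => q k * (y - a) ^ k)
                (fun k y => q k * (INR k * 1 * (y - a) ^ pred k))).
               intros i _. apply is_derive_Rscal. apply (is_derive_pow (fun y => y - a)).
               auto_derive; [auto|ring].
            -- rewrite rsum_Sl. simpl (INR 0).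
               rewrite !Rmult_0_l, Rmult_0_r, Rplus_0_l.
               apply rsum_ext. intros i _. simpl pred. ring. }
    assert (INR (S k) <> 0) by (apply not_0_INR; lia).
    apply Rmult_integral in E. tauto.
Qed.

(** The representation is built from left to right. The difference between [phi] and the spline
    found so far has [r - 2] continuous derivatives and vanishes left of the node, so on the next
    cell it is a multiple of [(x - X (S j)) ^ (r - 1)], and one truncated power repairs it. *)
Lemma Sh_Spl r N xs kappa h phi : (2 <= r)%nat -> 0 < kappa ->
  mesh kappa h N (extended N xs h) -> Sh r N xs phi ->
  exists f, Spl r N (extended N xs h) f /\ forall x, 0 <= x <= 1 -> phi x = f x.
Proof.
intros Hr Hk Hm [HC [H0 Hp]]. set (X := extended N xs h) in *.
assert (Hm' := Hm). destruct Hm' as [Hh [HN [X0 [X1 Hst]]]].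
assert (Hpoly : forall j, (j < N)%nat -> exists p, ispoly r p /\
  forall x, X j <= x <= X (S j) -> phi x = p x).
{ intros j Hj. destruct (Hp (j + 1)%nat ltac:(lia)) as [c Hc].
  exists (fun x => rsum r (fun k => c k * x ^ k)). split; [now exists c|].
  intros x Hx. unfold X in Hx. rewrite !extended_eq in Hx by lia.
  rewrite Hc.
  - rewrite sum_n_rsum. replace (S (r - 1)) with r by lia. reflexivity.
  - unfold interval. replace (j + 1 + 1)%nat with (S j + 1)%nat by lia. exact Hx. }
assert (H : forall j, (j < N)%nat -> exists f, Spl r N X f /\
  forall x, 0 <= x <= X (S j) -> phi x = f x).
{ induction j as [|j IH]; intros Hj.
  - destruct (Hpoly O Hj) as [p [Hpp E]]. exists p. split.
    + apply Spl_ispoly; [exact Hpp|]. rewrite <- E; [exact H0|].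
      rewrite X0. specialize (Hst O). rewrite X0 in Hst.
      assert (0 < h / kappa) by now apply Rdiv_lt_0_compat. lra.
    + intros x Hx. apply E. rewrite X0. exact Hx.
  - destruct (IH ltac:(lia)) as [f [Hf E]].
    destruct (Hpoly (S j) Hj) as [p [Hpp Ep]].
    destruct (Spl_local r N X kappa h f (S j) Hr Hk Hm Hf) as [a Ha].
    destruct (lp_of_ispoly r (fun x => p x + (-1) * lp r a (X (S j)) h x) (X (S j)) 1)
      as [q Hq]; [lra|apply ispoly_lin; [exact Hpp|apply ispoly_lp; lra]|].
    assert (L1 := mesh_lt kappa h N X (S j) Hk Hm).
    assert (L0 : 0 < X (S j)).
    { rewrite <- X0. apply Rlt_le_trans with (X 1%nat).
      - now apply (mesh_lt kappa h N).
      - apply (mesh_le kappa h N); [lra|assumption|lia]. }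
    assert (L2 : X (S (S j)) <= 1) by (apply (mesh_in kappa h N X); auto; lia).
    assert (Hqv : forall x, lp r q (X (S j)) 1 x
      = rsum r (fun k => q k * (x - X (S j)) ^ k)).
    { intros x. apply rsum_ext. intros k _. f_equal. f_equal. field. }
    assert (Hpsi : forall x, X (S j) <= x <= X (S (S j)) ->
      phi x + (-1) * f x = rsum r (fun k => q k * (x - X (S j)) ^ k)).
    { intros x Hx. rewrite <- Hqv, <- Hq, Ep, <- Ha by exact Hx. reflexivity. }
    assert (Hz : forall k, (k <= r - 2)%nat -> q k = 0).
    { intros k Hkr.
      apply (smooth_junction (r - 2) r (fun x => phi x + (-1) * f x) q
        (X (S j)) (X (S (S j)))); [| |exact L2| |exact Hpsi|exact Hkr|lia].
      - apply Ck_on_lin; [exact HC|]. now apply (Spl_Ck r N X).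
      - split; [exact L0|exact L1].
      - intros x Hx. rewrite E by lra. ring. }
    exists (fun x => f x + q (r - 1)%nat * tp (r - 1) (X (S j)) x). split.
    + apply Spl_lin; [exact Hf|]. apply Spl_tp. lia.
    + intros x Hx. destruct (Rle_dec x (X (S j))) as [L|L].
      * rewrite E by lra. replace (r - 1)%nat with (S (r - 2)) at 2 by lia.
        rewrite tp_left by exact L. ring.
      * rewrite tp_right by lra. specialize (Hpsi x ltac:(lra)).
        rewrite (rsum_single r (r - 1)) in Hpsi; [lra|lia|].
        intros i Hi Hi2. rewrite Hz by lia. ring. }
destruct (H (N - 1)%nat ltac:(lia)) as [f [Hf E]]. exists f. split; [exact Hf|].
replace (S (N - 1)) with N in E by lia. rewrite X1 in E. exact E.
Qed.

(** * Orthonormal bases *)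

Definition orthonormal (m : nat) (phi : nat -> R -> R) : Prop :=
  forall i j, (i < m)%nat -> (j < m)%nat ->
  RInt (fun x => phi i x * phi j x) 0 1 = if Nat.eq_dec i j then 1 else 0.

(* [RInt] equations live in the carrier of a normed module. *)
Ltac Rring := match goal with |- @eq _ ?a ?b => change (@eq R a b) end; ring.

(** The generators are dependent on [0,1], where those with fictitious knots vanish. A vector whose
    residual has norm zero is therefore dropped, and the final expansions hold on [0,1] only,
    although the [phi i] are combinations of the generators on all of R. *)
Lemma gram_schmidt n (psi : nat -> R -> R) : (forall k, (k < n)%nat -> cont (psi k)) ->
  exists (m : nat) (phi : nat -> R -> R),
  (forall i, (i < m)%nat -> exists c, forall x, phi i x = rsum n (fun k => c k * psi k x)) /\
  orthonormal m phi /\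
  (forall k, (k < n)%nat -> exists d, forall x, 0 <= x <= 1 ->
     psi k x = rsum m (fun i => d i * phi i x)).
Proof.
induction n as [|n IH]; intros Hc.
{ exists O, (fun _ _ => 0). split; [|split]; intros i Hi; try (intros; lia); lia. }
destruct IH as [m [phi [Hs [Ho Hg]]]]; [intros; apply Hc; lia|].
assert (Hcn : cont (psi n)) by (apply Hc; lia).
assert (Hcp : forall i, (i < m)%nat -> cont (phi i)).
{ intros i Hi. destruct (Hs i Hi) as [c E].
  assert (A : cont (fun x => rsum n (fun k => c k * psi k x))).
  { cont. apply Hc; lia. }
  intros x. apply continuous_ext with (2 := A x). intros y. now rewrite E. }
set (w := fun x => psi n x - rsum m (fun i => RInt (fun x => psi n x * phi i x) 0 1 * phi i x)).
assert (Hw : cont w) by (unfold w; cont; now apply Hcp).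
assert (How : forall j, (j < m)%nat -> RInt (fun x => w x * phi j x) 0 1 = 0).
{ intros j Hj. assert (Cj := Hcp j Hj). unfold w.
  rewrite (RI_ext _ (fun x => psi n x * phi j x - rsum m (fun i =>
     RInt (fun x => psi n x * phi i x) 0 1 * (phi i x * phi j x)))).
  - rewrite RI_minus; [|cont|cont; now apply Hcp].
    rewrite RI_rsum by (intros i Hi; assert (Ci := Hcp i Hi); cont).
    rewrite (rsum_single m j); [|exact Hj|].
    + rewrite RI_scal by cont. rewrite Ho by assumption.
      destruct (Nat.eq_dec j j); [Rring|lia].
    + intros i Hi Hij. assert (Ci := Hcp i Hi). rewrite RI_scal by cont.
      rewrite Ho by assumption. destruct (Nat.eq_dec i j); [lia|Rring].
  - lra.
  - intros x _. rewrite Rmult_minus_distr_r. f_equal.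
    rewrite (Rmult_comm (rsum _ _)), <- rsum_scal. apply rsum_ext. intros; ring. }
assert (Hpad : forall i, (i < m)%nat -> exists c, forall x,
  phi i x = rsum (S n) (fun k => c k * psi k x)).
{ intros i Hi. destruct (Hs i Hi) as [c E].
  exists (fun k => if Nat.eq_dec k n then 0 else c k). intros x. rewrite E. simpl.
  destruct (Nat.eq_dec n n); [|lia].
  rewrite Rmult_0_l, Rplus_0_r. apply rsum_ext. intros k Hk.
  destruct (Nat.eq_dec k n); [lia|reflexivity]. }
assert (HsS : exists c, forall x, w x = rsum (S n) (fun k => c k * psi k x)).
{ destruct (finite_choice (fun i c => forall x, phi i x = rsum (S n) (fun k => c k * psi k x))
    (fun _ => 0) m Hpad) as [cc Hcc].
  exists (fun k => (if Nat.eq_dec k n then 1 else 0)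
     - rsum m (fun i => RInt (fun x => psi n x * phi i x) 0 1 * cc i k)).
  intros x. unfold w.
  rewrite (rsum_ext (S n) _ (fun k => (if Nat.eq_dec k n then 1 else 0) * psi k x -
    rsum m (fun i => psi k x * (RInt (fun x => psi n x * phi i x) 0 1 * cc i k)))).
  2:{ intros k _. rewrite rsum_scal. ring. }
  rewrite rsum_minus. f_equal.
  - rewrite (rsum_single (S n) n); [destruct (Nat.eq_dec n n); [Rring|lia]|lia|].
    intros j _ Hj. destruct (Nat.eq_dec j n); [lia|Rring].
  - rewrite rsum_swap. apply rsum_ext. intros i Hi. rewrite (Hcc i Hi).
    rewrite <- rsum_scal. apply rsum_ext. intros; ring. }
destruct HsS as [cw Hcw].
set (I := RInt (fun x => w x ^ 2) 0 1).
assert (HI : 0 <= I) by (apply RI_nonneg; [lra|cont|intros; apply pow2_ge_0]).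
destruct (Req_dec I 0) as [E|E].
- exists m, phi. split; [exact Hpad|]. split; [exact Ho|].
  intros k Hk. destruct (Nat.eq_dec k n) as [->|Ek]; [|apply Hg; lia].
  exists (fun i => RInt (fun x => psi n x * phi i x) 0 1). intros x Hx.
  assert (W := RI_sqr_eq0 w 0 1 Rlt_0_1 Hw E x Hx). unfold w in W. lra.
- assert (HI2 : 0 < I) by lra.
  assert (Hsq : 0 < sqrt I) by now apply sqrt_lt_R0.
  assert (Hss : sqrt I * sqrt I = I) by now apply sqrt_sqrt.
  exists (S m), (fun i => if Nat.eq_dec i m then (fun x => / sqrt I * w x) else phi i).
  split; [|split].
  + intros i Hi. destruct (Nat.eq_dec i m) as [_|Ei]; [|apply Hpad; lia].
    exists (fun k => / sqrt I * cw k). intros x. rewrite Hcw, <- rsum_scal.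
    apply rsum_ext. intros; ring.
  + assert (Hwi : forall i, (i < m)%nat -> RInt (fun x => / sqrt I * w x * phi i x) 0 1 = 0).
    { intros i Hi. assert (Ci := Hcp i Hi).
      rewrite (RI_ext _ (fun x => / sqrt I * (w x * phi i x))) by (try lra; intros; ring).
      rewrite RI_scal by cont. rewrite How by exact Hi. Rring. }
    intros i j Hi Hj.
    destruct (Nat.eq_dec i m) as [Ei|Ei], (Nat.eq_dec j m) as [Ej|Ej].
    * destruct (Nat.eq_dec i j); [|lia].
      rewrite (RI_ext _ (fun x => / (sqrt I * sqrt I) * w x ^ 2)); [|lra|].
      -- rewrite RI_scal by cont. fold I. rewrite Hss. now apply Rinv_l.
      -- intros x _. field. lra.
    * destruct (Nat.eq_dec i j); [lia|]. apply Hwi. lia.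
    * destruct (Nat.eq_dec i j); [lia|].
      transitivity (RInt (fun x => / sqrt I * w x * phi i x) 0 1); [|apply Hwi; lia].
      apply RI_ext; [lra|]. intros; ring.
    * apply Ho; lia.
  + intros k Hk. destruct (Nat.eq_dec k n) as [->|Ek].
    * exists (fun i => if Nat.eq_dec i m then sqrt I
        else RInt (fun x => psi n x * phi i x) 0 1).
      intros x _. simpl. destruct (Nat.eq_dec m m); [|lia].
      rewrite (rsum_ext m _ (fun i => RInt (fun x => psi n x * phi i x) 0 1 * phi i x)).
      -- unfold w. field. lra.
      -- intros i Hi. destruct (Nat.eq_dec i m); [lia|reflexivity].
    * destruct (Hg k ltac:(lia)) as [d Hd].
      exists (fun i => if Nat.eq_dec i m then 0 else d i). intros x Hx.
      rewrite Hd by exact Hx. simpl. destruct (Nat.eq_dec m m); [|lia].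
      rewrite Rmult_0_l, Rplus_0_r. apply rsum_ext. intros i Hi.
      destruct (Nat.eq_dec i m); [lia|reflexivity].
Qed.

Lemma orthonormal_basis r N X : (3 <= r)%nat ->
  exists (m : nat) (phi : nat -> R -> R),
  (forall i, (i < m)%nat -> Spl r N X (phi i)) /\ orthonormal m phi /\
  (forall f, Spl r N X f -> exists d, forall x, 0 <= x <= 1 ->
     f x = rsum m (fun i => d i * phi i x)).
Proof.
intros Hr.
destruct (gram_schmidt (dimgen r N) (gen r X)) as [m [phi [H1 [H2 H3]]]].
{ intros k Hk. apply (Spl_cont r N X); [exact Hr|]. now apply Spl_gen. }
exists m, phi. split; [|split; [exact H2|]].
- intros i Hi. destruct (H1 i Hi) as [c Hc]. now exists c.
- intros f [c Hc].
  destruct (finite_choice (fun k d => forall x, 0 <= x <= 1 ->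
    gen r X k x = rsum m (fun i => d i * phi i x)) (fun _ => 0) _ H3) as [dd Hdd].
  exists (fun i => rsum (dimgen r N) (fun k => c k * dd k i)). intros x Hx.
  rewrite Hc.
  rewrite (rsum_ext m _ (fun i => rsum (dimgen r N) (fun k => c k * dd k i * phi i x))).
  2:{ intros i _. rewrite Rmult_comm, <- rsum_scal. apply rsum_ext. intros; ring. }
  rewrite rsum_swap. apply rsum_ext. intros k Hk. rewrite (Hdd k Hk x Hx).
  rewrite <- rsum_scal. apply rsum_ext. intros; ring.
Qed.

(** * Ordinary differential equations *)

Lemma cont_abs f : cont f -> cont (fun x => Rabs (f x)).
Proof.
intros Hf. apply (cont_comp Rabs f); [|exact Hf]. apply cont_lip with 1.
intros x y. rewrite Rmult_1_l. apply Rabs_triang_inv2.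
Qed.

Lemma cont_inv f : cont f -> (forall x, f x <> 0) -> cont (fun x => / f x).
Proof.
intros Hf Hn x. apply continuity_pt_filterlim. apply continuity_pt_inv; [|apply Hn].
apply continuity_pt_filterlim, Hf.
Qed.

Lemma pow_half_pos k : 0 < (1 / 2) ^ k.
Proof. apply pow_lt. lra. Qed.

Lemma geometric_small E eps : 0 <= E -> 0 < eps -> exists k, E * (1 / 2) ^ k < eps.
Proof.
intros HE He.
destruct (pow_lt_1_zero (1 / 2)) with (y := eps / (E + 1)) as [k Hk].
- rewrite Rabs_pos_eq; lra.
- apply Rdiv_lt_0_compat; lra.
- exists k. specialize (Hk k ltac:(lia)).
  rewrite Rabs_pos_eq in Hk by (left; apply pow_half_pos).
  apply Rmult_lt_compat_r with (r := E + 1) in Hk; [|lra].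
  unfold Rdiv in Hk at 2. rewrite Rmult_assoc, Rinv_l in Hk by lra.
  assert (P := pow_half_pos k). nra.
Qed.

Lemma geometric_zero E a : 0 <= E -> (forall k, Rabs a <= E * (1 / 2) ^ k) -> a = 0.
Proof.
intros HE H. destruct (Req_dec a 0) as [->|N]; [reflexivity|exfalso].
destruct (geometric_small E (Rabs a) HE (Rabs_pos_lt _ N)) as [k Hk].
specialize (H k). lra.
Qed.

(** The intervals around [u k] of radius [2 * E * (1 / 2) ^ k] are nested. The limit is given as a
    sigma type so that a limit function can be formed pointwise. *)
Lemma geometric_limit (u : nat -> R) E : 0 <= E ->
  (forall k, Rabs (u (S k) - u k) <= E * (1 / 2) ^ k) ->
  {l | forall k, Rabs (u k - l) <= 2 * E * (1 / 2) ^ k}.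
Proof.
intros HE H.
assert (Hab : forall k, u k - 2 * E * (1 / 2) ^ k <= u (S k) - 2 * E * (1 / 2) ^ S k /\
  u (S k) + 2 * E * (1 / 2) ^ S k <= u k + 2 * E * (1 / 2) ^ k).
{ intros k. specialize (H k). apply Rabs_le_between in H. simpl. lra. }
assert (Hinc : forall k d, u k - 2 * E * (1 / 2) ^ k
    <= u (k + d)%nat - 2 * E * (1 / 2) ^ (k + d) /\
  u (k + d)%nat + 2 * E * (1 / 2) ^ (k + d) <= u k + 2 * E * (1 / 2) ^ k).
{ intros k. induction d as [|d IH].
  - rewrite Nat.add_0_r. lra.
  - rewrite Nat.add_succ_r. specialize (Hab (k + d)%nat). lra. }
assert (Hcross : forall j k, u j - 2 * E * (1 / 2) ^ j <= u k + 2 * E * (1 / 2) ^ k).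
{ intros j k. assert (A := Hinc j k). assert (B := Hinc k j).
  rewrite (Nat.add_comm k j) in B.
  assert (0 <= 2 * E * (1 / 2) ^ (j + k)).
  { assert (P := pow_half_pos (j + k)). nra. }
  lra. }
destruct (completeness (fun x => exists k, x = u k - 2 * E * (1 / 2) ^ k)) as [l [Hl1 Hl2]].
- exists (u O + 2 * E * (1 / 2) ^ O). intros x [k ->]. apply Hcross.
- exists (u O - 2 * E * (1 / 2) ^ O). now exists O.
- exists l. intros k. apply Rabs_le_between'.
  assert (u k - 2 * E * (1 / 2) ^ k <= l) by (apply Hl1; now exists k).
  assert (l <= u k + 2 * E * (1 / 2) ^ k).
  { apply Hl2. intros x [j ->]. apply Hcross. }
  lra.
Qed.

Lemma cont_uniform_limit (u : nat -> R -> R) f E : 0 <= E ->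
  (forall k, cont (u k)) -> (forall k t, Rabs (u k t - f t) <= E * (1 / 2) ^ k) ->
  cont f.
Proof.
intros HE Hu H t. apply cont_eps. intros eps He.
destruct (geometric_small E (eps / 3) HE ltac:(lra)) as [k Hk].
destruct (proj1 (cont_eps (u k) t) (Hu k t) (eps / 3) ltac:(lra)) as [d [Hd Hd2]].
exists d. split; [exact Hd|]. intros y Hy. specialize (Hd2 y Hy).
assert (A := H k y). assert (B := H k t).
replace (f y - f t) with (- (u k y - f y) + (u k y - u k t) + (u k t - f t)) by ring.
eapply Rle_lt_trans; [apply Rabs_triang|].
assert (T := Rabs_triang (- (u k y - f y)) (u k y - u k t)).
rewrite Rabs_Ropp in T. lra.
Qed.

Lemma common_bound m (P : nat -> R -> Prop) :
  (forall i a b, a <= b -> P i a -> P i b) ->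
  (forall i, (i < m)%nat -> exists M, 0 <= M /\ P i M) ->
  exists M, 0 <= M /\ forall i, (i < m)%nat -> P i M.
Proof.
intros Hmon. induction m as [|m IH]; intros H.
- exists 0. split; [lra|]. intros; lia.
- destruct IH as [M [HM H1]]; [intros; apply H; lia|].
  destruct (H m ltac:(lia)) as [M2 [HM2 H2]].
  exists (Rmax M M2). split; [eapply Rle_trans; [exact HM|apply Rmax_l]|].
  intros i Hi. destruct (Nat.eq_dec i m) as [->|E].
  + apply Hmon with M2; [apply Rmax_r|exact H2].
  + apply Hmon with M; [apply Rmax_l|apply H1; lia].
Qed.

(** Successive approximation, with differences measured against the weight [exp (K * t)]: in this
    measure one step contracts by 1/2 whatever the length of [0,T]. *)
Lemma picard m (G : nat -> R -> (nat -> R) -> R) T L : 0 <= T -> 0 <= L ->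
  (forall y : nat -> R -> R, (forall j, (j < m)%nat -> cont (y j)) ->
     forall i, (i < m)%nat -> cont (fun t => G i t (fun j => y j t))) ->
  (forall i t c c', (i < m)%nat ->
     Rabs (G i t c - G i t c') <= L * rsum m (fun j => Rabs (c j - c' j))) ->
  exists y dy : nat -> R -> R, forall i, (i < m)%nat ->
    y i 0 = 0 /\ cont (dy i) /\ (forall t, is_derive (y i) t (dy i t)) /\
    forall t, 0 <= t <= T -> dy i t = G i t (fun j => y j t).
Proof.
intros HT HL HG HLip.
set (cl := clamp 0 T).
assert (Hcl : forall t, 0 <= cl t <= T) by (intros; now apply clamp_in).
set (Y := fix Y (k : nat) : nat -> R -> R := match k with
  | O => fun _ _ => 0
  | S k' => fun i t => RInt (fun s => G i s (fun j => Y k' j s)) 0 (cl t) end).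
assert (HYc : forall k i, (i < m)%nat -> cont (Y k i)).
{ induction k as [|k IH]; intros i Hi; simpl; [cont|].
  apply (cont_comp (fun t => RInt (fun s => G i s (fun j => Y k j s)) 0 t) cl).
  - apply cont_RI, HG; auto.
  - apply cont_clamp. }
destruct (common_bound m (fun i M => forall t, 0 <= t <= T -> Rabs (G i t (fun _ => 0)) <= M))
  as [B [HB HBb]].
{ intros i a b Hab H t Ht. specialize (H t Ht). lra. }
{ intros i Hi. apply cont_bounded; [exact HT|].
  apply (HG (fun _ _ => 0)); [intros; cont|exact Hi]. }
(* Chosen so that [INR m * L / K <= 1 / 2], which is the contraction factor; the summand 1 keeps [K]
   positive. *)
set (K := 1 + 2 * (INR m * L)). assert (Pm := pos_INR m).
assert (HK : 1 <= K) by (unfold K; nra).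
set (A := T * B). assert (HA : 0 <= A) by (unfold A; nra).
assert (Hexp : forall t, 0 <= t -> 1 <= exp (K * t)).
{ intros t Ht. rewrite <- exp_0. destruct (Req_dec t 0) as [->|E].
  - rewrite Rmult_0_r. lra.
  - left. apply exp_increasing. nra. }
assert (HcE : cont (fun s => exp (K * s))).
{ apply is_derive_cont with (fun s => K * exp (K * s)).
  intros s. auto_derive; [auto|ring]. }
assert (Hdiff : forall k i t, (i < m)%nat ->
  Rabs (Y (S k) i t - Y k i t) <= A * (1 / 2) ^ k * exp (K * cl t)).
{ induction k as [|k IH]; intros i t Hi; specialize (Hcl t).
  - simpl. rewrite Rminus_0_r, Rmult_1_r.
    apply Rle_trans with ((cl t - 0) * B).
    + apply RI_abs_le; [lra| |].
      * apply (HG (fun _ _ => 0)); [intros; cont|exact Hi].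
      * intros x Hx. apply HBb; [exact Hi|lra].
    + specialize (Hexp (cl t) ltac:(lra)).
      assert (cl t * B <= A) by (apply Rmult_le_compat_r; lra). nra.
  - change (Y (S (S k)) i t) with (RInt (fun s => G i s (fun j => Y (S k) j s)) 0 (cl t)).
    change (Y (S k) i t) with (RInt (fun s => G i s (fun j => Y k j s)) 0 (cl t)).
    assert (C1 : cont (fun s => G i s (fun j => Y (S k) j s)))
      by (apply HG; [intros; now apply HYc|exact Hi]).
    assert (C2 : cont (fun s => G i s (fun j => Y k j s)))
      by (apply HG; [intros; now apply HYc|exact Hi]).
    rewrite <- RI_minus by assumption.
    set (c := A * (1 / 2) ^ k).
    assert (Hc : 0 <= c) by (unfold c; assert (P := pow_half_pos k); nra).
    eapply Rle_trans; [apply abs_RInt_le; [lra|apply cont_ex_RInt; cont]|].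
    apply Rle_trans with (RInt (fun s => (INR m * L * c) * exp (K * s)) 0 (cl t)).
    + apply RI_le; [lra|apply cont_abs; cont|cont|]. intros s Hs.
      eapply Rle_trans; [now apply HLip|].
      replace (INR m * L * c * exp (K * s)) with (L * (INR m * (c * exp (K * s)))) by ring.
      apply Rmult_le_compat_l; [exact HL|]. rewrite <- rsum_const.
      apply rsum_le. intros j Hj. specialize (IH j s Hj). fold c in IH.
      unfold cl in IH. rewrite clamp_id in IH by lra. exact IH.
    + rewrite (FTC_open (fun s => INR m * L * c / K * exp (K * s))).
      * rewrite Rmult_0_r, exp_0.
        assert (HK0 : K > 0) by lra.
        assert (INR m * L / K <= 1 / 2)
          by (apply (proj2 (Rle_div_l _ _ _ HK0)); unfold K; lra).
        assert (0 <= INR m * L / K).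
        { apply Rle_div_r; [lra|]. rewrite Rmult_0_l. now apply Rmult_le_pos. }
        assert (P := exp_pos (K * cl t)).
        replace (INR m * L * c / K) with (INR m * L / K * c) by (field; lra).
        set (q := INR m * L / K) in *.
        replace (A * (1 / 2) ^ S k) with (1 / 2 * c) by (unfold c; simpl; ring).
        assert (0 <= q * c) by nra. assert (q * c <= 1 / 2 * c) by nra. nra.
      * lra.
      * apply cont_mult; [cont|exact HcE].
      * apply cont_mult; [cont|exact HcE].
      * intros s _. auto_derive; [auto|]. field. lra. }
set (E := A * exp (K * T)).
assert (HE : 0 <= E) by (unfold E; assert (P := exp_pos (K * T)); nra).
assert (Hdiff2 : forall k i t, (i < m)%nat ->
  Rabs (Y (S k) i t - Y k i t) <= E * (1 / 2) ^ k).
{ intros k i t Hi. eapply Rle_trans; [now apply Hdiff|]. unfold E.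
  assert (exp (K * cl t) <= exp (K * T)).
  { destruct (Req_dec (cl t) T) as [->|NE]; [lra|]. left. apply exp_increasing.
    specialize (Hcl t). nra. }
  replace (A * exp (K * T) * (1 / 2) ^ k) with (A * (1 / 2) ^ k * exp (K * T)) by ring.
  apply Rmult_le_compat_l; [|assumption].
  assert (P := pow_half_pos k). nra. }
clearbody E.
destruct (finite_choice (fun i (f : R -> R) => forall k t,
   Rabs (Y k i t - f t) <= 2 * E * (1 / 2) ^ k) (fun _ => 0) m) as [Z HZ].
{ intros i Hi.
  exists (fun t => proj1_sig (geometric_limit (fun k => Y k i t) E HE
     (fun k => Hdiff2 k i t Hi))).
  intros k t. destruct geometric_limit as [l Hl]. exact (Hl k). }
assert (HZc : forall i, (i < m)%nat -> cont (Z i)).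
{ intros i Hi. apply (cont_uniform_limit (fun k => Y k i) (Z i) (2 * E)); [lra| |].
  - intros k. now apply HYc.
  - intros k t. now apply HZ. }
assert (HGZ : forall i, (i < m)%nat -> cont (fun s => G i s (fun j => Z j s))).
{ intros i Hi. now apply HG. }
assert (HZe : forall i t, (i < m)%nat ->
  Z i t = RInt (fun s => G i s (fun j => Z j s)) 0 (cl t)).
{ intros i t Hi. apply Rminus_diag_uniq.
  apply (geometric_zero (2 * E + T * (L * (INR m * (2 * E))))).
  { assert (0 <= T * (L * (INR m * (2 * E)))) by (repeat apply Rmult_le_pos; lra). lra. }
  intros k. specialize (Hcl t).
  assert (C2 : cont (fun s => G i s (fun j => Y k j s)))
    by (apply HG; [intros; now apply HYc|exact Hi]).
  assert (HGi := HGZ i Hi).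
  assert (A1 := HZ i Hi (S k) t).
  change (Y (S k) i t) with (RInt (fun s => G i s (fun j => Y k j s)) 0 (cl t)) in A1.
  set (I1 := RInt (fun s => G i s (fun j => Y k j s)) 0 (cl t)) in *.
  set (I2 := RInt (fun s => G i s (fun j => Z j s)) 0 (cl t)).
  assert (A2 : Rabs (I1 - I2) <= T * (L * (INR m * (2 * E * (1 / 2) ^ k)))).
  { unfold I1, I2. rewrite <- RI_minus by assumption.
    assert (0 <= L * (INR m * (2 * E * (1 / 2) ^ k))).
    { assert (P := pow_half_pos k). repeat apply Rmult_le_pos; lra. }
    apply Rle_trans with ((cl t - 0) * (L * (INR m * (2 * E * (1 / 2) ^ k)))).
    - apply RI_abs_le; [lra|cont|]. intros s Hs.
      eapply Rle_trans; [now apply HLip|].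
      apply Rmult_le_compat_l; [exact HL|]. rewrite <- rsum_const.
      apply rsum_le. intros j Hj. now apply HZ.
    - apply Rmult_le_compat_r; lra. }
  replace (Z i t - I2) with (- (I1 - Z i t) + (I1 - I2)) by ring.
  eapply Rle_trans; [apply Rabs_triang|]. rewrite Rabs_Ropp.
  assert (2 * E * (1 / 2) ^ S k <= 2 * E * (1 / 2) ^ k).
  { simpl. assert (P := pow_half_pos k). nra. }
  lra. }
(* The limit [Z] is frozen outside [0,T]. The integral with free upper end coincides with it on
   [0,T] and is differentiable at every [t], endpoints included. *)
exists (fun i t => RInt (fun s => G i s (fun j => Z j s)) 0 t).
exists (fun i t => G i t (fun j => Z j t)).
intros i Hi. split; [|split; [|split]].
- apply (RInt_point (V := R_CompleteNormedModule)).
- now apply HGZ.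
- intros t. now apply (is_derive_RI (fun s => G i s (fun j => Z j s))), HGZ.
- intros t Ht. cbv beta. apply Rminus_diag_uniq.
  assert (H : Rabs (G i t (fun j => Z j t) -
    G i t (fun j => RInt (fun s => G j s (fun j0 => Z j0 s)) 0 t)) <= 0).
  { eapply Rle_trans; [now apply HLip|]. rewrite rsum_eq0; [lra|].
    intros j Hj. rewrite HZe by exact Hj. unfold cl. rewrite clamp_id by exact Ht.
    rewrite Rminus_diag. apply Rabs_R0. }
  destruct (Req_dec (G i t (fun j => Z j t) -
    G i t (fun j => RInt (fun s => G j s (fun j0 => Z j0 s)) 0 t)) 0) as [H0|H0];
    [exact H0|].
  apply Rabs_pos_lt in H0. lra.
Qed.

Definition loc_lip (m : nat) (F : nat -> (nat -> R) -> R) : Prop :=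
  forall M, 0 <= M -> exists L, 0 <= L /\ forall i c c', (i < m)%nat ->
  (forall j, (j < m)%nat -> Rabs (c j) <= M) ->
  (forall j, (j < m)%nat -> Rabs (c' j) <= M) ->
  Rabs (F i c - F i c') <= L * rsum m (fun j => Rabs (c j - c' j)).

Lemma loc_lip_cont m (F : nat -> (nat -> R) -> R) (e : nat -> R -> R) i : loc_lip m F -> (i < m)%nat ->
  (forall j, (j < m)%nat -> cont (e j)) -> cont (fun t => F i (fun j => e j t)).
Proof.
intros HF Hi He t.
destruct (common_bound m (fun j M => forall s, t - 1 <= s <= t + 1 -> Rabs (e j s) <= M))
  as [M [HM HMb]].
{ intros j a b Hab H s Hs. specialize (H s Hs). lra. }
{ intros j Hj. apply cont_bounded; [lra|]. now apply He. }
destruct (HF M HM) as [L [HL HLip]].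
set (g := fun s => L * rsum m (fun j => Rabs (e j s - e j t))).
assert (Hg : cont g).
{ unfold g. cont. apply cont_abs. cont. now apply He. }
assert (Hg0 : g t = 0).
{ unfold g. rewrite rsum_eq0; [ring|]. intros. rewrite Rminus_diag. apply Rabs_R0. }
apply cont_eps. intros eps Heps.
destruct (proj1 (cont_eps g t) (Hg t) eps Heps) as [d [Hd H]].
exists (Rmin 1 d). split; [apply Rmin_glb_lt; lra|]. intros s Hs.
assert (H1 : Rabs (s - t) < 1) by (eapply Rlt_le_trans; [exact Hs|apply Rmin_l]).
assert (H2 : Rabs (s - t) < d) by (eapply Rlt_le_trans; [exact Hs|apply Rmin_r]).
apply Rabs_def2 in H1. specialize (H s H2). rewrite Hg0, Rminus_0_r in H.
eapply Rle_lt_trans; [apply (HLip i _ _ Hi)|].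
- intros j Hj. apply HMb; [exact Hj|lra].
- intros j Hj. apply HMb; [exact Hj|lra].
- eapply Rle_lt_trans; [apply Rle_abs|exact H].
Qed.

(* Dividing by [trunc m rho v] retracts onto a ball of radius [rho] and is the
   identity there. *)
Definition trunc (m : nat) (rho : R) (v : nat -> R) : R :=
  Rmax 1 (rsum m (fun i => v i ^ 2) / rho ^ 2).

Lemma trunc_ge1 m rho v : 1 <= trunc m rho v.
Proof. apply Rmax_l. Qed.

Lemma trunc_sum m rho v : 0 < rho -> rsum m (fun i => v i ^ 2) <= trunc m rho v * rho ^ 2.
Proof.
intros Hr. apply Rle_div_l; [now apply pow_lt|]. apply Rmax_r.
Qed.

Lemma trunc_coord m rho v i : 0 < rho -> (i < m)%nat -> v i ^ 2 <= trunc m rho v * rho ^ 2.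
Proof.
intros Hr Hi. eapply Rle_trans; [|now apply trunc_sum].
apply (rsum_term_le m (fun i => v i ^ 2)); [intros; apply pow2_ge_0|exact Hi].
Qed.

Lemma trunc_coord_abs m rho v i : 0 < rho -> (i < m)%nat ->
  Rabs (v i) <= rho * trunc m rho v.
Proof.
intros Hr Hi. assert (H := trunc_coord m rho v i Hr Hi). assert (H1 := trunc_ge1 m rho v).
apply abs_le_of_sqr; [nra|]. rewrite Rpow_mult_distr.
assert (0 < rho ^ 2) by now apply pow_lt.
assert (trunc m rho v <= trunc m rho v ^ 2) by nra. nra.
Qed.

(** Outside the ball the map is the inversion [v -> rho^2 v / |v|^2], for which no square root is
    needed. The change of the denominator is quadratic in [v] and [w], and the product of the two
    denominators in the quotient offsets this growth. The constant 3 is 1 from the numerator and 2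
    from the denominator. *)
Lemma trunc_lip m rho v w j : 0 < rho -> (j < m)%nat ->
  Rabs (v j / trunc m rho v - w j / trunc m rho w)
  <= 3 * rsum m (fun i => Rabs (v i - w i)).
Proof.
intros Hr Hj.
assert (Ha := trunc_ge1 m rho v). assert (Hb := trunc_ge1 m rho w).
assert (Hr2 : 0 < rho ^ 2) by now apply pow_lt.
set (s := rsum m (fun i => Rabs (v i - w i))).
assert (Hvj : Rabs (v j - w j) <= s).
{ apply (rsum_term_le m (fun i => Rabs (v i - w i))); [intros; apply Rabs_pos|exact Hj]. }
assert (Hs : 0 <= s) by (eapply Rle_trans; [apply Rabs_pos|exact Hvj]).
set (a := trunc m rho v) in *. set (b := trunc m rho w) in *.
assert (Hba : Rabs (b - a) <= rsum m (fun i => Rabs (v i - w i) * (Rabs (v i) + Rabs (w i)))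
   / rho ^ 2).
{ assert (Q : Rabs (b - a) <= Rabs (rsum m (fun i => v i ^ 2) / rho ^ 2
     - rsum m (fun i => w i ^ 2) / rho ^ 2)).
  { unfold a, b, trunc. set (p := rsum m (fun i => w i ^ 2) / rho ^ 2).
    set (q := rsum m (fun i => v i ^ 2) / rho ^ 2).
    unfold Rmax. repeat destruct Rle_dec; unfold Rabs; repeat destruct Rcase_abs; lra. }
  eapply Rle_trans; [exact Q|]. unfold Rdiv. rewrite <- Rmult_minus_distr_r.
  rewrite Rabs_mult, (Rabs_pos_eq (/ _)) by (left; now apply Rinv_0_lt_compat).
  apply Rmult_le_compat_r; [left; now apply Rinv_0_lt_compat|].
  rewrite <- rsum_minus. eapply Rle_trans; [apply rsum_abs|]. apply rsum_le.
  intros i _. replace (v i ^ 2 - w i ^ 2) with ((v i - w i) * (v i + w i)) by ring.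
  rewrite Rabs_mult. apply Rmult_le_compat_l; [apply Rabs_pos|apply Rabs_triang]. }
assert (Hwb : Rabs (w j) * Rabs (b - a) / (a * b) <= 2 * s).
{ apply Rle_div_l; [nra|].
  apply Rle_trans with (rsum m (fun i => Rabs (v i - w i) * (2 * (a * b)))).
  - eapply Rle_trans; [apply Rmult_le_compat_l; [apply Rabs_pos|exact Hba]|].
    unfold Rdiv. rewrite <- Rmult_assoc. apply Rle_div_l; [exact Hr2|].
    rewrite <- rsum_scal, Rmult_comm, <- rsum_scal. apply rsum_le. intros i Hi.
    assert (V := trunc_coord_abs m rho v i Hr Hi). fold a in V.
    assert (W := trunc_coord_abs m rho w j Hr Hj). fold b in W.
    assert (W2 := trunc_coord m rho w j Hr Hj). fold b in W2.
    assert (W3 := trunc_coord m rho w i Hr Hi). fold b in W3.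
    rewrite <- pow2_abs in W2. rewrite <- pow2_abs in W3.
    assert (P0 := Rabs_pos (v i - w i)). assert (P1 := Rabs_pos (v i)).
    assert (P2 := Rabs_pos (w j)). assert (P3 := Rabs_pos (w i)).
    set (vi := Rabs (v i)) in *. set (wj := Rabs (w j)) in *. set (wi := Rabs (w i)) in *.
    set (d := Rabs (v i - w i)) in *.
    assert (T1 : wj * vi <= rho ^ 2 * (a * b)).
    { replace (rho ^ 2 * (a * b)) with ((rho * b) * (rho * a)) by ring.
      apply Rmult_le_compat; auto. }
    assert (T2 : wj * wi <= rho ^ 2 * (a * b)).
    { assert (wj * wi <= b * rho ^ 2) by nra.
      assert (b * rho ^ 2 <= rho ^ 2 * (a * b)) by nra. lra. }
    replace (wj * (d * (vi + wi))) with (d * (wj * vi + wj * wi)) by ring.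
    replace (rho ^ 2 * (d * (2 * (a * b)))) with (d * (2 * (rho ^ 2 * (a * b)))) by ring.
    apply Rmult_le_compat_l; lra.
  - rewrite (rsum_ext m _ (fun i => 2 * (a * b) * Rabs (v i - w i))) by (intros; ring).
    rewrite rsum_scal. fold s. lra. }
replace (v j / a - w j / b) with ((v j - w j) / a + w j * (b - a) / (a * b))
  by (field; lra).
eapply Rle_trans; [apply Rabs_triang|].
rewrite !Rabs_div by nra. rewrite (Rabs_mult (w j)).
rewrite (Rabs_pos_eq a), (Rabs_pos_eq (a * b)) by nra.
assert (Rabs (v j - w j) / a <= s).
{ apply Rle_div_l; [lra|]. nra. }
lra.
Qed.

(** The unknown is the deviation from the given curve [c]. Since the retracted deviation is bounded
    by [rho], the argument of [F] stays in a fixed ball, where a local Lipschitz constant serves for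
    all times. *)
Lemma truncated_ode m (F : nat -> (nat -> R) -> R) (c dc : nat -> R -> R) T rho : loc_lip m F -> 0 <= T -> 0 < rho ->
  (forall j, (j < m)%nat -> cont (c j) /\ cont (dc j)) ->
  exists y dy : nat -> R -> R, forall i, (i < m)%nat ->
    y i 0 = 0 /\ cont (dy i) /\ (forall t, is_derive (y i) t (dy i t)) /\
    forall t, 0 <= t <= T ->
      dy i t = dc i t - F i (fun j => c j t - y j t / trunc m rho (fun j => y j t)).
Proof.
intros HF HT Hr Hc. set (cl := clamp 0 T).
destruct (common_bound m (fun j M => forall s, 0 <= s <= T -> Rabs (c j s) <= M))
  as [M [HM HMb]].
{ intros j a b Hab H s Hs. specialize (H s Hs). lra. }
{ intros j Hj. apply cont_bounded; [lra|]. now apply Hc. }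
destruct (HF (M + rho) ltac:(lra)) as [L [HL HLip]].
set (G := fun i t v => dc i (cl t) - F i (fun j => c j (cl t) - v j / trunc m rho v)).
assert (Pm := pos_INR m).
destruct (picard m G T (L * (INR m * 3))) as [y [dy Hy]].
- exact HT.
- repeat apply Rmult_le_pos; lra.
- intros y Hy i Hi. unfold G. apply cont_minus.
  + apply (cont_comp (dc i) cl); [now apply Hc|apply cont_clamp].
  + apply (loc_lip_cont m F
      (fun j t => c j (cl t) - y j t / trunc m rho (fun j => y j t)) i HF Hi).
    intros j Hj. apply cont_minus.
    * apply (cont_comp (c j) cl); [now apply Hc|apply cont_clamp].
    * apply (cont_mult (y j)); [now apply Hy|]. apply cont_inv.
      -- unfold trunc. apply (cont_comp (Rmax 1)); [|cont; now apply Hy].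
         apply cont_lip with 1. intros p q. rewrite Rmult_1_l. unfold Rmax.
         repeat destruct Rle_dec; unfold Rabs; repeat destruct Rcase_abs; lra.
      -- intros t. assert (H := trunc_ge1 m rho (fun j => y j t)). lra.
- intros i t v w Hi. unfold G.
  set (d := dc i (cl t)).
  replace (d - F i (fun j => c j (cl t) - v j / trunc m rho v)
    - (d - F i (fun j => c j (cl t) - w j / trunc m rho w)))
   with (F i (fun j => c j (cl t) - w j / trunc m rho w)
     - F i (fun j => c j (cl t) - v j / trunc m rho v)) by ring.
  assert (Hb : forall u j, (j < m)%nat -> Rabs (c j (cl t) - u j / trunc m rho u) <= M + rho).
  { intros u j Hj. eapply Rle_trans; [apply Rabs_triang|]. rewrite Rabs_Ropp.
    apply Rplus_le_compat; [apply HMb; [exact Hj|now apply clamp_in]|].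
    assert (H1 := trunc_ge1 m rho u).
    rewrite Rabs_div, (Rabs_pos_eq (trunc m rho u)) by lra.
    apply Rle_div_l; [lra|]. now apply trunc_coord_abs. }
  eapply Rle_trans; [apply HLip; auto|]. rewrite Rmult_assoc.
  apply Rmult_le_compat_l; [exact HL|]. rewrite Rmult_assoc, <- rsum_const.
  apply rsum_le. intros j Hj.
  replace (c j (cl t) - w j / trunc m rho w - (c j (cl t) - v j / trunc m rho v))
    with (v j / trunc m rho v - w j / trunc m rho w) by ring.
  now apply trunc_lip.
- exists y, dy. intros i Hi. destruct (Hy i Hi) as [H1 [H2 [H3 H4]]]. split; [exact H1|].
  split; [exact H2|]. split; [exact H3|]. intros t Ht. rewrite H4 by exact Ht.
  unfold G, cl. now rewrite clamp_id by exact Ht.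
Qed.

(** Both solutions stay in a common ball on [0,T], so one Lipschitz constant applies, and Gronwall
    for the squared distance gives zero. *)
Lemma ode_unique m (F : nat -> (nat -> R) -> R) (c d : nat -> R -> R) T : loc_lip m F -> 0 <= T ->
  (forall j, (j < m)%nat -> cont (c j) /\ cont (d j) /\ c j 0 = d j 0) ->
  (forall j t, (j < m)%nat -> 0 < t < T ->
     is_derive (c j) t (F j (fun i => c i t)) /\ is_derive (d j) t (F j (fun i => d i t))) ->
  forall j t, (j < m)%nat -> 0 <= t <= T -> c j t = d j t.
Proof.
intros HF HT Hc Hd.
destruct (common_bound m (fun j M => forall s, 0 <= s <= T ->
   Rabs (c j s) <= M /\ Rabs (d j s) <= M)) as [M [HM HMb]].
{ intros j a b Hab H s Hs. specialize (H s Hs). lra. }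
{ intros j Hj. destruct (Hc j Hj) as [C1 [C2 _]].
  destruct (cont_bounded (c j) 0 T HT C1) as [M1 [HM1 B1]].
  destruct (cont_bounded (d j) 0 T HT C2) as [M2 [HM2 B2]].
  exists (M1 + M2). split; [lra|]. intros s Hs. specialize (B1 s Hs).
  specialize (B2 s Hs). lra. }
destruct (HF M HM) as [L [HL HLip]]. assert (Pm := pos_INR m).
set (E := fun t => rsum m (fun j => (c j t - d j t) ^ 2)).
assert (HE : forall t, 0 <= t <= T -> E t <= (E 0 + 0 * t) * exp (2 * L * INR m * t)).
{ apply gronwall with (dE := fun t => rsum m (fun j => 2 * (c j t - d j t) *
    (F j (fun i => c i t) - F j (fun i => d i t)))).
  - repeat apply Rmult_le_pos; lra.
  - lra.
  - unfold E. cont; now apply Hc.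
  - intros t Ht. split.
    + unfold E. apply (is_derive_rsum m (fun j t => (c j t - d j t) ^ 2)
        (fun j t => 2 * (c j t - d j t) *
          (F j (fun i => c i t) - F j (fun i => d i t)))).
      intros j Hj. destruct (Hd j t Hj Ht) as [D1 D2].
      eapply is_derive_eq.
      * apply (is_derive_pow (fun t => c j t - d j t) 2).
        apply is_derive_Rminus; [exact D1|exact D2].
      * simpl. ring.
    + set (s := rsum m (fun i => Rabs (c i t - d i t))).
      apply Rle_trans with (rsum m (fun j => 2 * L * s * Rabs (c j t - d j t))).
      * apply rsum_le. intros j Hj.
        assert (H := HLip j (fun i => c i t) (fun i => d i t) Hj
          (fun i Hi => proj1 (HMb i Hi t ltac:(lra))) (fun i Hi => proj2 (HMb i Hi t ltac:(lra)))).
        cbv beta in H. fold s in H.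
        eapply Rle_trans; [apply Rle_abs|]. rewrite !Rabs_mult, (Rabs_pos_eq 2) by lra.
        assert (P := Rabs_pos (c j t - d j t)). nra.
      * rewrite rsum_scal. fold s.
        assert (Q := rsum_sqr_le m (fun i => Rabs (c i t - d i t))). fold s in Q.
        rewrite (rsum_ext m _ (fun j => (c j t - d j t) ^ 2)) in Q
          by (intros; apply pow2_abs).
        fold (E t) in Q. rewrite Rplus_0_r.
        replace (2 * L * s * s) with (2 * L * s ^ 2) by ring.
        rewrite (Rmult_assoc (2 * L)). apply Rmult_le_compat_l; lra. }
intros j t Hj Ht. specialize (HE t Ht).
assert (E0 : E 0 = 0).
{ unfold E. apply rsum_eq0. intros i Hi. destruct (Hc i Hi) as [_ [_ ->]]. ring. }
rewrite E0 in HE. replace ((0 + 0 * t) * exp (2 * L * INR m * t)) with 0 in HE by ring.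
assert (H := rsum_term_le m (fun j => (c j t - d j t) ^ 2) j
  (fun i _ => pow2_ge_0 _) Hj). cbv beta in H. fold (E t) in H.
assert ((c j t - d j t) ^ 2 = 0) by (assert (P := pow2_ge_0 (c j t - d j t)); lra).
apply Rminus_diag_uniq. nra.
Qed.

(** * The energy inequality *)

Lemma prod_bound c B x y S : Rabs c <= B -> x ^ 2 <= S -> y ^ 2 <= S ->
  - (B * S) <= c * x * y <= B * S.
Proof.
intros Hc Hx Hy. apply Rabs_le_between. rewrite Rmult_assoc, Rabs_mult.
apply Rmult_le_compat; auto using Rabs_pos.
apply Rabs_le. assert (0 <= (x - y) ^ 2) by apply pow2_ge_0.
assert (0 <= (x + y) ^ 2) by apply pow2_ge_0. nra.
Qed.

Lemma Rabs_mult_le a b A B : Rabs a <= A -> Rabs b <= B -> Rabs (a * b) <= A * B.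
Proof. intros. rewrite Rabs_mult. apply Rmult_le_compat; auto using Rabs_pos. Qed.

(* With [e = rho + s th] and [f = sig + s xi], the flux terms tested with [th]
   and [H xi + h d] are [s] times the derivative of
   [U th^2 / 2 + H th xi + H U xi^2 / 2] up to a quadratic form in
   [th, xi, h th_x, h xi_x, d, rho, sig, rho_x, sig_x].  Here [p = h th_x],
   [q = h xi_x], [e = h e'], [f = h f']. *)
Lemma energy_pointwise K h s U Ux H Hx th thx xi xix rho rhox sig sigx d (e' f' : R) :
  1 <= K -> 0 < h <= 1 -> 0 <= s <= 1 ->
  Rabs U <= K -> Rabs Ux <= K -> Rabs H <= K -> Rabs Hx <= K ->
  Rabs e' <= K -> Rabs f' <= K ->
  rho + s * th = h * e' -> sig + s * xi = h * f' ->
  let e := rho + s * th in let f := sig + s * xi in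
  let ex := rhox + s * thx in let fx := sigx + s * xix in
  s * (/ 2 * Ux * th ^ 2 + U * th * thx + Hx * th * xi + H * thx * xi + H * th * xix
       + / 2 * (Hx * U + H * Ux) * xi ^ 2 + H * U * xi * xix)
  - 40 * K ^ 2 * (th ^ 2 + xi ^ 2 + (h * thx) ^ 2 + (h * xix) ^ 2 + d ^ 2
       + rho ^ 2 + rhox ^ 2 + sig ^ 2 + sigx ^ 2)
  <= (Ux * e + U * ex + Hx * f + H * fx - ex * f - e * fx) * th
     + (ex + Ux * f + U * fx - f * fx) * (H * xi + h * d).
Proof.
intros HK Hh Hs HU HUx HH HHx He' Hf' Ee Ef e f ex fx.
set (p := h * thx). set (q := h * xix).
set (S := th ^ 2 + xi ^ 2 + p ^ 2 + q ^ 2 + d ^ 2 + rho ^ 2 + rhox ^ 2 + sig ^ 2 + sigx ^ 2).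
assert (G1 := pow2_ge_0 th). assert (G2 := pow2_ge_0 xi). assert (G3 := pow2_ge_0 p).
assert (G4 := pow2_ge_0 q). assert (G5 := pow2_ge_0 d). assert (G6 := pow2_ge_0 rho).
assert (G7 := pow2_ge_0 rhox). assert (G8 := pow2_ge_0 sig). assert (G9 := pow2_ge_0 sigx).
assert (S1 : th ^ 2 <= S) by (unfold S; lra). assert (S2 : xi ^ 2 <= S) by (unfold S; lra).
assert (S3 : p ^ 2 <= S) by (unfold S; lra). assert (S4 : q ^ 2 <= S) by (unfold S; lra).
assert (S5 : d ^ 2 <= S) by (unfold S; lra). assert (S6 : rho ^ 2 <= S) by (unfold S; lra).
assert (S7 : rhox ^ 2 <= S) by (unfold S; lra). assert (S8 : sig ^ 2 <= S) by (unfold S; lra).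
assert (S9 : sigx ^ 2 <= S) by (unfold S; lra).
assert (S0 : 0 <= S) by lra.
assert (Hsa : Rabs s <= 1) by (rewrite Rabs_pos_eq; lra).
assert (Hha : Rabs h <= 1) by (rewrite Rabs_pos_eq; lra).
assert (Hsh : Rabs (s * / 2) <= 1) by (rewrite Rabs_pos_eq; lra).
assert (KK : K <= K ^ 2) by nra.
assert (m1 : forall a, Rabs a <= K -> Rabs (s * a) <= K).
{ intros a Ha. replace K with (1 * K) by ring. now apply Rabs_mult_le. }
assert (m2 : forall a, Rabs a <= K -> Rabs (h * a) <= K).
{ intros a Ha. replace K with (1 * K) by ring. now apply Rabs_mult_le. }
assert (m3 : forall a b, Rabs a <= K -> Rabs b <= K -> Rabs (a * b) <= K ^ 2).
{ intros a b Ha Hb. replace (K ^ 2) with (K * K) by ring. now apply Rabs_mult_le. }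
assert (K1 : Rabs 1 <= K) by (rewrite Rabs_R1; lra).
assert (T : forall c x y, Rabs c <= K ^ 2 -> x ^ 2 <= S -> y ^ 2 <= S ->
  - (K ^ 2 * S) <= c * x * y) by (intros; now apply prod_bound).
assert (W : forall a, Rabs a <= K -> Rabs a <= K ^ 2) by (intros; lra).
assert (N : forall a, Rabs a <= K ^ 2 -> Rabs (- a) <= K ^ 2)
  by (intros; now rewrite Rabs_Ropp).
assert (Hh2 : Rabs (/ 2 * Hx) <= K).
{ rewrite Rabs_mult, (Rabs_pos_eq (/ 2)) by lra. assert (P := Rabs_pos Hx). lra. }
assert (Hu2 : Rabs (/ 2 * Ux) <= K).
{ rewrite Rabs_mult, (Rabs_pos_eq (/ 2)) by lra. assert (P := Rabs_pos Ux). lra. }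
(* The list covers every term that is not part of the exact derivative: 24 products of two of the
   nine quantities with coefficients at most [K ^ 2], so that 40 is ample. Derivatives of [th] and
   [xi] occur only as [p] and [q]; the factor [h] they need comes from [e = h * e'], [f = h * f'] or
   the defect [h * d]. *)
assert (A1 := T (s * (/ 2 * Ux)) th th (W _ (m1 _ Hu2)) S1 S1).
assert (A2 := T ((s * H) * (/ 2 * Ux)) xi xi (m3 _ _ (m1 _ HH) Hu2) S2 S2).
assert (A3 := T (- ((s * U) * (/ 2 * Hx))) xi xi (N _ (m3 _ _ (m1 _ HU) Hh2)) S2 S2).
assert (A4 := T Ux rho th (W _ HUx) S6 S1).
assert (A5 := T U rhox th (W _ HU) S7 S1).
assert (A6 := T Hx sig th (W _ HHx) S8 S1).
assert (A7 := T H sigx th (W _ HH) S9 S1).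
assert (B1 := T (1 * H) rhox xi (m3 _ _ K1 HH) S7 S2).
assert (B2 := T (Ux * H) sig xi (m3 _ _ HUx HH) S8 S2).
assert (B3 := T (U * H) sigx xi (m3 _ _ HU HH) S9 S2).
assert (B4 := T (h * 1) rhox d (W _ (m2 _ K1)) S7 S5).
assert (B5 := T (h * Ux) sig d (W _ (m2 _ HUx)) S8 S5).
assert (B6 := T (h * U) sigx d (W _ (m2 _ HU)) S9 S5).
assert (C1 := T (s * 1) p d (W _ (m1 _ K1)) S3 S5).
assert (C2 := T (s * (h * Ux)) xi d (W _ (m1 _ (m2 _ HUx))) S2 S5).
assert (C3 := T (s * U) q d (W _ (m1 _ HU)) S4 S5).
assert (D1 := T (- (h * f')) rhox th (N _ (W _ (m2 _ Hf'))) S7 S1).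
assert (D2 := T (- (s * f')) p th (N _ (W _ (m1 _ Hf'))) S3 S1).
assert (D3 := T (- (h * e')) sigx th (N _ (W _ (m2 _ He'))) S9 S1).
assert (D4 := T (- (s * e')) q th (N _ (W _ (m1 _ He'))) S4 S1).
assert (E1 := T (- ((h * f') * H)) sigx xi (N _ (m3 _ _ (m2 _ Hf') HH)) S9 S2).
assert (E2 := T (- ((s * f') * H)) q xi (N _ (m3 _ _ (m1 _ Hf') HH)) S4 S2).
assert (E3 := T (- (h * (h * f'))) sigx d (N _ (W _ (m2 _ (m2 _ Hf')))) S9 S5).
assert (E4 := T (- (h * (s * f'))) q d (N _ (W _ (m2 _ (m1 _ Hf')))) S4 S5).
match goal with |- _ <= ?r => assert (Q : r =
  s * (/ 2 * Ux * th ^ 2 + U * th * thx + Hx * th * xi + H * thx * xi + H * th * xix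
       + / 2 * (Hx * U + H * Ux) * xi ^ 2 + H * U * xi * xix)
  + s * (/ 2 * Ux) * th * th + (s * H) * (/ 2 * Ux) * xi * xi
  + - ((s * U) * (/ 2 * Hx)) * xi * xi
  + Ux * rho * th + U * rhox * th + Hx * sig * th + H * sigx * th
  + 1 * H * rhox * xi + Ux * H * sig * xi + U * H * sigx * xi
  + h * 1 * rhox * d + h * Ux * sig * d + h * U * sigx * d
  + s * 1 * p * d + s * (h * Ux) * xi * d + s * U * q * d
  + - (h * f') * rhox * th + - (s * f') * p * th + - (h * e') * sigx * th
  + - (s * e') * q * th
  + - ((h * f') * H) * sigx * xi + - ((s * f') * H) * q * xi
  + - (h * (h * f')) * sigx * d + - (h * (s * f')) * q * d) end.
{ replace (ex * f) with (ex * (h * f')) by (unfold f; rewrite Ef; ring).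
  replace (e * fx) with (h * e' * fx) by (unfold e; rewrite Ee; ring).
  replace (f * fx) with (h * f' * fx) by (unfold f; rewrite Ef; ring).
  unfold e, f, ex, fx, p, q. field. }
rewrite Q. assert (0 <= K ^ 2 * S) by nra. lra.
Qed.

(** [chi] stands for the projection of [H xi], and only its distance to [H xi] divided by [h] is
    charged. As [s] is constant in space, the exact derivative integrates to [s] times the boundary
    form, which vanishes at 0 and is nonnegative at 1. *)
Lemma energy_integrated K h s (U Ux H Hx th thx xi xix rho rhox sig sigx chi : R -> R) :
  1 <= K -> 0 < h <= 1 -> 0 <= s <= 1 ->
  cont U -> cont Ux -> cont H -> cont Hx -> cont th -> cont thx -> cont xi -> cont xix ->
  cont rho -> cont rhox -> cont sig -> cont sigx -> cont chi ->
  (forall x, 0 < x < 1 -> is_derive U x (Ux x) /\ is_derive H x (Hx x) /\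
     is_derive th x (thx x) /\ is_derive xi x (xix x)) ->
  (forall x, 0 <= x <= 1 -> Rabs (U x) <= K /\ Rabs (Ux x) <= K /\
     Rabs (H x) <= K /\ Rabs (Hx x) <= K /\
     Rabs (rho x + s * th x) <= K * h /\ Rabs (sig x + s * xi x) <= K * h) ->
  th 0 = 0 -> xi 0 = 0 -> 0 < U 1 -> 0 <= H 1 <= U 1 ^ 2 ->
  - (40 * K ^ 2) * RInt (fun x => th x ^ 2 + xi x ^ 2 + (h * thx x) ^ 2 + (h * xix x) ^ 2
      + ((chi x - H x * xi x) / h) ^ 2
      + rho x ^ 2 + rhox x ^ 2 + sig x ^ 2 + sigx x ^ 2) 0 1
  <= RInt (fun x =>
      let e := rho x + s * th x in let f := sig x + s * xi x in
      let ex := rhox x + s * thx x in let fx := sigx x + s * xix x in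
      (Ux x * e + U x * ex + Hx x * f + H x * fx - ex * f - e * fx) * th x
      + (ex + Ux x * f + U x * fx - f * fx) * chi x) 0 1.
Proof.
intros HK Hh Hs CU CUx CH CHx Cth Cthx Cxi Cxix Cr Crx Cs Csx Cchi Hd Hb Hth0 Hxi0 HU1 HH1.
cbv zeta.
set (B := fun x => / 2 * (U x * th x ^ 2) + H x * th x * xi x + / 2 * (H x * U x * xi x ^ 2)).
set (Bx := fun x => / 2 * Ux x * th x ^ 2 + U x * th x * thx x + Hx x * th x * xi x
  + H x * thx x * xi x + H x * th x * xix x
  + / 2 * (Hx x * U x + H x * Ux x) * xi x ^ 2 + H x * U x * xi x * xix x).
assert (CB : cont B) by (unfold B; cont).
assert (CBx : cont Bx) by (unfold Bx; cont).
assert (HBx : RInt Bx 0 1 = B 1 - B 0).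
{ apply FTC_open; [lra|exact CB|exact CBx|]. intros x Hx01.
  destruct (Hd x Hx01) as [D1 [D2 [D3 D4]]].
  assert (P1 : is_derive (fun x => th x ^ 2) x (2 * thx x * th x)).
  { eapply is_derive_eq; [apply (is_derive_pow th 2 x (thx x) D3)|simpl; ring]. }
  assert (P2 : is_derive (fun x => xi x ^ 2) x (2 * xix x * xi x)).
  { eapply is_derive_eq; [apply (is_derive_pow xi 2 x (xix x) D4)|simpl; ring]. }
  eapply is_derive_eq.
  - apply is_derive_Rplus; [apply is_derive_Rplus|].
    + apply is_derive_Rscal. apply is_derive_Rmult; [exact D1|exact P1].
    + apply is_derive_Rmult; [apply is_derive_Rmult; [exact D2|exact D3]|exact D4].
    + apply is_derive_Rscal. apply is_derive_Rmult; [|exact P2].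
      apply is_derive_Rmult; [exact D2|exact D1].
  - unfold Bx. cbv beta. field. }
assert (HB0 : B 0 = 0) by (unfold B; rewrite Hth0, Hxi0; ring).
(* Multiplication by [U 1] completes the square: what remains besides it is [H (U^2 - H) xi^2] at
   the endpoint, where the supercritical condition applies. *)
assert (HB1 : 0 <= B 1).
{ apply Rmult_le_reg_l with (U 1); [exact HU1|]. rewrite Rmult_0_r. unfold B.
  assert (0 <= (U 1 * th 1 + H 1 * xi 1) ^ 2) by apply pow2_ge_0.
  assert (0 <= H 1 * (U 1 ^ 2 - H 1) * xi 1 ^ 2).
  { apply Rmult_le_pos; [|apply pow2_ge_0]. apply Rmult_le_pos; lra. }
  replace (U 1 * (/ 2 * (U 1 * th 1 ^ 2) + H 1 * th 1 * xi 1 + / 2 * (H 1 * U 1 * xi 1 ^ 2)))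
    with (/ 2 * ((U 1 * th 1 + H 1 * xi 1) ^ 2 + H 1 * (U 1 ^ 2 - H 1) * xi 1 ^ 2)) by field.
  lra. }
set (Sx := fun x => th x ^ 2 + xi x ^ 2 + (h * thx x) ^ 2 + (h * xix x) ^ 2
      + ((chi x - H x * xi x) / h) ^ 2
      + rho x ^ 2 + rhox x ^ 2 + sig x ^ 2 + sigx x ^ 2).
assert (CS : cont Sx) by (unfold Sx; cont).
apply Rle_trans with (RInt (fun x => s * Bx x + - (40 * K ^ 2) * Sx x) 0 1).
- rewrite RI_plus by cont. rewrite !RI_scal by assumption. rewrite HBx, HB0.
  assert (0 <= s * (B 1 - 0)) by (apply Rmult_le_pos; lra).
  change (RInt (fun x => th x ^ 2 + xi x ^ 2 + (h * thx x) ^ 2 + (h * xix x) ^ 2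
      + ((chi x - H x * xi x) / h) ^ 2
      + rho x ^ 2 + rhox x ^ 2 + sig x ^ 2 + sigx x ^ 2) 0 1) with (RInt Sx 0 1).
  lra.
- apply RI_le; [lra|cont|cont|]. intros x Hx01.
  destruct (Hb x ltac:(lra)) as [B1 [B2 [B3 [B4 [B5 B6]]]]].
  assert (Hdiv : forall z, Rabs z <= K * h -> Rabs (z / h) <= K).
  { intros z Hz. rewrite Rabs_div, (Rabs_pos_eq h) by lra.
    apply (proj2 (Rle_div_l _ _ _ (Rlt_gt _ _ (proj1 Hh)))). exact Hz. }
  assert (E := energy_pointwise K h s (U x) (Ux x) (H x) (Hx x) (th x) (thx x) (xi x) (xix x)
    (rho x) (rhox x) (sig x) (sigx x) ((chi x - H x * xi x) / h)
    ((rho x + s * th x) / h) ((sig x + s * xi x) / h) HK Hh Hs B1 B2 B3 B4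
    (Hdiv _ B5) (Hdiv _ B6)).
  cbv zeta in E.
  replace (H x * xi x + h * ((chi x - H x * xi x) / h)) with (chi x) in E by (field; lra).
  unfold Bx, Sx.
  eapply Rle_trans; [|apply E; field; lra]. right. ring.
Qed.

(** * Projection onto the spline space *)

Definition comb (m : nat) (phi : nat -> R -> R) (c : nat -> R) (x : R) : R :=
  rsum m (fun j => c j * phi j x).

Definition basis (r N : nat) (X : nat -> R) (m : nat) (phi dphi : nat -> R -> R) : Prop :=
  (forall i, (i < m)%nat -> Spl r N X (phi i) /\ cont (phi i) /\ cont (dphi i) /\
     forall x, is_derive (phi i) x (dphi i x)) /\
  orthonormal m phi /\
  (forall f, Spl r N X f -> exists d, forall x, 0 <= x <= 1 -> f x = comb m phi d x).

Lemma basis_exists r N X : (3 <= r)%nat -> exists m phi dphi, basis r N X m phi dphi.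
Proof.
intros Hr. destruct (orthonormal_basis r N X Hr) as [m [phi [H1 [H2 H3]]]].
destruct (finite_choice (fun i d => cont d /\ forall x, is_derive (phi i) x (d x))
  (fun _ => 0) m) as [dphi Hd].
{ intros i Hi. apply (Spl_deriv r N X); auto. }
exists m, phi, dphi. split; [|split; [exact H2|exact H3]].
intros i Hi. destruct (Hd i Hi) as [A B]. split; [now apply H1|].
split; [apply (Spl_cont r N X); auto|]. now split.
Qed.

Lemma comb_scal m phi c a x : comb m phi (fun j => a * c j) x = a * comb m phi c x.
Proof. unfold comb. rewrite <- rsum_scal. apply rsum_ext. intros; ring. Qed.

Lemma comb_minus m phi c d x :
  comb m phi (fun j => c j - d j) x = comb m phi c x - comb m phi d x.
Proof. unfold comb. rewrite <- rsum_minus. apply rsum_ext. intros; ring. Qed.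

Lemma cont_comb m phi c : (forall i, (i < m)%nat -> cont (phi i)) -> cont (comb m phi c).
Proof. intros H. unfold comb. cont. now apply H. Qed.

Lemma basis_comb r N X m phi dphi c : basis r N X m phi dphi ->
  Spl r N X (comb m phi c) /\ cont (comb m phi c) /\ cont (comb m dphi c) /\
  forall x, is_derive (comb m phi c) x (comb m dphi c x).
Proof.
intros [H _]. split; [|split; [|split]].
- apply Spl_rsum. intros i Hi. apply Spl_scal. now apply H.
- apply cont_comb. intros; now apply H.
- apply cont_comb. intros; now apply H.
- intros x. apply (is_derive_rsum m (fun j x => c j * phi j x) (fun j x => c j * dphi j x)).
  intros i Hi. apply is_derive_Rscal. now apply H.
Qed.

Lemma inner_comb m phi c g : (forall i, (i < m)%nat -> cont (phi i)) -> cont g ->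
  RInt (fun x => g x * comb m phi c x) 0 1 =
  rsum m (fun j => c j * RInt (fun x => g x * phi j x) 0 1).
Proof.
intros Hp Hg.
rewrite (RI_ext _ (fun x => rsum m (fun j => c j * (g x * phi j x)))).
- rewrite RI_rsum.
  + apply rsum_ext. intros j Hj. assert (Cj := Hp j Hj). rewrite RI_scal by cont.
    reflexivity.
  + intros j Hj. assert (Cj := Hp j Hj). cont.
- lra.
- intros x _. unfold comb. rewrite <- rsum_scal. apply rsum_ext. intros; ring.
Qed.

Lemma inner_comb_comb m phi c d : (forall i, (i < m)%nat -> cont (phi i)) ->
  orthonormal m phi ->
  RInt (fun x => comb m phi c x * comb m phi d x) 0 1 = rsum m (fun j => c j * d j).
Proof.
intros Hp Ho. rewrite inner_comb by (auto; now apply cont_comb).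
apply rsum_ext. intros j Hj. rewrite Rmult_comm. f_equal.
rewrite (RI_ext _ (fun x => phi j x * comb m phi c x)) by (try lra; intros; ring).
rewrite inner_comb by auto.
rewrite (rsum_single m j).
- rewrite Ho by assumption. destruct (Nat.eq_dec j j); [Rring|lia].
- exact Hj.
- intros i Hi Hij. rewrite Ho by assumption. destruct (Nat.eq_dec j i); [lia|Rring].
Qed.

Lemma norm_comb m phi c : (forall i, (i < m)%nat -> cont (phi i)) -> orthonormal m phi ->
  RInt (fun x => comb m phi c x ^ 2) 0 1 = rsum m (fun j => c j ^ 2).
Proof.
intros Hp Ho.
rewrite (RI_ext _ (fun x => comb m phi c x * comb m phi c x)) by (try lra; intros; ring).
rewrite inner_comb_comb by auto. apply rsum_ext. intros; ring.
Qed.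

Definition proj_coef (phi : nat -> R -> R) (g : R -> R) (j : nat) : R :=
  RInt (fun x => g x * phi j x) 0 1.

Lemma best_approx m phi g d : (forall i, (i < m)%nat -> cont (phi i)) ->
  orthonormal m phi -> cont g ->
  RInt (fun x => (comb m phi (proj_coef phi g) x - g x) ^ 2) 0 1
  <= RInt (fun x => (comb m phi d x - g x) ^ 2) 0 1.
Proof.
intros Hp Ho Hg.
assert (E : forall c, RInt (fun x => (comb m phi c x - g x) ^ 2) 0 1 =
  rsum m (fun j => c j ^ 2) - 2 * rsum m (fun j => c j * proj_coef phi g j)
  + RInt (fun x => g x ^ 2) 0 1).
{ intros c. assert (Cc := cont_comb m phi c Hp).
  rewrite (RI_ext _ (fun x => comb m phi c x ^ 2 - 2 * (g x * comb m phi c x) + g x ^ 2))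
    by (try lra; intros; ring).
  rewrite RI_plus by cont. rewrite RI_minus by cont. rewrite RI_scal by cont.
  rewrite norm_comb, inner_comb by assumption. reflexivity. }
rewrite !E. set (g2 := RInt (fun x => g x ^ 2) 0 1).
assert (H : 0 <= rsum m (fun j => (d j - proj_coef phi g j) ^ 2))
  by (apply rsum_nonneg; intros; apply pow2_ge_0).
rewrite (rsum_ext m (fun j => (d j - proj_coef phi g j) ^ 2)
  (fun j => d j ^ 2 - 2 * (d j * proj_coef phi g j) + proj_coef phi g j ^ 2)) in H
  by (intros; ring).
rewrite rsum_plus, rsum_minus, rsum_scal in H.
rewrite (rsum_ext m (fun j => proj_coef phi g j * proj_coef phi g j)
  (fun j => proj_coef phi g j ^ 2)) by (intros; ring).
lra.
Qed.

Lemma sqr_plus_le a b : (a + b) ^ 2 <= 2 * a ^ 2 + 2 * b ^ 2.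
Proof. assert (0 <= (a - b) ^ 2) by apply pow2_ge_0. nra. Qed.

Lemma RI_sqr_plus f g : cont f -> cont g -> RInt (fun x => (f x + g x) ^ 2) 0 1
  <= 2 * RInt (fun x => f x ^ 2) 0 1 + 2 * RInt (fun x => g x ^ 2) 0 1.
Proof.
intros Hf Hg. rewrite <- !RI_scal by cont. rewrite <- RI_plus by cont.
apply RI_le; [lra|cont|cont|]. intros; apply sqr_plus_le.
Qed.

Lemma RI_sqr_sup f B : cont f -> (forall x, 0 < x < 1 -> Rabs (f x) <= B) ->
  RInt (fun x => f x ^ 2) 0 1 <= B ^ 2.
Proof.
intros Hf H. replace (B ^ 2) with ((1 - 0) * B ^ 2) by ring. rewrite <- RI_const.
apply RI_le; [lra|cont|cont|]. intros x Hx. now apply sqr_le_of_abs, H.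
Qed.

(** The projection is compared with the approximant [psi]. Their difference [w] is a spline of L2
    norm O(h^r), so the inverse estimates give O(h^(r-1)) for its derivative and O(h^(r-1/2)) for
    its maximum; of the latter only O(h) is kept. *)
Lemma proj_error r kappa : (3 <= r)%nat -> 1 <= kappa ->
  exists C, 0 <= C /\ forall h N X m phi dphi, mesh kappa h N X -> h <= 1 ->
  basis r N X m phi dphi ->
  forall D M, chain r D -> 0 <= M -> (forall x, 0 <= x <= 1 -> Rabs (D r x) <= M) ->
  D O 0 = 0 ->
  let c := proj_coef phi (D O) in
  RInt (fun x => (D O x - comb m phi c x) ^ 2) 0 1 <= C * M ^ 2 * (h ^ (r - 1)) ^ 2 /\
  RInt (fun x => (D 1%nat x - comb m dphi c x) ^ 2) 0 1 <= C * M ^ 2 * (h ^ (r - 1)) ^ 2 /\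
  forall x, 0 <= x <= 1 -> (D O x - comb m phi c x) ^ 2 <= C * M ^ 2 * h ^ 2.
Proof.
intros Hr Hk. destruct (approx r kappa Hr Hk) as [C1 [HC1 Hap]].
destruct (inverse_estimates r kappa Hr Hk) as [C2 [HC2 Hinv]].
exists ((2 + 8 * C2) * C1 ^ 2).
assert (HC12 : 0 <= C1 ^ 2) by apply pow2_ge_0. split; [nra|].
intros h N X m phi dphi Hm Hh1 Hb D M HD HM HB H0 c.
assert (Hh : 0 < h) by now destruct Hm.
destruct (Hap h N X Hm D M HD HM HB H0) as [psi [Hpsi [Hp1 Hp2]]].
assert (Hb' := Hb). destruct Hb' as [Hb1 [Ho Hspan]].
destruct (Hspan psi Hpsi) as [d Hd].
assert (Hpc : forall i, (i < m)%nat -> cont (phi i)) by (intros; now apply Hb1).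
destruct (basis_comb r N X m phi dphi d Hb) as [Sq [Cq [Cdq Dq]]].
destruct (basis_comb r N X m phi dphi c Hb) as [Sp [Cp [Cdp Dp]]].
destruct (basis_comb r N X m phi dphi (fun j => d j - c j) Hb) as [Sw [Cw [Cdw Dw]]].
assert (CD0 : cont (D O)) by (apply HD; lia).
assert (CD1 : cont (D 1%nat)) by (apply HD; lia).
set (q := comb m phi d) in *. set (dq := comb m dphi d) in *.
set (p := comb m phi c) in *. set (dp := comb m dphi c) in *.
set (e1 := C1 * M * h ^ r).
assert (Q1 : forall x, 0 <= x <= 1 -> Rabs (q x - D O x) <= e1).
{ intros x Hx. rewrite <- Hd by exact Hx. now apply Hp1. }
(* [q] agrees with [psi] on [0,1] only, so their derivatives are identified at interior points. *)
assert (Q2 : forall x, 0 < x < 1 -> Rabs (dq x - D 1%nat x) <= C1 * M * h ^ (r - 1)).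
{ intros x Hx. apply Hp2; [exact Hx|]. apply is_derive_ext_loc with q; [|apply Dq].
  exists (mkposreal (Rmin x (1 - x)) ltac:(apply Rmin_glb_lt; lra)).
  intros y Hy. symmetry. apply Hd. apply Rabs_def2 in Hy. simpl in Hy.
  unfold minus, plus, opp in Hy; simpl in Hy.
  assert (A := Rmin_l x (1 - x)). assert (B := Rmin_r x (1 - x)). lra. }
assert (I1 : RInt (fun x => (q x - D O x) ^ 2) 0 1 <= e1 ^ 2).
{ apply (RI_sqr_sup (fun x => q x - D O x)); [cont|]. intros x Hx. apply Q1. lra. }
assert (I2 : RInt (fun x => (p x - D O x) ^ 2) 0 1 <= e1 ^ 2).
{ eapply Rle_trans; [|exact I1]. now apply best_approx. }
set (w := comb m phi (fun j => d j - c j)) in *.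
set (dw := comb m dphi (fun j => d j - c j)) in *.
assert (Iw : RInt (fun x => w x ^ 2) 0 1 <= 4 * e1 ^ 2).
{ rewrite (RI_ext _ (fun x => ((q x - D O x) + (-1) * (p x - D O x)) ^ 2)).
  - eapply Rle_trans; [apply (RI_sqr_plus (fun x => q x - D O x)
      (fun x => -1 * (p x - D O x))); cont|].
    rewrite (RI_ext (fun x => (-1 * (p x - D O x)) ^ 2) (fun x => (p x - D O x) ^ 2))
      by (try lra; intros; ring). lra.
  - lra.
  - intros x _. unfold w, q, p. rewrite comb_minus. ring. }
destruct (Hinv h N X Hm w dw Sw Cdw Dw) as [V1 [V2 V3]].
assert (Hhr : h ^ r = h * h ^ (r - 1)).
{ replace r with (S (r - 1)) at 1 by lia. reflexivity. }
assert (Hp0 : 0 < h ^ (r - 1)) by now apply pow_lt.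
assert (Hpr : h ^ (r - 1) <= h).
{ replace (r - 1)%nat with (S (r - 2)) by lia. simpl.
  assert (h ^ (r - 2) <= 1) by (rewrite <- (pow1 (r - 2)); apply pow_incr; lra).
  assert (0 < h ^ (r - 2)) by now apply pow_lt. nra. }
set (g := h ^ (r - 1)) in *.
assert (He : e1 ^ 2 = C1 ^ 2 * M ^ 2 * (h ^ 2 * g ^ 2)) by (unfold e1; rewrite Hhr; ring).
assert (HCM : 0 <= C1 ^ 2 * M ^ 2) by (apply Rmult_le_pos; apply pow2_ge_0).
assert (Hg2 : 0 <= g ^ 2) by apply pow2_ge_0.
assert (Hh2 : 0 < h ^ 2) by now apply pow_lt.
assert (Hh21 : h ^ 2 <= 1) by nra.
assert (Hgh : g ^ 2 <= h ^ 2) by (apply pow_incr; lra).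
split; [|split].
- rewrite (RI_ext _ (fun x => (p x - D O x) ^ 2)) by (try lra; intros; ring).
  eapply Rle_trans; [exact I2|]. rewrite He.
  assert (h ^ 2 * g ^ 2 <= g ^ 2) by nra.
  apply Rle_trans with (C1 ^ 2 * M ^ 2 * g ^ 2); [now apply Rmult_le_compat_l|].
  assert (0 <= C1 ^ 2 * M ^ 2 * g ^ 2) by (apply Rmult_le_pos; auto). nra.
- assert (J1 : RInt (fun x => (dq x - D 1%nat x) ^ 2) 0 1 <= (C1 * M * g) ^ 2).
  { apply (RI_sqr_sup (fun x => dq x - D 1%nat x)); [cont|exact Q2]. }
  assert (J2 : RInt (fun x => dw x ^ 2) 0 1 <= 4 * C2 * (C1 ^ 2 * M ^ 2) * g ^ 2).
  { apply Rmult_le_reg_l with (h ^ 2); [exact Hh2|].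
    eapply Rle_trans; [exact V3|].
    eapply Rle_trans; [apply Rmult_le_compat_l; [exact HC2|exact Iw]|].
    rewrite He. right. ring. }
  rewrite (RI_ext _ (fun x => ((-1) * (dq x - D 1%nat x) + dw x) ^ 2)).
  + eapply Rle_trans; [apply (RI_sqr_plus (fun x => -1 * (dq x - D 1%nat x)) dw); cont|].
    rewrite (RI_ext (fun x => (-1 * (dq x - D 1%nat x)) ^ 2)
      (fun x => (dq x - D 1%nat x) ^ 2)) by (try lra; intros; ring).
    replace ((C1 * M * g) ^ 2) with (C1 ^ 2 * M ^ 2 * g ^ 2) in J1 by ring. lra.
  + lra.
  + intros x _. unfold dw, dq, dp. rewrite comb_minus. ring.
- intros x Hx. specialize (V1 x Hx). specialize (Q1 x Hx).
  replace (D O x - p x) with ((-1) * (q x - D O x) + w x).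
  2:{ unfold w, q, p. rewrite comb_minus. ring. }
  eapply Rle_trans; [apply sqr_plus_le|].
  apply sqr_le_of_abs in Q1. rewrite He in Q1.
  assert (W1 : w x ^ 2 <= 4 * C2 * (C1 ^ 2 * M ^ 2) * h ^ 2).
  { apply Rmult_le_reg_r with h; [exact Hh|].
    eapply Rle_trans; [exact V1|].
    eapply Rle_trans; [apply Rmult_le_compat_l; [exact HC2|exact Iw]|].
    rewrite He. assert (g ^ 2 <= h) by nra.
    replace (C2 * (4 * (C1 ^ 2 * M ^ 2 * (h ^ 2 * g ^ 2))))
      with (4 * C2 * (C1 ^ 2 * M ^ 2) * h ^ 2 * g ^ 2) by ring.
    apply Rmult_le_compat_l; [|assumption].
    repeat apply Rmult_le_pos; try lra; apply pow2_ge_0. }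
  assert (g ^ 2 <= 1) by lra.
  assert (h ^ 2 * g ^ 2 <= h ^ 2) by nra.
  assert (C1 ^ 2 * M ^ 2 * (h ^ 2 * g ^ 2) <= C1 ^ 2 * M ^ 2 * h ^ 2)
    by now apply Rmult_le_compat_l.
  replace ((-1 * (q x - D O x)) ^ 2) with ((q x - D O x) ^ 2) by ring. lra.
Qed.

(** * The Galerkin vector field *)

(* Coordinates [0 <= j < m] are those of [eta_h], coordinates [m + j] those of [u_h]. *)
Definition galerkin (m : nat) (phi dphi : nat -> R -> R) (a b : R) (i : nat)
    (c : nat -> R) : R :=
  let A := comb m phi c in let dA := comb m dphi c in
  let B := comb m phi (fun j => c (m + j)%nat) in
  let dB := comb m dphi (fun j => c (m + j)%nat) in
  if lt_dec i m
  then - RInt (fun x => (a * dA x + b * dB x + (dA x * B x + A x * dB x)) * phi i x) 0 1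
  else - RInt (fun x => (dA x + a * dB x + B x * dB x) * phi (i - m)%nat x) 0 1.

Lemma comb_bound m phi P c s x : 0 <= P ->
  (forall j, (j < m)%nat -> Rabs (phi j x) <= P) ->
  rsum m (fun j => Rabs (c j)) <= s -> Rabs (comb m phi c x) <= P * s.
Proof.
intros HP Hp Hs. unfold comb. eapply Rle_trans; [apply rsum_abs|].
eapply Rle_trans; [|apply Rmult_le_compat_l; [exact HP|exact Hs]].
rewrite <- rsum_scal. apply rsum_le. intros j Hj. rewrite Rabs_mult, Rmult_comm.
apply Rmult_le_compat_r; [apply Rabs_pos|auto].
Qed.

(** The field is quadratic in the coordinates, and differences of products are telescoped. The
    constant depends on the basis and hence on the mesh; this is harmless because it serves
    existence and uniqueness, never the error bound. *)
Lemma galerkin_loc_lip m phi dphi a b :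
  (forall i, (i < m)%nat -> cont (phi i) /\ cont (dphi i)) ->
  loc_lip (m + m) (galerkin m phi dphi a b).
Proof.
intros Hc M HM.
destruct (common_bound m (fun i B => forall x, 0 <= x <= 1 ->
  Rabs (phi i x) <= B /\ Rabs (dphi i x) <= B)) as [P [HP Hpb]].
{ intros i p q Hpq H x Hx. specialize (H x Hx). lra. }
{ intros i Hi. destruct (Hc i Hi) as [C1 C2].
  destruct (cont_bounded _ 0 1 Rle_0_1 C1) as [M1 [HM1 B1]].
  destruct (cont_bounded _ 0 1 Rle_0_1 C2) as [M2 [HM2 B2]].
  exists (M1 + M2). split; [lra|]. intros x Hx. specialize (B1 x Hx).
  specialize (B2 x Hx). lra. }
set (Q := P * (INR m * M)). assert (Pm := pos_INR m).
assert (HQ : 0 <= Q) by (unfold Q; repeat apply Rmult_le_pos; lra).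
set (L := (1 + Rabs a + Rabs b + 4 * Q) * P * P).
assert (Ra := Rabs_pos a). assert (Rb := Rabs_pos b).
exists L. split; [unfold L; repeat apply Rmult_le_pos; lra|].
intros i c c' Hi Hcb Hcb'.
assert (Cp : forall e, cont (comb m phi e)) by (intros; apply cont_comb; intros; now apply Hc).
assert (Cd : forall e, cont (comb m dphi e)) by (intros; apply cont_comb; intros; now apply Hc).
set (s := rsum (m + m) (fun j => Rabs (c j - c' j))).
assert (Hs1 : rsum m (fun j => Rabs (c j - c' j)) <= s).
{ unfold s. rewrite rsum_split.
  assert (0 <= rsum m (fun i => Rabs (c (m + i)%nat - c' (m + i)%nat)))
    by (apply rsum_nonneg; intros; apply Rabs_pos). lra. }
assert (Hs2 : rsum m (fun j => Rabs (c (m + j)%nat - c' (m + j)%nat)) <= s).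
{ unfold s. rewrite rsum_split.
  assert (0 <= rsum m (fun i => Rabs (c i - c' i)))
    by (apply rsum_nonneg; intros; apply Rabs_pos). lra. }
assert (Hs : 0 <= s) by (apply rsum_nonneg; intros; apply Rabs_pos).
assert (Hsum : forall e : nat -> R, (forall j, (j < m)%nat -> Rabs (e j) <= M) ->
  rsum m (fun j => Rabs (e j)) <= INR m * M).
{ intros e He. rewrite <- rsum_const. now apply rsum_le. }
assert (key : forall (g g' : R -> R) k, (k < m)%nat -> cont g -> cont g' ->
  (forall x, 0 <= x <= 1 -> Rabs (g x - g' x) <= (1 + Rabs a + Rabs b + 4 * Q) * (P * s)) ->
  Rabs (- RInt (fun x => g x * phi k x) 0 1 - - RInt (fun x => g' x * phi k x) 0 1)
   <= L * s).
{ intros g g' k Hk Cg Cg' H. destruct (Hc k Hk) as [Ck _].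
  replace (- RInt (fun x => g x * phi k x) 0 1 - - RInt (fun x => g' x * phi k x) 0 1)
    with (- (RInt (fun x => g x * phi k x) 0 1 - RInt (fun x => g' x * phi k x) 0 1)) by Rring.
  rewrite Rabs_Ropp, <- RI_minus by cont.
  replace (L * s) with ((1 - 0) * ((1 + Rabs a + Rabs b + 4 * Q) * (P * s) * P))
    by (unfold L; ring).
  apply RI_abs_le; [lra|cont|]. intros x Hx.
  replace (g x * phi k x - g' x * phi k x) with ((g x - g' x) * phi k x) by ring.
  apply Rabs_mult_le; [now apply H|now apply Hpb]. }
set (A := comb m phi c). set (dA := comb m dphi c).
set (B := comb m phi (fun j => c (m + j)%nat)).
set (dB := comb m dphi (fun j => c (m + j)%nat)).
set (A' := comb m phi c'). set (dA' := comb m dphi c').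
set (B' := comb m phi (fun j => c' (m + j)%nat)).
set (dB' := comb m dphi (fun j => c' (m + j)%nat)).
assert (Hall : forall x, 0 <= x <= 1 ->
  (Rabs (A x - A' x) <= P * s /\ Rabs (dA x - dA' x) <= P * s /\
   Rabs (B x - B' x) <= P * s /\ Rabs (dB x - dB' x) <= P * s) /\
  (Rabs (A' x) <= Q /\ Rabs (dA' x) <= Q /\ Rabs (B x) <= Q /\ Rabs (dB x) <= Q /\
   Rabs (B' x) <= Q)).
{ intros x Hx.
  assert (P1 : forall j, (j < m)%nat -> Rabs (phi j x) <= P) by (intros; now apply Hpb).
  assert (P2 : forall j, (j < m)%nat -> Rabs (dphi j x) <= P) by (intros; now apply Hpb).
  unfold A, A', dA, dA', B, B', dB, dB'. rewrite <- !comb_minus.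
  repeat split; apply comb_bound; auto; apply Hsum; intros j Hj;
    first [apply Hcb; lia|apply Hcb'; lia]. }
assert (CA : cont A) by apply Cp. assert (CA' : cont A') by apply Cp.
assert (CB : cont B) by apply Cp. assert (CB' : cont B') by apply Cp.
assert (CdA : cont dA) by apply Cd. assert (CdA' : cont dA') by apply Cd.
assert (CdB : cont dB) by apply Cd. assert (CdB' : cont dB') by apply Cd.
unfold galerkin. cbv zeta.
fold A dA B dB A' dA' B' dB'.
destruct (lt_dec i m) as [Li|Li].
- apply (key (fun x => a * dA x + b * dB x + (dA x * B x + A x * dB x))
    (fun x => a * dA' x + b * dB' x + (dA' x * B' x + A' x * dB' x)) i Li); [cont|cont|].
  intros x Hx. destruct (Hall x Hx) as [[D1 [D2 [D3 D4]]] [E1 [E2 [E3 [E4 E5]]]]].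
  replace (a * dA x + b * dB x + (dA x * B x + A x * dB x) -
    (a * dA' x + b * dB' x + (dA' x * B' x + A' x * dB' x)))
   with (a * (dA x - dA' x) + b * (dB x - dB' x) + B x * (dA x - dA' x)
     + dA' x * (B x - B' x) + dB x * (A x - A' x) + A' x * (dB x - dB' x)) by ring.
  assert (F1 := Rabs_mult_le a _ _ _ (Rle_refl _) D2).
  assert (F2 := Rabs_mult_le b _ _ _ (Rle_refl _) D4).
  assert (F3 := Rabs_mult_le _ _ _ _ E3 D2).
  assert (F4 := Rabs_mult_le _ _ _ _ E2 D3).
  assert (F5 := Rabs_mult_le _ _ _ _ E4 D1).
  assert (F6 := Rabs_mult_le _ _ _ _ E1 D4).
  apply Rabs_le_between in F1. apply Rabs_le_between in F2. apply Rabs_le_between in F3.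
  apply Rabs_le_between in F4. apply Rabs_le_between in F5. apply Rabs_le_between in F6.
  assert (0 <= P * s) by now apply Rmult_le_pos.
  apply Rabs_le. lra.
- apply (key (fun x => dA x + a * dB x + B x * dB x)
    (fun x => dA' x + a * dB' x + B' x * dB' x) (i - m)%nat); [lia|cont|cont|].
  intros x Hx. destruct (Hall x Hx) as [[D1 [D2 [D3 D4]]] [E1 [E2 [E3 [E4 E5]]]]].
  replace (dA x + a * dB x + B x * dB x - (dA' x + a * dB' x + B' x * dB' x))
   with ((dA x - dA' x) + a * (dB x - dB' x) + dB x * (B x - B' x)
     + B' x * (dB x - dB' x)) by ring.
  assert (F1 := Rabs_mult_le a _ _ _ (Rle_refl _) D4).
  assert (F2 := Rabs_mult_le _ _ _ _ E4 D3).
  assert (F3 := Rabs_mult_le _ _ _ _ E5 D4).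
  apply Rabs_le_between in F1. apply Rabs_le_between in F2. apply Rabs_le_between in F3.
  apply Rabs_le_between in D2.
  assert (0 <= P * s) by now apply Rmult_le_pos.
  assert (0 <= Q * (P * s)) by now apply Rmult_le_pos.
  assert (0 <= Rabs b * (P * s)) by now apply Rmult_le_pos.
  apply Rabs_le. lra.
Qed.

(** * The exact solution *)

(** [D k] is the [k]-th space derivative, extended by [clamp] in both variables, and [Dt] is the
    first time derivative. Continuity and bounds therefore hold for all arguments, the differential
    relations only at interior points of the variable concerned. *)
Record smooth_data (r : nat) (T M : R) (D : nat -> R -> R -> R) (Dt : R -> R -> R)
    : Prop := {
  sd_cont : forall k, (k <= r)%nat -> cont2 (D k);
  sd_bound : forall k x t, (k <= r)%nat -> Rabs (D k x t) <= M;
  sd_dx : forall k x t, (k < r)%nat -> 0 < x < 1 ->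
    is_derive (fun y => D k y t) x (D (S k) x t);
  sd_contt : cont2 Dt;
  sd_boundt : forall x t, Rabs (Dt x t) <= M;
  sd_dt : forall x t, 0 < t < T -> is_derive (fun s => D O x s) t (Dt x t);
  sd_0 : forall t, D O 0 t = 0 }.

Lemma rect_chain T m : forall f, Ck_rect m T f -> exists D : nat -> R -> R -> R,
  D O = f /\
  (forall k, (k <= m)%nat ->
    continuous_on (fun p : R * R => interval 0 1 (fst p) /\ interval 0 T (snd p))
    (fun p : R * R => D k (fst p) (snd p))) /\
  (forall k x t, (k < m)%nat -> interval 0 1 x -> interval 0 T t ->
     is_derive_on (interval 0 1) (fun y => D k y t) x (D (S k) x t)).
Proof.
induction m as [|m IH]; intros f [Hc Hd].
- exists (fun _ => f). split; [reflexivity|]. split; [|intros; lia].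
  intros k _. exact Hc.
- destruct Hd as [fx [ft [Hd [Hx _]]]]. destruct (IH fx Hx) as [D [E [Dc Dd]]].
  exists (fun k => match k with O => f | S k' => D k' end).
  split; [reflexivity|]. split.
  + intros [|k] Hk; [exact Hc|]. apply Dc. lia.
  + intros [|k] x t Hk Hxi Ht.
    * rewrite E. now apply Hd.
    * apply Dd; auto. lia.
Qed.

Lemma is_derive_clamp a b (f : R -> R) x (l : R) : a < x < b ->
  is_derive f x l -> is_derive (fun y => f (clamp a b y)) x l.
Proof.
intros Hx H. apply is_derive_ext_loc with f; [|exact H].
exists (mkposreal (Rmin (x - a) (b - x)) ltac:(apply Rmin_glb_lt; lra)).
intros y Hy. apply Rabs_def2 in Hy. simpl in Hy.
unfold minus, plus, opp in Hy; simpl in Hy.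
assert (A := Rmin_l (x - a) (b - x)). assert (B := Rmin_r (x - a) (b - x)).
rewrite clamp_id; [reflexivity|lra].
Qed.

Lemma smooth_data_of_rect r T f : (1 <= r)%nat -> 0 < T -> Ck_rect r T f ->
  (forall t, 0 <= t <= T -> f 0 t = 0) ->
  exists M D Dt, 0 <= M /\ smooth_data r T M D Dt /\
  (forall x t, 0 <= x <= 1 -> 0 <= t <= T -> D O x t = f x t) /\
  (forall x t, 0 <= x <= 1 -> 0 <= t <= T ->
     is_derive_on (interval 0 1) (fun y => f y t) x (D 1%nat x t) /\
     is_derive_on (interval 0 T) (fun s => f x s) t (Dt x t)) /\
  (forall k x t, D k (clamp 0 1 x) (clamp 0 T t) = D k x t) /\
  (forall x t, Dt (clamp 0 1 x) (clamp 0 T t) = Dt x t).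
Proof.
intros Hr HT Hf H0. destruct (rect_chain T r f Hf) as [D [E [Dc Dd]]].
assert (Hft : exists ft : R -> R -> R, (forall x t, interval 0 1 x -> interval 0 T t ->
    is_derive_on (interval 0 T) (fun s => f x s) t (ft x t)) /\
  continuous_on (fun p : R * R => interval 0 1 (fst p) /\ interval 0 T (snd p))
    (fun p : R * R => ft (fst p) (snd p))).
{ destruct r as [|r]; [lia|]. destruct Hf as [_ [fx [ft [Hd [_ Hft]]]]]. exists ft.
  split; [intros; now apply Hd|]. destruct r; apply Hft. }
destruct Hft as [ft [Hd Hftc]].
set (c1 := clamp 0 1). set (cT := clamp 0 T).
assert (H1 : forall x, 0 <= c1 x <= 1) by (intros; apply clamp_in; lra).
assert (H2 : forall t, 0 <= cT t <= T) by (intros; apply clamp_in; lra).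
assert (I1 : forall x, 0 <= x <= 1 -> c1 x = x) by (intros; now apply clamp_id).
assert (I2 : forall t, 0 <= t <= T -> cT t = t) by (intros; now apply clamp_id).
assert (Cd : forall k, (k <= r)%nat -> cont2 (fun x t => D k (c1 x) (cT t))).
{ intros k Hk. apply (continuous_on_clamp2 T (D k)); [lra|now apply Dc]. }
assert (Ct : cont2 (fun x t => ft (c1 x) (cT t))).
{ apply (continuous_on_clamp2 T ft); [lra|exact Hftc]. }
destruct (common_bound (S r) (fun k M => forall x t, Rabs (D k (c1 x) (cT t)) <= M))
  as [M1 [HM1 B1]].
{ intros k a b Hab H x t. specialize (H x t). lra. }
{ intros k Hk.
  destruct (cont2_bounded _ 0 1 0 T Rle_0_1 (Rlt_le _ _ HT) (Cd k ltac:(lia)))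
    as [B [HB HBb]].
  exists B. split; [exact HB|]. intros x t. specialize (HBb (c1 x) (cT t) (H1 x) (H2 t)).
  rewrite (I1 (c1 x)), (I2 (cT t)) in HBb by auto. exact HBb. }
destruct (cont2_bounded _ 0 1 0 T Rle_0_1 (Rlt_le _ _ HT) Ct) as [M2 [HM2 B2]].
exists (M1 + M2), (fun k x t => D k (c1 x) (cT t)), (fun x t => ft (c1 x) (cT t)).
split; [lra|]. split; [|split; [|split; [|split]]].
- split.
  + exact Cd.
  + intros k x t Hk. specialize (B1 k ltac:(lia) x t). lra.
  + intros k x t Hk Hx. rewrite (I1 x) by lra.
    apply (is_derive_clamp 0 1 (fun y => D k y (cT t))); [exact Hx|].
    apply (is_derive_on_open 0 1); [exact Hx|]. apply Dd; auto; [|apply H2].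
    unfold interval; lra.
  + exact Ct.
  + intros x t. specialize (B2 (c1 x) (cT t) (H1 x) (H2 t)).
    rewrite (I1 (c1 x)), (I2 (cT t)) in B2 by auto. lra.
  + intros x t Ht. rewrite (I2 t) by lra.
    apply (is_derive_clamp 0 T (fun s => D O (c1 x) s)); [exact Ht|].
    apply (is_derive_on_open 0 T); [exact Ht|]. rewrite E. apply Hd; [apply H1|].
    unfold interval; lra.
  + intros t. rewrite E, (I1 0) by lra. apply H0, H2.
- intros x t Hx Ht. now rewrite E, I1, I2.
- intros x t Hx Ht. rewrite !I1, !I2 by assumption. split.
  + rewrite <- E. apply (Dd O x t); [lia|exact Hx|exact Ht].
  + now apply Hd.
- intros k x t. cbv beta. now rewrite (I1 (c1 x)), (I2 (cT t)) by auto.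
- intros x t. cbv beta. now rewrite (I1 (c1 x)), (I2 (cT t)) by auto.
Qed.

(** * Error estimate for the truncated Galerkin system *)

Definition pair_coef (m : nat) (phi : nat -> R -> R) (g1 g2 : R -> R) (i : nat) : R :=
  if lt_dec i m then proj_coef phi g1 i else proj_coef phi g2 (i - m).

Lemma pair_coef_l m phi g1 g2 i : (i < m)%nat -> pair_coef m phi g1 g2 i = proj_coef phi g1 i.
Proof. intros H. unfold pair_coef. destruct lt_dec; [reflexivity|lia]. Qed.

Lemma pair_coef_r m phi g1 g2 i : pair_coef m phi g1 g2 (m + i) = proj_coef phi g2 i.
Proof.
unfold pair_coef. destruct lt_dec; [lia|]. f_equal. lia.
Qed.

Lemma comb_ext m phi c d x : (forall j, (j < m)%nat -> c j = d j) ->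
  comb m phi c x = comb m phi d x.
Proof. intros H. apply rsum_ext. intros j Hj. now rewrite H. Qed.

Lemma galerkin_l m phi dphi a b i c c1 c2 : (i < m)%nat ->
  (forall j, (j < m)%nat -> c j = c1 j) -> (forall j, (j < m)%nat -> c (m + j)%nat = c2 j) ->
  galerkin m phi dphi a b i c = - RInt (fun x =>
    (a * comb m dphi c1 x + b * comb m dphi c2 x +
     (comb m dphi c1 x * comb m phi c2 x + comb m phi c1 x * comb m dphi c2 x)) * phi i x) 0 1.
Proof.
intros Hi H1 H2. unfold galerkin. cbv zeta. destruct lt_dec; [|lia]. f_equal.
apply RI_ext; [lra|]. intros x _.
rewrite (comb_ext m phi c c1), (comb_ext m dphi c c1), (comb_ext m phi (fun j => c (m + j)%nat) c2),
  (comb_ext m dphi (fun j => c (m + j)%nat) c2) by assumption. reflexivity.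
Qed.

Lemma galerkin_r m phi dphi a b i c c1 c2 :
  (forall j, (j < m)%nat -> c j = c1 j) -> (forall j, (j < m)%nat -> c (m + j)%nat = c2 j) ->
  galerkin m phi dphi a b (m + i) c = - RInt (fun x =>
    (comb m dphi c1 x + a * comb m dphi c2 x + comb m phi c2 x * comb m dphi c2 x)
    * phi i x) 0 1.
Proof.
intros H1 H2. unfold galerkin. cbv zeta. destruct lt_dec; [lia|]. f_equal.
replace (m + i - m)%nat with i by lia.
apply RI_ext; [lra|]. intros x _.
rewrite (comb_ext m dphi c c1), (comb_ext m phi (fun j => c (m + j)%nat) c2),
  (comb_ext m dphi (fun j => c (m + j)%nat) c2) by assumption. reflexivity.
Qed.

Lemma sqr_le_abs_sqrt z C h : 0 <= C -> 0 <= h -> z ^ 2 <= C * h ^ 2 ->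
  Rabs z <= sqrt C * h.
Proof.
intros HC Hh H. apply abs_le_of_sqr.
- apply Rmult_le_pos; [apply sqrt_pos|exact Hh].
- rewrite Rpow_mult_distr, pow2_sqrt; assumption.
Qed.

(** The energy inequality at one instant: [v] holds the coordinates of theta and xi, [w] those of
    their time derivatives in the truncated system. The left-hand side is half the time derivative
    of the energy, up to the term in which the weight is differentiated. *)
Lemma energy_fixed r kappa M a b : (3 <= r)%nat -> 1 <= kappa -> 0 <= M ->
  exists K2, 0 <= K2 /\ forall h N X m phi dphi, mesh kappa h N X -> h <= 1 ->
  basis r N X m phi dphi ->
  forall (De Du : nat -> R -> R) (et ut : R -> R), chain r De -> chain r Du ->
  (forall k x, (k <= r)%nat -> 0 <= x <= 1 -> Rabs (De k x) <= M /\ Rabs (Du k x) <= M) ->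
  De O 0 = 0 -> Du O 0 = 0 -> cont et -> cont ut ->
  (forall x, 0 < x < 1 ->
     et x + a * De 1%nat x + b * Du 1%nat x
       + (De 1%nat x * Du O x + De O x * Du 1%nat x) = 0 /\
     ut x + De 1%nat x + a * Du 1%nat x + Du O x * Du 1%nat x = 0) ->
  0 < a + Du O 1 -> 0 <= b + De O 1 <= (a + Du O 1) ^ 2 ->
  forall (v w : nat -> R) rho, 0 < rho -> rho ^ 2 = h ^ 3 ->
  (forall i, (i < m + m)%nat -> w i = pair_coef m phi et ut i -
     galerkin m phi dphi a b i
       (fun j => pair_coef m phi (De O) (Du O) j - v j / trunc (m + m) rho v)) ->
  rsum m (fun j => w j * v j)
  + RInt (fun x => (b + De O x) * comb m phi (fun j => v (m + j)%nat) x
       * comb m phi (fun j => w (m + j)%nat) x) 0 1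
  <= K2 * (rsum (m + m) (fun j => v j ^ 2) + (h ^ (r - 1)) ^ 2).
Proof.
intros Hr Hk HM.
destruct (proj_error r kappa Hr Hk) as [Cp [HCp Hproj]].
destruct (inverse_estimates r kappa Hr Hk) as [Ci [HCi Hinv]].
destruct (superapprox r kappa Hr Hk) as [Cs [HCs Hsup]].
(* Bounds the coefficients [U], [H] and their derivatives. The two square roots account for the
   maximum norms of the projection error and of the retracted spline error, both divided by [h]. *)
set (K := 1 + Rabs a + Rabs b + M + sqrt (Cp * M ^ 2) + sqrt Ci).
assert (Ra := Rabs_pos a). assert (Rb := Rabs_pos b).
assert (Q1 := sqrt_pos (Cp * M ^ 2)). assert (Q2 := sqrt_pos Ci).
assert (HM2 : 0 <= M ^ 2) by apply pow2_ge_0.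
assert (HCpM : 0 <= Cp * M ^ 2) by now apply Rmult_le_pos.
assert (HCsM : 0 <= Cs * M ^ 2) by now apply Rmult_le_pos.
assert (HK : 1 <= K) by (unfold K; lra).
assert (HK2 : 0 <= K ^ 2) by apply pow2_ge_0.
exists (40 * K ^ 2 * (1 + Ci + Cs * M ^ 2 + 4 * (Cp * M ^ 2))). split.
{ repeat apply Rmult_le_pos; lra. }
intros h N X m phi dphi Hm Hh1 Hb De Du et ut HDe HDu Hbd He0 Hu0 Cet Cut Hpde HU1 HH1
  v w rh Hrh Hrh2 Hw.
assert (Hh : 0 < h) by now destruct Hm.
assert (Hk0 : 0 < kappa) by lra.
assert (Hb' := Hb). destruct Hb' as [Hb1 [Ho Hspan]].
assert (Hpc : forall i, (i < m)%nat -> cont (phi i)) by (intros; now apply Hb1).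
set (tr := trunc (m + m) rh v) in *.
assert (Htr : 1 <= tr) by apply trunc_ge1.
set (s := / tr).
assert (Hs : 0 <= s <= 1).
{ unfold s. split; [left; apply Rinv_0_lt_compat; lra|].
  rewrite <- Rinv_1. apply Rinv_le_contravar; lra. }
set (v2 := fun j => v (m + j)%nat).
set (w2 := fun j => w (m + j)%nat).
set (ce := proj_coef phi (De O)). set (cu := proj_coef phi (Du O)).
destruct (basis_comb r N X m phi dphi ce Hb) as [_ [C1 [C1' _]]].
destruct (basis_comb r N X m phi dphi cu Hb) as [_ [C2 [C2' _]]].
destruct (basis_comb r N X m phi dphi v Hb) as [Sth [Cth [Cth' Dth]]].
destruct (basis_comb r N X m phi dphi v2 Hb) as [Sxi [Cxi [Cxi' Dxi]]].
set (th := comb m phi v) in *. set (thx := comb m dphi v) in *.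
set (xi := comb m phi v2) in *. set (xix := comb m dphi v2) in *.
assert (Cw2 : cont (comb m phi w2)) by now apply cont_comb.
assert (CDe : forall k, (k <= r)%nat -> cont (De k)) by apply HDe.
assert (CDu : forall k, (k <= r)%nat -> cont (Du k)) by apply HDu.
assert (CDe0 := CDe O ltac:(lia)). assert (CDe1 := CDe 1%nat ltac:(lia)).
assert (CDu0 := CDu O ltac:(lia)). assert (CDu1 := CDu 1%nat ltac:(lia)).
set (rho := fun x => De O x - comb m phi ce x).
set (rhox := fun x => De 1%nat x - comb m dphi ce x).
set (sig := fun x => Du O x - comb m phi cu x).
set (sigx := fun x => Du 1%nat x - comb m dphi cu x).
assert (Crho : cont rho) by (unfold rho; cont).
assert (Crhox : cont rhox) by (unfold rhox; cont).
assert (Csig : cont sig) by (unfold sig; cont).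
assert (Csigx : cont sigx) by (unfold sigx; cont).
set (U := fun x => a + Du O x). set (H := fun x => b + De O x).
assert (CU : cont U) by (unfold U; cont). assert (CH : cont H) by (unfold H; cont).
set (chi := comb m phi (proj_coef phi (fun x => H x * xi x))).
assert (Cchi : cont chi) by now apply cont_comb.
set (n1 := rsum m (fun j => v j ^ 2)). set (n2 := rsum m (fun j => v2 j ^ 2)).
assert (Hn1 : 0 <= n1) by (apply rsum_nonneg; intros; apply pow2_ge_0).
assert (Hn2 : 0 <= n2) by (apply rsum_nonneg; intros; apply pow2_ge_0).
assert (Hn : rsum (m + m) (fun j => v j ^ 2) = n1 + n2) by apply rsum_split.
assert (Nth : RInt (fun x => th x ^ 2) 0 1 = n1) by now apply norm_comb.
assert (Nxi : RInt (fun x => xi x ^ 2) 0 1 = n2) by now apply norm_comb.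
destruct (Hproj h N X m phi dphi Hm Hh1 Hb De M HDe HM
  (fun x Hx => proj1 (Hbd r x (le_n r) Hx)) He0) as [P1 [P2 P3]].
destruct (Hproj h N X m phi dphi Hm Hh1 Hb Du M HDu HM
  (fun x Hx => proj2 (Hbd r x (le_n r) Hx)) Hu0) as [P4 [P5 P6]].
fold ce in P1, P2, P3. fold cu in P4, P5, P6.
destruct (Hinv h N X Hm th thx Sth Cth' Dth) as [V1 [_ V3]]. rewrite Nth in V1, V3.
destruct (Hinv h N X Hm xi xix Sxi Cxi' Dxi) as [W1 [_ W3]]. rewrite Nxi in W1, W3.
set (g2 := (h ^ (r - 1)) ^ 2) in *.
(* With [s = / tr] one factor [s] cancels [tr] and the other is at most 1, so the retracted error
   has squared norm at most [rho ^ 2 = h ^ 3]. *)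
assert (Hsn : s ^ 2 * (n1 + n2) <= h ^ 3).
{ rewrite <- Hn. assert (A := trunc_sum (m + m) rh v Hrh). fold tr in A.
  rewrite Hrh2 in A. assert (0 < h ^ 3) by now apply pow_lt.
  assert (Hst : s * tr = 1) by (unfold s; apply Rinv_l; lra).
  apply Rle_trans with (s ^ 2 * (tr * h ^ 3)).
  - apply Rmult_le_compat_l; [apply pow2_ge_0|exact A].
  - replace (s ^ 2 * (tr * h ^ 3)) with (s * (s * tr) * h ^ 3) by ring.
    rewrite Hst, Rmult_1_r.
    apply Rle_trans with (1 * h ^ 3); [apply Rmult_le_compat_r|]; lra. }
(* This is where the radius is spent: the inverse estimate loses [h^(-1/2)] against [h^(3/2)], and
   the maximum norm comes out as O(h). *)
assert (Hsmall : forall z n, z ^ 2 * h <= Ci * n -> 0 <= n <= n1 + n2 ->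
  Rabs (s * z) <= sqrt Ci * h).
{ intros z n Hz Hnn. apply sqr_le_abs_sqrt; [exact HCi|lra|].
  apply Rmult_le_reg_r with h; [exact Hh|].
  replace ((s * z) ^ 2 * h) with (s ^ 2 * (z ^ 2 * h)) by ring.
  replace (Ci * h ^ 2 * h) with (Ci * h ^ 3) by ring.
  apply Rle_trans with (Ci * (s ^ 2 * (n1 + n2))).
  - replace (Ci * (s ^ 2 * (n1 + n2))) with (s ^ 2 * (Ci * (n1 + n2))) by ring.
    apply Rmult_le_compat_l; [apply pow2_ge_0|].
    eapply Rle_trans; [exact Hz|]. apply Rmult_le_compat_l; lra.
  - now apply Rmult_le_compat_l. }
assert (EI := energy_integrated K h s U (Du 1%nat) H (De 1%nat) th thx xi xix
  rho rhox sig sigx chi HK (conj Hh Hh1) Hs CU CDu1 CH CDe1 Cth Cth' Cxi Cxi'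
  Crho Crhox Csig Csigx Cchi).
cbv zeta in EI.
set (Q := RInt (fun x =>
      (Du 1%nat x * (rho x + s * th x) + U x * (rhox x + s * thx x)
       + De 1%nat x * (sig x + s * xi x) + H x * (sigx x + s * xix x)
       - (rhox x + s * thx x) * (sig x + s * xi x)
       - (rho x + s * th x) * (sigx x + s * xix x)) * th x
      + (rhox x + s * thx x + Du 1%nat x * (sig x + s * xi x) + U x * (sigx x + s * xix x)
         - (sig x + s * xi x) * (sigx x + s * xix x)) * chi x) 0 1) in EI.
(* The state at which the field is evaluated is the projection minus [s] times the spline error,
   that is the exact solution minus [rho + s th] and [sig + s xi]. Subtracting the differential
   equation leaves the difference of the fluxes, tested as in [Q]. *)
assert (EQ : rsum m (fun j => w j * v j)
  + RInt (fun x => (b + De O x) * xi x * comb m phi w2 x) 0 1 = - Q).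
{ set (tl := fun j => ce j - s * v j). set (xl := fun j => cu j - s * v2 j).
  destruct (basis_comb r N X m phi dphi tl Hb) as [_ [L1 [L2 _]]].
  destruct (basis_comb r N X m phi dphi xl Hb) as [_ [L3 [L4 _]]].
  assert (X1 : forall x, comb m phi tl x = De O x - (rho x + s * th x)).
  { intros x. unfold tl. rewrite comb_minus, comb_scal. unfold rho, th. ring. }
  assert (X2 : forall x, comb m dphi tl x = De 1%nat x - (rhox x + s * thx x)).
  { intros x. unfold tl. rewrite comb_minus, comb_scal. unfold rhox, thx. ring. }
  assert (X3 : forall x, comb m phi xl x = Du O x - (sig x + s * xi x)).
  { intros x. unfold xl. rewrite comb_minus, comb_scal. unfold sig, xi. ring. }
  assert (X4 : forall x, comb m dphi xl x = Du 1%nat x - (sigx x + s * xix x)).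
  { intros x. unfold xl. rewrite comb_minus, comb_scal. unfold sigx, xix. ring. }
  set (c := fun j => pair_coef m phi (De O) (Du O) j - v j / tr) in *.
  assert (Hc1 : forall j, (j < m)%nat -> c j = tl j).
  { intros j Hj. unfold c, tl. rewrite pair_coef_l by exact Hj. unfold s, Rdiv, ce. ring. }
  assert (Hc2 : forall j, (j < m)%nat -> c (m + j)%nat = xl j).
  { intros j Hj. unfold c, xl. rewrite pair_coef_r. unfold s, Rdiv, cu, v2. ring. }
  set (R1 := fun x => a * comb m dphi tl x + b * comb m dphi xl x +
     (comb m dphi tl x * comb m phi xl x + comb m phi tl x * comb m dphi xl x)).
  set (R2 := fun x => comb m dphi tl x + a * comb m dphi xl x
     + comb m phi xl x * comb m dphi xl x).
  assert (CR1 : cont R1) by (unfold R1; cont).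
  assert (CR2 : cont R2) by (unfold R2; cont).
  assert (Hw1 : forall j, (j < m)%nat -> w j = RInt (fun x => (et x + R1 x) * phi j x) 0 1).
  { intros j Hj. assert (Cj := Hpc j Hj). rewrite Hw by lia.
    rewrite pair_coef_l by exact Hj.
    rewrite (galerkin_l m phi dphi a b j c tl xl Hj Hc1 Hc2). fold (R1).
    unfold proj_coef. change (RInt _ 0 1 - - RInt ?f 0 1) with
      (RInt (fun x => et x * phi j x) 0 1 - - RInt (fun x => R1 x * phi j x) 0 1).
    rewrite (RI_ext (fun x => (et x + R1 x) * phi j x)
      (fun x => et x * phi j x + R1 x * phi j x)) by (try lra; intros; ring).
    rewrite RI_plus by cont. Rring. }
  assert (Hw2 : forall j, (j < m)%nat -> w2 j = RInt (fun x => (ut x + R2 x) * phi j x) 0 1).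
  { intros j Hj. assert (Cj := Hpc j Hj). unfold w2. rewrite Hw by lia.
    rewrite pair_coef_r.
    rewrite (galerkin_r m phi dphi a b j c tl xl Hc1 Hc2).
    unfold proj_coef. change (RInt _ 0 1 - - RInt ?f 0 1) with
      (RInt (fun x => ut x * phi j x) 0 1 - - RInt (fun x => R2 x * phi j x) 0 1).
    rewrite (RI_ext (fun x => (ut x + R2 x) * phi j x)
      (fun x => ut x * phi j x + R2 x * phi j x)) by (try lra; intros; ring).
    rewrite RI_plus by cont. Rring. }
  assert (T1 : rsum m (fun j => w j * v j) = RInt (fun x => (et x + R1 x) * th x) 0 1).
  { unfold th. rewrite inner_comb; [|exact Hpc|cont]. apply rsum_ext.
    intros j Hj. rewrite Hw1 by exact Hj. apply Rmult_comm. }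
  (* [H xi] may be exchanged for its projection [chi] at no cost here, since the other factor
     [comb m phi w2] is itself a spline. *)
  assert (T2 : RInt (fun x => (b + De O x) * xi x * comb m phi w2 x) 0 1
     = RInt (fun x => (ut x + R2 x) * chi x) 0 1).
  { rewrite (inner_comb m phi w2 (fun x => (b + De O x) * xi x)); [|exact Hpc|cont].
    unfold chi. rewrite inner_comb; [|exact Hpc|cont]. apply rsum_ext.
    intros j Hj. rewrite Hw2 by exact Hj. unfold proj_coef, H. apply Rmult_comm. }
  rewrite T1, T2. rewrite <- RI_plus by cont. unfold Q. rewrite <- RI_opp.
  - apply RI_ext; [lra|]. intros x Hx. destruct (Hpde x Hx) as [G1 G2].
    unfold R1, R2. rewrite X1, X2, X3, X4.
    set (A := rho x + s * th x). set (A' := rhox x + s * thx x).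
    set (B := sig x + s * xi x). set (B' := sigx x + s * xix x).
    replace (et x) with (- (a * De 1%nat x + b * Du 1%nat x
       + (De 1%nat x * Du O x + De O x * Du 1%nat x))) by lra.
    replace (ut x) with (- (De 1%nat x + a * Du 1%nat x + Du O x * Du 1%nat x)) by lra.
    unfold U, H. ring.
  - cont. }
fold v2 w2. change (comb m phi v2) with xi. rewrite EQ, Hn.
set (SS := RInt (fun x => th x ^ 2 + xi x ^ 2 + (h * thx x) ^ 2 + (h * xix x) ^ 2
      + ((chi x - H x * xi x) / h) ^ 2
      + rho x ^ 2 + rhox x ^ 2 + sig x ^ 2 + sigx x ^ 2) 0 1) in EI.
assert (HSS : SS <= (1 + Ci + Cs * M ^ 2) * (n1 + n2) + 4 * (Cp * M ^ 2 * g2)).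
{ unfold SS. do 8 (rewrite RI_plus by cont). rewrite Nth, Nxi.
  rewrite (RI_ext (fun x => (h * thx x) ^ 2) (fun x => h ^ 2 * thx x ^ 2))
    by (try lra; intros; ring).
  rewrite (RI_ext (fun x => (h * xix x) ^ 2) (fun x => h ^ 2 * xix x ^ 2))
    by (try lra; intros; ring).
  rewrite !RI_scal by cont.
  (* [chi] is the best L2 approximation of [H xi], hence at least as close as the spline [ph]
     furnished by superapproximation. *)
  assert (Z : RInt (fun x => ((chi x - H x * xi x) / h) ^ 2) 0 1 <= Cs * M ^ 2 * n2).
  { destruct (Hsup h N X Hm H M xi CH HM) as [ph [Sph Hph]]; [|exact Sxi|].
    - assert (Hl : forall x y, 0 <= x <= 1 -> 0 <= y <= 1 -> x <= y ->
        Rabs (H x - H y) <= M * Rabs (x - y)).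
      { intros x y Hx Hy Hxy. destruct (Req_dec x y) as [->|Exy].
        - rewrite !Rminus_diag, Rabs_R0. lra.
        - destruct (MVT_open H (De 1%nat) x y) as [z [Hz Ez]]; [lra|exact CH| |].
          + intros z Hz. unfold H. eapply is_derive_eq.
            * apply is_derive_Rplus; [apply (is_derive_const b)|].
              apply HDe; [lia|lra].
            * unfold zero; simpl. ring.
          + rewrite Rabs_minus_sym, Ez, Rabs_mult, (Rabs_minus_sym x y).
            apply Rmult_le_compat_r; [apply Rabs_pos|].
            apply Hbd; [lia|lra]. }
      intros x y Hx Hy. destruct (Rle_dec x y) as [L|L]; [now apply Hl|].
      rewrite (Rabs_minus_sym (H x)), (Rabs_minus_sym x). apply Hl; lra.
    - rewrite Nxi in Hph. destruct (Hspan ph Sph) as [d Hd].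
      rewrite (RI_ext _ (fun x => / h ^ 2 * (chi x - H x * xi x) ^ 2)).
      + rewrite RI_scal by cont. rewrite Rmult_comm.
        apply (proj2 (Rle_div_l _ _ _ (pow_lt h 2 Hh))).
        eapply Rle_trans; [apply (best_approx m phi (fun x => H x * xi x) d Hpc Ho); cont|].
        rewrite (RI_ext _ (fun x => (ph x - H x * xi x) ^ 2)).
        * eapply Rle_trans; [exact Hph|]. right. ring.
        * lra.
        * intros x Hx. rewrite Hd by lra. reflexivity.
      + lra.
      + intros x _. field. lra. }
  assert (0 <= Ci * n1) by now apply Rmult_le_pos.
  assert (0 <= Ci * n2) by now apply Rmult_le_pos.
  assert (0 <= Cs * M ^ 2 * n1) by now apply Rmult_le_pos.
  unfold rho, rhox, sig, sigx. lra. }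
assert (EI2 : - (40 * K ^ 2) * SS <= Q).
{ apply EI.
  - intros x Hx. split; [|split; [|split]].
    + unfold U. eapply is_derive_eq.
      * apply is_derive_Rplus; [apply (is_derive_const a)|]. apply HDu; [lia|lra].
      * unfold zero; simpl. ring.
    + unfold H. eapply is_derive_eq.
      * apply is_derive_Rplus; [apply (is_derive_const b)|]. apply HDe; [lia|lra].
      * unfold zero; simpl. ring.
    + apply Dth.
    + apply Dxi.
  - intros x Hx. destruct (Hbd O x ltac:(lia) Hx) as [B1 B2].
    destruct (Hbd 1%nat x ltac:(lia) Hx) as [B3 B4].
    assert (Rt := Rabs_triang a (Du O x)). assert (Rt2 := Rabs_triang b (De O x)).
    repeat split; try (unfold U, H, K; lra).
    + eapply Rle_trans; [apply Rabs_triang|].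
      assert (F1 := sqr_le_abs_sqrt _ _ h HCpM (Rlt_le _ _ Hh) (P3 x Hx)).
      assert (F2 := Hsmall (th x) n1 (V1 x Hx) ltac:(lra)).
      fold (rho x) in F1. unfold K. nra.
    + eapply Rle_trans; [apply Rabs_triang|].
      assert (F1 := sqr_le_abs_sqrt _ _ h HCpM (Rlt_le _ _ Hh) (P6 x Hx)).
      assert (F2 := Hsmall (xi x) n2 (W1 x Hx) ltac:(lra)).
      fold (sig x) in F1. unfold K. nra.
  - apply (Spl_at0 r N X kappa h); auto. lia.
  - apply (Spl_at0 r N X kappa h); auto. lia.
  - exact HU1.
  - exact HH1. }
assert (Hg2 : 0 <= g2) by apply pow2_ge_0.
apply Rle_trans with (40 * K ^ 2 * SS); [lra|].
apply Rle_trans with (40 * K ^ 2 *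
  ((1 + Ci + Cs * M ^ 2) * (n1 + n2) + 4 * (Cp * M ^ 2 * g2))).
- apply Rmult_le_compat_l; [lra|exact HSS].
- replace (40 * K ^ 2 * (1 + Ci + Cs * M ^ 2 + 4 * (Cp * M ^ 2)) * (n1 + n2 + g2))
    with (40 * K ^ 2 * ((1 + Ci + Cs * M ^ 2 + 4 * (Cp * M ^ 2)) * (n1 + n2 + g2))) by ring.
  assert (E : (1 + Ci + Cs * M ^ 2) * (n1 + n2) + 4 * (Cp * M ^ 2 * g2) <=
    (1 + Ci + Cs * M ^ 2 + 4 * (Cp * M ^ 2)) * (n1 + n2 + g2)).
  { assert (0 <= (1 + Ci + Cs * M ^ 2) * g2) by (apply Rmult_le_pos; lra).
    assert (0 <= Cp * M ^ 2 * (n1 + n2)) by (apply Rmult_le_pos; lra). lra. }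
  apply Rmult_le_compat_l with (r := 40 * K ^ 2) in E; [|lra]. lra.
Qed.

Lemma cont2_2 f : cont f -> cont2 (fun _ t => f t).
Proof.
intros Hf x y eps. destruct (proj1 (cont_eps f y) (Hf y) eps (cond_pos eps)) as [d [Hd H]].
exists (mkposreal d Hd). intros u v _ Hv. now apply H.
Qed.

Lemma cont2_rsum n (f : nat -> R -> R -> R) : (forall i, (i < n)%nat -> cont2 (f i)) ->
  cont2 (fun x t => rsum n (fun i => f i x t)).
Proof.
induction n as [|n IH]; simpl; intros H; [apply (cont2_const 0)|].
apply (cont2_plus (fun x t => rsum n (fun i => f i x t)) (f n)).
- apply IH. intros; apply H; lia.
- apply H. lia.
Qed.

Lemma cont2_comb m phi (c : nat -> R -> R) :
  (forall j, (j < m)%nat -> cont (phi j) /\ cont (c j)) ->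
  cont2 (fun x t => comb m phi (fun j => c j t) x).
Proof.
intros H. apply (cont2_rsum m (fun j x t => c j t * phi j x)). intros j Hj.
apply (cont2_mult (fun _ t => c j t) (fun x _ => phi j x)).
- apply cont2_2. now apply H.
- apply cont2_1. now apply H.
Qed.

(** Gronwall is applied to [E = |theta|^2 + (H xi, xi)]. The weight is bounded below by [beta],
    which makes [E] control both L2 norms, and the time derivative falling on the weight costs
    [M |xi|^2]. The initial energy is zero. *)
Lemma energy_estimate r kappa T M beta a b :
  (3 <= r)%nat -> 1 <= kappa -> 0 <= T -> 0 <= M -> 0 < beta ->
  exists C, 0 <= C /\ forall h N X m phi dphi, mesh kappa h N X -> h <= 1 ->
  basis r N X m phi dphi ->
  forall De et Du ut, smooth_data r T M De et -> smooth_data r T M Du ut ->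
  (forall x t, 0 < x < 1 ->
     et x t + a * De 1%nat x t + b * Du 1%nat x t
       + (De 1%nat x t * Du O x t + De O x t * Du 1%nat x t) = 0 /\
     ut x t + De 1%nat x t + a * Du 1%nat x t + Du O x t * Du 1%nat x t = 0) ->
  (forall x t, 0 <= x <= 1 ->
     0 < a + Du O x t /\ beta <= b + De O x t <= (a + Du O x t) ^ 2) ->
  forall (y dy : nat -> R -> R) rho, 0 < rho -> rho ^ 2 = h ^ 3 ->
  (forall i, (i < m + m)%nat -> y i 0 = 0 /\ cont (dy i) /\
     (forall t, is_derive (y i) t (dy i t)) /\
     forall t, 0 <= t <= T ->
       dy i t = pair_coef m phi (fun x => et x t) (fun x => ut x t) i -
       galerkin m phi dphi a b i (fun j =>
         pair_coef m phi (fun x => De O x t) (fun x => Du O x t) j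
         - y j t / trunc (m + m) rho (fun j => y j t))) ->
  forall t, 0 <= t <= T -> rsum (m + m) (fun j => y j t ^ 2) <= C * (h ^ (r - 1)) ^ 2.
Proof.
intros Hr Hk HT HM Hbe.
destruct (energy_fixed r kappa M a b Hr Hk HM) as [K2 [HK2 Hfix]].
(* Lower bound for the two weights 1 and [H] in the energy, so [c3] converts the energy back into
   the sum of squares. *)
set (mu := Rmin 1 beta). assert (Hmu : 0 < mu) by (apply Rmin_glb_lt; lra).
assert (Hmu1 : mu <= 1) by apply Rmin_l. assert (Hmub : mu <= beta) by apply Rmin_r.
set (c3 := / mu). assert (Hc3 : 0 < c3) by now apply Rinv_0_lt_compat.
(* Twice the constant of the fixed-time inequality, plus [M] for the derivative of the weight,
   expressed through the energy by [c3]. *)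
set (G := (2 * K2 + M) * c3).
assert (HG : 0 <= G) by (unfold G; apply Rmult_le_pos; lra).
exists (c3 * (2 * K2 * T * exp (G * T))). split.
{ assert (P := exp_pos (G * T)). repeat apply Rmult_le_pos; lra. }
intros h N X m phi dphi Hm Hh1 Hb De et Du ut HDe HDu Hpde Hpos y dy rho Hrho Hrho2 Hy.
assert (Hb' := Hb). destruct Hb' as [Hb1 [Ho _]].
assert (Hpc : forall i, (i < m)%nat -> cont (phi i)) by (intros; now apply Hb1).
set (g2 := (h ^ (r - 1)) ^ 2). assert (Hg2 : 0 <= g2) by apply pow2_ge_0.
assert (Cy : forall i, (i < m + m)%nat -> cont (y i)).
{ intros i Hi. apply is_derive_cont with (dy i). now apply Hy. }
set (xi := fun x t => comb m phi (fun j => y (m + j)%nat t) x).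
set (xit := fun x t => comb m phi (fun j => dy (m + j)%nat t) x).
assert (Cxi : cont2 xi).
{ apply (cont2_comb m phi (fun j => y (m + j)%nat)). intros j Hj.
  split; [now apply Hpc|]. apply Cy. lia. }
assert (Cxit : cont2 xit).
{ apply (cont2_comb m phi (fun j => dy (m + j)%nat)). intros j Hj.
  split; [now apply Hpc|]. apply Hy. lia. }
assert (CDe : cont2 (De O)) by (apply (sd_cont _ _ _ _ _ HDe); lia).
assert (Cet : cont2 et) by apply (sd_contt _ _ _ _ _ HDe).
assert (CH : cont2 (fun x t => b + De O x t)).
{ apply (cont2_plus (fun _ _ => b)); [apply cont2_const|exact CDe]. }
set (g := fun x t => (b + De O x t) * (xi x t * xi x t)).
set (gt := fun x t => et x t * (xi x t * xi x t) +
  (b + De O x t) * (xit x t * xi x t + xi x t * xit x t)).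
assert (Cg : cont2 g) by (apply cont2_mult; [exact CH|now apply cont2_mult]).
assert (Cgt : cont2 gt).
{ apply (cont2_plus (fun x t => et x t * (xi x t * xi x t))).
  - apply cont2_mult; [exact Cet|now apply cont2_mult].
  - apply (cont2_mult (fun x t => b + De O x t)); [exact CH|].
    apply (cont2_plus (fun x t => xit x t * xi x t)); now apply cont2_mult. }
set (E := fun t => rsum m (fun j => y j t ^ 2) + RInt (fun x => g x t) 0 1).
set (dE := fun t => rsum m (fun j => 2 * (dy j t * y j t)) + RInt (fun x => gt x t) 0 1).
assert (CE : cont E).
{ unfold E. apply cont_plus.
  - cont. apply Cy. lia.
  - now apply cont_RI_param. }
set (n := fun t => rsum (m + m) (fun j => y j t ^ 2)).
set (n2 := fun t => rsum m (fun j => y (m + j)%nat t ^ 2)).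
assert (Hn12 : forall t, n t = rsum m (fun j => y j t ^ 2) + n2 t) by (intros; apply rsum_split).
assert (Hn2 : forall t, 0 <= n2 t) by (intros; apply rsum_nonneg; intros; apply pow2_ge_0).
assert (Hn1 : forall t, 0 <= rsum m (fun j => y j t ^ 2))
  by (intros; apply rsum_nonneg; intros; apply pow2_ge_0).
assert (Nxi : forall t, RInt (fun x => xi x t ^ 2) 0 1 = n2 t).
{ intros t. exact (norm_comb m phi (fun j => y (m + j)%nat t) Hpc Ho). }
assert (Cxt : forall t, cont (fun x => xi x t)) by (intros; now apply cont2_x).
assert (HnE : forall t, n t <= c3 * E t).
{ intros t. apply Rmult_le_reg_l with mu; [exact Hmu|].
  replace (mu * (c3 * E t)) with (E t) by (unfold c3; field; lra).
  rewrite Hn12. unfold E.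
  assert (mu * n2 t <= RInt (fun x => g x t) 0 1).
  { rewrite <- Nxi. specialize (Cxt t). rewrite <- RI_scal by cont.
    apply RI_le; [lra|cont|now apply (cont2_x g)|].
    intros x Hx. destruct (Hpos x t ltac:(lra)) as [_ P]. unfold g.
    replace (xi x t * xi x t) with (xi x t ^ 2) by ring.
    apply Rmult_le_compat_r; [apply pow2_ge_0|lra]. }
  assert (mu * rsum m (fun j => y j t ^ 2) <= 1 * rsum m (fun j => y j t ^ 2))
    by (apply Rmult_le_compat_r; [apply Hn1|exact Hmu1]).
  lra. }
assert (HE : forall t, 0 <= t <= T -> E t <= (E 0 + 2 * K2 * g2 * t) * exp (G * t)).
{ apply gronwall with (dE := dE); [exact HG| |exact CE|].
  { apply Rmult_le_pos; [lra|exact Hg2]. }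
  intros t Ht. split.
  - unfold E, dE. apply is_derive_Rplus.
    + apply (is_derive_rsum m (fun j t => y j t ^ 2) (fun j t => 2 * (dy j t * y j t))).
      intros j Hj. eapply is_derive_eq.
      * apply (is_derive_pow (y j) 2). apply Hy. lia.
      * simpl. ring.
    + apply (is_derive_RI_param g gt T Cg Cgt); [|exact Ht].
      intros x s Hx Hs.
      apply (is_derive_Rmult (fun s => b + De O x s) (fun s => xi x s * xi x s) s (et x s)).
      * eapply is_derive_eq.
        -- apply is_derive_Rplus; [apply (is_derive_const b)|].
           now apply (sd_dt _ _ _ _ _ HDe).
        -- unfold zero; simpl. ring.
      * assert (Dx : is_derive (fun s => xi x s) s (xit x s)).
        { apply (is_derive_rsum m (fun j s => y (m + j)%nat s * phi j x)
            (fun j s => dy (m + j)%nat s * phi j x)).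
          intros j Hj. eapply is_derive_eq.
          - apply is_derive_Rmult; [apply Hy; lia|apply (is_derive_const (phi j x))].
          - unfold zero; simpl. ring. }
        now apply (is_derive_Rmult (fun s => xi x s) (fun s => xi x s)).
  - assert (HF := Hfix h N X m phi dphi Hm Hh1 Hb (fun k x => De k x t) (fun k x => Du k x t)
      (fun x => et x t) (fun x => ut x t)).
    assert (HF1 : rsum m (fun j => dy j t * y j t)
      + RInt (fun x => (b + De O x t) * xi x t * xit x t) 0 1 <= K2 * (n t + g2)).
    { apply (HF) with (rho := rho) (v := fun j => y j t) (w := fun j => dy j t);
        try assumption.
      - split; intros; [apply cont2_x|]; now apply HDe.
      - split; intros; [apply cont2_x|]; now apply HDu.
      - intros k x Hkr Hx. split.
        + now apply (sd_bound _ _ _ _ _ HDe).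
        + now apply (sd_bound _ _ _ _ _ HDu).
      - apply (sd_0 _ _ _ _ _ HDe).
      - apply (sd_0 _ _ _ _ _ HDu).
      - now apply cont2_x.
      - apply cont2_x. apply (sd_contt _ _ _ _ _ HDu).
      - intros x Hx. now apply Hpde.
      - apply (Hpos 1 t). lra.
      - destruct (Hpos 1 t ltac:(lra)) as [_ P]. lra.
      - intros i Hi. apply Hy; [exact Hi|lra]. }
    assert (Cet1 := cont2_x et t Cet). assert (CH1 := cont2_x _ t CH). cbv beta in CH1.
    assert (Cxit1 := cont2_x xit t Cxit). specialize (Cxt t).
    assert (HI : RInt (fun x => gt x t) 0 1 =
      RInt (fun x => et x t * xi x t ^ 2) 0 1
      + 2 * RInt (fun x => (b + De O x t) * xi x t * xit x t) 0 1).
    { rewrite <- RI_scal by cont. rewrite <- RI_plus by cont.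
      apply RI_ext; [lra|]. intros x _. unfold gt. ring. }
    assert (HI2 : RInt (fun x => et x t * xi x t ^ 2) 0 1 <= M * n2 t).
    { rewrite <- Nxi. rewrite <- RI_scal by cont. apply RI_le; [lra|cont|cont|].
      intros x _. apply Rmult_le_compat_r; [apply pow2_ge_0|].
      eapply Rle_trans; [apply Rle_abs|]. apply (sd_boundt _ _ _ _ _ HDe). }
    unfold dE. rewrite HI, rsum_scal.
    assert (n2 t <= n t) by (rewrite Hn12; specialize (Hn1 t); lra).
    assert (M * n2 t <= M * n t) by now apply Rmult_le_compat_l.
    assert ((2 * K2 + M) * n t <= (2 * K2 + M) * (c3 * E t))
      by (apply Rmult_le_compat_l; [lra|apply HnE]).
    unfold G. lra. }
intros t Ht. fold (n t). eapply Rle_trans; [apply HnE|].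
assert (E0 : E 0 = 0).
{ unfold E. rewrite rsum_eq0.
  - rewrite (RI_ext _ (fun _ => 0)).
    + rewrite RI_const. Rring.
    + lra.
    + intros x _. unfold g, xi, comb. rewrite rsum_eq0; [ring|].
      intros j Hj. destruct (Hy (m + j)%nat ltac:(lia)) as [-> _]. ring.
  - intros j Hj. destruct (Hy j ltac:(lia)) as [-> _]. ring. }
specialize (HE t Ht). rewrite E0, Rplus_0_l in HE.
assert (Hexp : exp (G * t) <= exp (G * T)).
{ destruct (Req_dec (G * t) (G * T)) as [->|NE]; [lra|]. left. apply exp_increasing.
  assert (G * t <= G * T) by (apply Rmult_le_compat_l; lra). lra. }
fold g2. rewrite (Rmult_assoc c3). apply Rmult_le_compat_l; [lra|].
eapply Rle_trans; [exact HE|].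
replace (2 * K2 * T * exp (G * T) * g2) with (2 * K2 * g2 * T * exp (G * T)) by ring.
apply Rmult_le_compat; [|left; apply exp_pos| |exact Hexp].
- apply Rmult_le_pos; [|lra]. apply Rmult_le_pos; [lra|exact Hg2].
- apply Rmult_le_compat_l; [|lra]. apply Rmult_le_pos; [lra|exact Hg2].
Qed.

(** * The semidiscrete problem in coordinates *)

(** All that the passage to coordinates uses of the space. The basis functions are differentiable on
    R, whereas a member of [S] equals its expansion on [0,1] only. *)
Record sh_basis (S : (R -> R) -> Prop) (m : nat) (phi dphi : nat -> R -> R) : Prop := {
  sb_mem : forall c, S (comb m phi c);
  sb_cont : forall i, (i < m)%nat -> cont (phi i);
  sb_dcont : forall i, (i < m)%nat -> cont (dphi i);
  sb_deriv : forall i x, (i < m)%nat -> is_derive (phi i) x (dphi i x);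
  sb_orth : orthonormal m phi;
  sb_span : forall v, S v -> exists d, forall x, 0 <= x <= 1 -> v x = comb m phi d x }.

Lemma sh_basis_of_basis r N xs kappa h m phi dphi : (2 <= r)%nat -> 0 < kappa ->
  mesh kappa h N (extended N xs h) -> basis r N (extended N xs h) m phi dphi ->
  sh_basis (Sh r N xs) m phi dphi.
Proof.
intros Hr Hk Hm Hb. assert (Hb' := Hb). destruct Hb' as [H1 [H2 H3]]. split.
- intros c. apply (Spl_Sh r N xs kappa h); auto.
  apply (basis_comb r N _ m phi dphi c Hb).
- intros; now apply H1.
- intros; now apply H1.
- intros; now apply H1.
- exact H2.
- intros v Hv. destruct (Sh_Spl r N xs kappa h v Hr Hk Hm Hv) as [f [Hf E]].
  destruct (H3 f Hf) as [d Hd]. exists d. intros x Hx. now rewrite E, Hd.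
Qed.

Lemma sb_dcomb S m phi dphi c x : sh_basis S m phi dphi ->
  is_derive (comb m phi c) x (comb m dphi c x).
Proof.
intros Hb.
apply (is_derive_rsum m (fun j x => c j * phi j x) (fun j x => c j * dphi j x)).
intros i Hi. apply is_derive_Rscal. now apply (sb_deriv _ _ _ _ Hb).
Qed.

Lemma sb_ccomb S m phi dphi c : sh_basis S m phi dphi ->
  cont (comb m phi c) /\ cont (comb m dphi c).
Proof.
intros Hb. split; apply cont_comb.
- apply (sb_cont _ _ _ _ Hb).
- apply (sb_dcont _ _ _ _ Hb).
Qed.

Lemma sb_coef S m phi dphi v : sh_basis S m phi dphi -> S v ->
  forall x, 0 <= x <= 1 -> v x = comb m phi (proj_coef phi v) x.
Proof.
intros Hb Hv x Hx. destruct (sb_span _ _ _ _ Hb v Hv) as [d Hd].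
rewrite Hd by exact Hx. apply comb_ext. intros j Hj. unfold proj_coef.
assert (Hc := sb_cont _ _ _ _ Hb).
rewrite (RI_ext _ (fun x => phi j x * comb m phi d x)).
- rewrite inner_comb by auto. rewrite (rsum_single m j); [|exact Hj|].
  + rewrite (sb_orth _ _ _ _ Hb) by assumption. destruct (Nat.eq_dec j j); [Rring|lia].
  + intros i Hi Hij. rewrite (sb_orth _ _ _ _ Hb) by assumption.
    destruct (Nat.eq_dec j i); [lia|Rring].
- lra.
- intros z Hz. rewrite Hd by lra. ring.
Qed.

Lemma L2norm_comb m phi c v : (forall i, (i < m)%nat -> cont (phi i)) -> orthonormal m phi ->
  (forall x, 0 < x < 1 -> v x = comb m phi c x) ->
  L2norm v = sqrt (rsum m (fun j => c j ^ 2)).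
Proof.
intros Hp Ho Hv. unfold L2norm, inner. f_equal. rewrite <- (norm_comb m phi c Hp Ho).
apply RI_ext; [lra|]. intros x Hx. rewrite Hv by exact Hx. ring.
Qed.

Lemma sqrt_sum_sqr_le m (c : nat -> R) :
  sqrt (rsum m (fun j => c j ^ 2)) <= rsum m (fun j => Rabs (c j)).
Proof.
assert (P : 0 <= rsum m (fun j => Rabs (c j))) by (apply rsum_nonneg; intros; apply Rabs_pos).
rewrite <- (sqrt_pow2 _ P). apply sqrt_le_1_alt. clear P.
induction m as [|m IH]; simpl; [lra|].
assert (P1 : 0 <= rsum m (fun j => Rabs (c j))) by (apply rsum_nonneg; intros; apply Rabs_pos).
assert (P2 := Rabs_pos (c m)). assert (P3 := pow2_abs (c m)). simpl in IH, P3. nra.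
Qed.

Lemma abs_le_sqrt_sum_sqr m (c : nat -> R) j : (j < m)%nat ->
  Rabs (c j) <= sqrt (rsum m (fun j => c j ^ 2)).
Proof.
intros Hj. rewrite <- (sqrt_pow2 (Rabs (c j))) by apply Rabs_pos. apply sqrt_le_1_alt.
rewrite pow2_abs. apply (rsum_term_le m (fun j => c j ^ 2)); [intros; apply pow2_ge_0|exact Hj].
Qed.

Lemma filterlim_within_0 (D : R -> Prop) (f : R -> R) (t : R) :
  filterlim f (within D (locally t)) (locally 0) <->
  forall eps, 0 < eps -> exists d, 0 < d /\
    forall s, Rabs (s - t) < d -> D s -> Rabs (f s) < eps.
Proof.
split.
- intros H eps He. destruct (H (fun z => Rabs z < eps)) as [d Hd].
  + exists (mkposreal eps He). intros z Hz.
    replace z with (z - 0) by ring. exact Hz.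
  + exists d. split; [apply cond_pos|]. intros s Hs Ds. exact (Hd s Hs Ds).
- intros H P [eps HP]. destruct (H eps (cond_pos eps)) as [d [Hd H1]].
  exists (mkposreal d Hd). intros s Hs Ds. apply HP.
  specialize (H1 s Hs Ds). replace (f s) with (f s - 0) in H1 by ring. exact H1.
Qed.

Lemma common_delta m (P : nat -> R -> Prop) :
  (forall i a b, a <= b -> P i b -> P i a) ->
  (forall i, (i < m)%nat -> exists d, 0 < d /\ P i d) ->
  exists d, 0 < d /\ forall i, (i < m)%nat -> P i d.
Proof.
intros Hmon. induction m as [|m IH]; intros H.
- exists 1. split; [lra|]. intros; lia.
- destruct IH as [d [Hd H1]]; [intros; apply H; lia|].
  destruct (H m ltac:(lia)) as [e [He H2]].
  exists (Rmin d e). split; [now apply Rmin_glb_lt|].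
  intros i Hi. destruct (Nat.eq_dec i m) as [->|E].
  + apply Hmon with e; [apply Rmin_r|exact H2].
  + apply Hmon with d; [apply Rmin_l|apply H1; lia].
Qed.

Lemma comb_C1_in_time S m phi dphi T (z dz : nat -> R -> R) : sh_basis S m phi dphi ->
  (forall j, (j < m)%nat -> cont (dz j) /\ forall t, is_derive (z j) t (dz j t)) ->
  is_C1_in_time S T (fun t => comb m phi (fun j => z j t))
    (fun t => comb m phi (fun j => dz j t)).
Proof.
intros Hb Hz. assert (Hc := sb_cont _ _ _ _ Hb). assert (Ho := sb_orth _ _ _ _ Hb).
split; [|split].
- intros t _. split; apply (sb_mem _ _ _ _ Hb).
- intros t _. apply filterlim_within_0. intros eps He.
  assert (Pm := pos_INR m).
  set (e := eps / (INR m + 1) / 2).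
  assert (He0 : 0 < e) by (unfold e; repeat apply Rdiv_lt_0_compat; lra).
  destruct (common_delta m (fun j d => forall s, Rabs (s - t) < d ->
    Rabs (z j s - z j t - (s - t) * dz j t) <= e * Rabs (s - t))) as [d [Hd H]].
  { intros i a b Hab H s Hs. apply H. lra. }
  { intros j Hj. exact (proj1 (is_derive_eps (z j) t (dz j t)) (proj2 (Hz j Hj) t) e He0). }
  exists d. split; [exact Hd|]. intros s Hs [_ Hst].
  set (q := fun j => (z j s - z j t) / (s - t) - dz j t).
  rewrite (L2norm_comb m phi q _ Hc Ho).
  2:{ intros x _. unfold q. rewrite comb_minus.
      rewrite (comb_ext m phi (fun j => (z j s - z j t) / (s - t))
        (fun j => / (s - t) * (z j s - z j t))) by (intros; unfold Rdiv; ring).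
      rewrite comb_scal, comb_minus. unfold Rdiv. ring. }
  rewrite Rabs_pos_eq by apply sqrt_pos.
  eapply Rle_lt_trans; [apply sqrt_sum_sqr_le|].
  apply Rle_lt_trans with (INR m * e).
  + rewrite <- rsum_const. apply rsum_le. intros j Hj. specialize (H j Hj s Hs).
    assert (Hn : s - t <> 0) by lra. assert (Hp := Rabs_pos_lt _ Hn).
    apply Rmult_le_reg_r with (Rabs (s - t)); [exact Hp|].
    rewrite <- Rabs_mult. eapply Rle_trans; [|exact H]. right. f_equal. unfold q. field.
    exact Hn.
  + unfold e. replace (INR m * (eps / (INR m + 1) / 2))
      with (INR m / (INR m + 1) * (eps / 2)) by (field; lra).
    assert (INR m / (INR m + 1) <= 1) by (apply Rle_div_l; lra). nra.
- intros t _. apply filterlim_within_0. intros eps He.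
  set (g := fun s => rsum m (fun j => Rabs (dz j s - dz j t))).
  assert (Cg : cont g).
  { unfold g. cont. apply cont_abs. cont. now apply Hz. }
  assert (Hg0 : g t = 0).
  { unfold g. apply rsum_eq0. intros. rewrite Rminus_diag. apply Rabs_R0. }
  destruct (proj1 (cont_eps g t) (Cg t) eps He) as [d [Hd H]].
  exists d. split; [exact Hd|]. intros s Hs _. specialize (H s Hs).
  rewrite Hg0, Rminus_0_r in H.
  rewrite (L2norm_comb m phi (fun j => dz j s - dz j t) _ Hc Ho).
  2:{ intros x _. now rewrite comb_minus. }
  rewrite Rabs_pos_eq by apply sqrt_pos.
  eapply Rle_lt_trans; [apply sqrt_sum_sqr_le|].
  eapply Rle_lt_trans; [apply Rle_abs|exact H].
Qed.

(** In an orthonormal basis each coordinate is dominated by the L2 norm, so differentiability in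
    norm passes to the coordinates, one-sidedly at the ends of [0,T]. *)
Lemma coef_derive S m phi dphi T v vt j t : sh_basis S m phi dphi -> 0 < T ->
  is_C1_in_time S T v vt -> (j < m)%nat -> interval 0 T t ->
  is_derive_on (interval 0 T) (fun s => proj_coef phi (v s) j) t (proj_coef phi (vt t) j).
Proof.
intros Hb HT [H1 [H2 _]] Hj Ht.
assert (Hc := sb_cont _ _ _ _ Hb). assert (Ho := sb_orth _ _ _ _ Hb).
apply is_derive_on_eps; [exact HT|exact Ht|]. intros eps He.
destruct (proj1 (filterlim_within_0 _ _ _) (H2 t Ht) eps He) as [d [Hd H]].
exists d. split; [exact Hd|]. intros s Hs Hsd.
destruct (Req_dec s t) as [->|Hst].
{ rewrite !Rminus_diag, Rabs_R0. rewrite Rmult_0_l, Rminus_0_r, Rabs_R0. lra. }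
specialize (H s Hsd (conj Hs Hst)).
rewrite (L2norm_comb m phi (fun j => (proj_coef phi (v s) j - proj_coef phi (v t) j) / (s - t)
  - proj_coef phi (vt t) j) _ Hc Ho) in H.
2:{ intros x Hx. rewrite comb_minus.
    rewrite (comb_ext m phi (fun j => (proj_coef phi (v s) j - proj_coef phi (v t) j) / (s - t))
      (fun j => / (s - t) * (proj_coef phi (v s) j - proj_coef phi (v t) j)))
      by (intros; unfold Rdiv; ring).
    rewrite comb_scal, comb_minus.
    rewrite <- !(sb_coef S m phi dphi) by (try assumption; try lra; now apply H1).
    unfold Rdiv. ring. }
rewrite Rabs_pos_eq in H by apply sqrt_pos.
assert (A := abs_le_sqrt_sum_sqr m (fun j => (proj_coef phi (v s) j - proj_coef phi (v t) j)
   / (s - t) - proj_coef phi (vt t) j) j Hj).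
cbv beta in A. assert (Hn : s - t <> 0) by lra.
replace (proj_coef phi (v s) j - proj_coef phi (v t) j - (s - t) * proj_coef phi (vt t) j)
  with (((proj_coef phi (v s) j - proj_coef phi (v t) j) / (s - t) - proj_coef phi (vt t) j)
    * (s - t)) by (field; exact Hn).
rewrite Rabs_mult. apply Rmult_le_compat_r; [apply Rabs_pos|lra].
Qed.

Lemma is_derive_on_continuous T f df : 0 < T ->
  (forall t, interval 0 T t -> is_derive_on (interval 0 T) f t (df t)) ->
  continuous_on (interval 0 T) f.
Proof.
intros HT H t Ht P [eps HP].
destruct (proj1 (is_derive_on_eps 0 T f t (df t) HT Ht) (H t Ht) 1 Rlt_0_1) as [d [Hd H1]].
assert (Pd := Rabs_pos (df t)). assert (Hep := cond_pos eps).
assert (Hq : 0 < eps / (2 + Rabs (df t))) by (apply Rdiv_lt_0_compat; lra).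
exists (mkposreal (Rmin d (eps / (2 + Rabs (df t)))) ltac:(now apply Rmin_glb_lt)).
intros s Hs Hsi. apply HP. change (Rabs (f s - f t) < eps).
assert (Hs1 : Rabs (s - t) < d) by (eapply Rlt_le_trans; [exact Hs|apply Rmin_l]).
assert (Hs2 : Rabs (s - t) < eps / (2 + Rabs (df t)))
  by (eapply Rlt_le_trans; [exact Hs|apply Rmin_r]).
specialize (H1 s Hsi Hs1).
apply Rmult_lt_compat_r with (r := 2 + Rabs (df t)) in Hs2; [|lra].
replace (eps / (2 + Rabs (df t)) * (2 + Rabs (df t))) with (pos eps) in Hs2 by (field; lra).
assert (Tr := Rabs_triang (f s - f t - (s - t) * df t) ((s - t) * df t)).
replace (f s - f t - (s - t) * df t + (s - t) * df t) with (f s - f t) in Tr by ring.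
rewrite (Rabs_mult (s - t) (df t)) in Tr. assert (Ps := Rabs_pos (s - t)). lra.
Qed.

Lemma Dx_of (f df g : R -> R) : (forall x, is_derive f x (df x)) ->
  (forall x, 0 <= x <= 1 -> g x = f x) -> forall x, 0 <= x <= 1 -> Defs.Dx g x = df x.
Proof.
intros Hd E x Hx. apply Derive_on_unique; [lra|exact Hx|].
apply is_derive_on_ext with f; [lra|exact Hx| |].
- intros y Hy. symmetry. now apply E.
- apply is_derive_on_of; [lra|exact Hx|]. apply Hd.
Qed.

Lemma galerkin_ext m phi dphi a b i c c' : (i < m + m)%nat ->
  (forall j, (j < m + m)%nat -> c j = c' j) ->
  galerkin m phi dphi a b i c = galerkin m phi dphi a b i c'.
Proof.
intros Hi E. destruct (lt_dec i m) as [L|L].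
- rewrite (galerkin_l m phi dphi a b i c c (fun j => c (m + j)%nat)) by auto.
  symmetry. apply galerkin_l; [exact L| |]; intros j Hj; symmetry; apply E; lia.
- replace i with (m + (i - m))%nat by lia.
  rewrite (galerkin_r m phi dphi a b (i - m) c c (fun j => c (m + j)%nat)) by auto.
  symmetry. apply galerkin_r; intros j Hj; symmetry; apply E; lia.
Qed.

Definition weak_form (eta_0 u_0 : R) (eta_ht u_ht eta_h u_h psi : R -> R) : Prop :=
  inner eta_ht psi + inner (fun x => u_0 * Defs.Dx eta_h x) psi
    + inner (fun x => (1 + eta_0) * Defs.Dx u_h x) psi
    + inner (Defs.Dx (fun x => eta_h x * u_h x)) psi = 0 /\
  inner u_ht psi + inner (Defs.Dx eta_h) psi + inner (fun x => u_0 * Defs.Dx u_h x) psi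
    + inner (fun x => u_h x * Defs.Dx u_h x) psi = 0.

Lemma weak_form_coef S m phi dphi eta_0 u_0 (A B At Bt psi : R -> R) (c1 c2 d1 d2 p : nat -> R) :
  sh_basis S m phi dphi ->
  (forall x, 0 <= x <= 1 -> A x = comb m phi c1 x) ->
  (forall x, 0 <= x <= 1 -> B x = comb m phi c2 x) ->
  (forall x, 0 <= x <= 1 -> At x = comb m phi d1 x) ->
  (forall x, 0 <= x <= 1 -> Bt x = comb m phi d2 x) ->
  (forall x, 0 <= x <= 1 -> psi x = comb m phi p x) ->
  weak_form eta_0 u_0 At Bt A B psi <->
  rsum m (fun j => p j * (d1 j + RInt (fun x => (u_0 * comb m dphi c1 x
     + (1 + eta_0) * comb m dphi c2 x
     + (comb m dphi c1 x * comb m phi c2 x + comb m phi c1 x * comb m dphi c2 x))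
     * phi j x) 0 1)) = 0 /\
  rsum m (fun j => p j * (d2 j + RInt (fun x => (comb m dphi c1 x
     + u_0 * comb m dphi c2 x + comb m phi c2 x * comb m dphi c2 x) * phi j x) 0 1)) = 0.
Proof.
intros Hb EA EB EAt EBt Ep.
assert (Hc := sb_cont _ _ _ _ Hb). assert (Ho := sb_orth _ _ _ _ Hb).
destruct (sb_ccomb _ _ _ _ c1 Hb) as [K1 K2]. destruct (sb_ccomb _ _ _ _ c2 Hb) as [K3 K4].
destruct (sb_ccomb _ _ _ _ d1 Hb) as [K5 _]. destruct (sb_ccomb _ _ _ _ d2 Hb) as [K6 _].
destruct (sb_ccomb _ _ _ _ p Hb) as [K7 _].
assert (DA := Dx_of _ _ A (fun x => sb_dcomb S m phi dphi c1 x Hb) EA).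
assert (DB := Dx_of _ _ B (fun x => sb_dcomb S m phi dphi c2 x Hb) EB).
assert (DAB : forall x, 0 <= x <= 1 -> Defs.Dx (fun x => A x * B x) x =
  comb m dphi c1 x * comb m phi c2 x + comb m phi c1 x * comb m dphi c2 x).
{ apply (Dx_of (fun x => comb m phi c1 x * comb m phi c2 x)).
  - intros x. apply (is_derive_Rmult (comb m phi c1) (comb m phi c2));
      apply (sb_dcomb S m phi dphi _ x Hb).
  - intros x Hx. now rewrite EA, EB. }
assert (T : forall d g, cont g -> rsum m (fun j => p j * (d j + RInt (fun x => g x * phi j x) 0 1))
  = RInt (fun x => comb m phi d x * comb m phi p x) 0 1
    + RInt (fun x => g x * comb m phi p x) 0 1).
{ intros d g Cg. rewrite inner_comb_comb, inner_comb by auto. rewrite <- rsum_plus.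
  apply rsum_ext. intros; ring. }
rewrite (T d1 (fun x => u_0 * comb m dphi c1 x + (1 + eta_0) * comb m dphi c2 x
     + (comb m dphi c1 x * comb m phi c2 x + comb m phi c1 x * comb m dphi c2 x))) by cont.
rewrite (T d2 (fun x => comb m dphi c1 x
     + u_0 * comb m dphi c2 x + comb m phi c2 x * comb m dphi c2 x)) by cont.
unfold weak_form, inner.
rewrite (RI_ext (fun x => At x * psi x) (fun x => comb m phi d1 x * comb m phi p x))
  by (try lra; intros x Hx; now rewrite EAt, Ep by lra).
rewrite (RI_ext (fun x => Bt x * psi x) (fun x => comb m phi d2 x * comb m phi p x))
  by (try lra; intros x Hx; now rewrite EBt, Ep by lra).
rewrite (RI_ext (fun x => u_0 * Defs.Dx A x * psi x)
  (fun x => u_0 * comb m dphi c1 x * comb m phi p x))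
  by (try lra; intros x Hx; now rewrite DA, Ep by lra).
rewrite (RI_ext (fun x => (1 + eta_0) * Defs.Dx B x * psi x)
  (fun x => (1 + eta_0) * comb m dphi c2 x * comb m phi p x))
  by (try lra; intros x Hx; now rewrite DB, Ep by lra).
rewrite (RI_ext (fun x => Defs.Dx (fun x => A x * B x) x * psi x)
  (fun x => (comb m dphi c1 x * comb m phi c2 x + comb m phi c1 x * comb m dphi c2 x)
     * comb m phi p x))
  by (try lra; intros x Hx; now rewrite DAB, Ep by lra).
rewrite (RI_ext (fun x => Defs.Dx A x * psi x) (fun x => comb m dphi c1 x * comb m phi p x))
  by (try lra; intros x Hx; now rewrite DA, Ep by lra).
rewrite (RI_ext (fun x => u_0 * Defs.Dx B x * psi x)
  (fun x => u_0 * comb m dphi c2 x * comb m phi p x))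
  by (try lra; intros x Hx; now rewrite DB, Ep by lra).
rewrite (RI_ext (fun x => B x * Defs.Dx B x * psi x)
  (fun x => comb m phi c2 x * comb m dphi c2 x * comb m phi p x))
  by (try lra; intros x Hx; now rewrite DB, EB, Ep by lra).
rewrite (RI_ext (fun x => (u_0 * comb m dphi c1 x + (1 + eta_0) * comb m dphi c2 x
     + (comb m dphi c1 x * comb m phi c2 x + comb m phi c1 x * comb m dphi c2 x))
     * comb m phi p x) (fun x => u_0 * comb m dphi c1 x * comb m phi p x
       + (1 + eta_0) * comb m dphi c2 x * comb m phi p x
       + (comb m dphi c1 x * comb m phi c2 x + comb m phi c1 x * comb m dphi c2 x)
     * comb m phi p x)) by (try lra; intros; ring).
rewrite (RI_ext (fun x => (comb m dphi c1 x
     + u_0 * comb m dphi c2 x + comb m phi c2 x * comb m dphi c2 x) * comb m phi p x)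
   (fun x => comb m dphi c1 x * comb m phi p x
     + u_0 * comb m dphi c2 x * comb m phi p x
     + comb m phi c2 x * comb m dphi c2 x * comb m phi p x)) by (try lra; intros; ring).
do 4 (rewrite RI_plus by cont).
rewrite !Rplus_assoc. tauto.
Qed.

(** For an orthonormal basis the mass matrix is the identity, so testing with the basis functions
    gives the time derivatives of the coordinates explicitly. *)
Lemma weak_form_ode S m phi dphi eta_0 u_0 (A B At Bt : R -> R) (c d : nat -> R) :
  sh_basis S m phi dphi ->
  (forall x, 0 <= x <= 1 -> A x = comb m phi c x) ->
  (forall x, 0 <= x <= 1 -> B x = comb m phi (fun j => c (m + j)%nat) x) ->
  (forall x, 0 <= x <= 1 -> At x = comb m phi d x) ->
  (forall x, 0 <= x <= 1 -> Bt x = comb m phi (fun j => d (m + j)%nat) x) ->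
  (forall psi, S psi -> weak_form eta_0 u_0 At Bt A B psi) <->
  (forall i, (i < m + m)%nat -> d i = galerkin m phi dphi u_0 (1 + eta_0) i c).
Proof.
intros Hb EA EB EAt EBt. set (c2 := fun j => c (m + j)%nat) in *.
set (d2 := fun j => d (m + j)%nat) in *.
assert (G1 : forall j, (j < m)%nat -> galerkin m phi dphi u_0 (1 + eta_0) j c = - RInt (fun x =>
  (u_0 * comb m dphi c x + (1 + eta_0) * comb m dphi c2 x
     + (comb m dphi c x * comb m phi c2 x + comb m phi c x * comb m dphi c2 x))
     * phi j x) 0 1).
{ intros j Hj. now apply galerkin_l. }
assert (G2 : forall j, galerkin m phi dphi u_0 (1 + eta_0) (m + j) c = - RInt (fun x =>
  (comb m dphi c x + u_0 * comb m dphi c2 x + comb m phi c2 x * comb m dphi c2 x)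
    * phi j x) 0 1).
{ intros j. now apply galerkin_r. }
split.
- intros H.
  assert (Hj : forall j, (j < m)%nat ->
    d j = galerkin m phi dphi u_0 (1 + eta_0) j c /\
    d (m + j)%nat = galerkin m phi dphi u_0 (1 + eta_0) (m + j) c).
  { intros j Hj. set (p := fun k => if Nat.eq_dec k j then 1 else 0).
    assert (Hp := H (comb m phi p) (sb_mem _ _ _ _ Hb p)).
    apply (weak_form_coef S m phi dphi eta_0 u_0 A B At Bt (comb m phi p) c c2 d d2 p Hb
      EA EB EAt EBt (fun x _ => eq_refl)) in Hp.
    destruct Hp as [Hp1 Hp2].
    rewrite (rsum_single m j) in Hp1, Hp2; try exact Hj;
      try (intros k _ Hk; unfold p; destruct (Nat.eq_dec k j); [lia|ring]).
    unfold p in Hp1, Hp2. destruct (Nat.eq_dec j j); [|lia].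
    rewrite G1 by exact Hj. rewrite G2. change (d (m + j)%nat) with (d2 j).
    split; lra. }
  intros i Hi. destruct (lt_dec i m) as [L|L]; [now apply Hj|].
  replace i with (m + (i - m))%nat by lia. apply Hj. lia.
- intros H psi Hpsi. destruct (sb_span _ _ _ _ Hb psi Hpsi) as [p Hp].
  apply (weak_form_coef S m phi dphi eta_0 u_0 A B At Bt psi c c2 d d2 p Hb
      EA EB EAt EBt Hp).
  split; apply rsum_eq0; intros j Hj.
  + rewrite H, G1 by lia. ring.
  + unfold d2. rewrite H, G2 by lia. ring.
Qed.

(** Orthogonality to the space is orthogonality to the basis. Nothing is known about [f] off (0,1);
    a continuous [g] that agrees with it inside takes its place under the integral. *)
Lemma comb_projection S m phi dphi f g : sh_basis S m phi dphi -> cont g ->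
  (forall x, 0 < x < 1 -> f x = g x) ->
  forall p, S p -> is_L2_projection S f p <->
  (forall j, (j < m)%nat -> proj_coef phi p j = proj_coef phi g j).
Proof.
intros Hb Cg E p Hp. assert (Hc := sb_cont _ _ _ _ Hb).
assert (Ep := sb_coef S m phi dphi p Hb Hp). set (cp := proj_coef phi p) in *.
assert (Ccp := cont_comb m phi cp Hc).
assert (T : forall q, RInt (fun x => (g x - comb m phi cp x) * comb m phi q x) 0 1
  = rsum m (fun j => q j * (proj_coef phi g j - cp j))).
{ intros q. assert (Cq := cont_comb m phi q Hc).
  rewrite (RI_ext _ (fun x => g x * comb m phi q x - comb m phi cp x * comb m phi q x))
    by (try lra; intros; ring).
  rewrite RI_minus by cont. rewrite inner_comb_comb, inner_comb by (auto; apply (sb_orth _ _ _ _ Hb)).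
  rewrite <- rsum_minus. apply rsum_ext. intros j _. unfold proj_coef. ring. }
split.
- intros [_ H] j Hj. set (q := fun k => if Nat.eq_dec k j then 1 else 0).
  specialize (H (comb m phi q) (sb_mem _ _ _ _ Hb q)). unfold inner in H.
  rewrite (RI_ext _ (fun x => (g x - comb m phi cp x) * comb m phi q x)) in H
    by (try lra; intros x Hx; now rewrite E, Ep by lra).
  rewrite T in H. rewrite (rsum_single m j) in H; [|exact Hj|].
  + unfold q in H. destruct (Nat.eq_dec j j); [lra|lia].
  + intros k _ Hk. unfold q. destruct (Nat.eq_dec k j); [lia|ring].
- intros H. split; [exact Hp|]. intros psi Hpsi.
  destruct (sb_span _ _ _ _ Hb psi Hpsi) as [q Hq]. unfold inner.
  rewrite (RI_ext _ (fun x => (g x - comb m phi cp x) * comb m phi q x))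
    by (try lra; intros x Hx; now rewrite E, Ep, Hq by lra).
  rewrite T. apply rsum_eq0. intros j Hj. unfold cp. rewrite H by exact Hj. ring.
Qed.

Lemma semidiscrete_coords S m phi dphi T eta_0 u_0 e_init u_init eta_h u_h (ge gu : R -> R) :
  sh_basis S m phi dphi -> 0 < T -> cont ge -> cont gu ->
  (forall x, 0 < x < 1 -> e_init x - eta_0 = ge x) ->
  (forall x, 0 < x < 1 -> u_init x - u_0 = gu x) ->
  is_semidiscrete_solution S T eta_0 u_0 e_init u_init eta_h u_h ->
  exists c : nat -> R -> R,
  (forall t x, 0 <= t <= T -> 0 <= x <= 1 ->
     eta_h t x = comb m phi (fun j => c j t) x /\
     u_h t x = comb m phi (fun j => c (m + j)%nat t) x) /\
  (forall i, (i < m + m)%nat -> cont (c i) /\ c i 0 = pair_coef m phi ge gu i /\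
     forall t, 0 < t < T ->
     is_derive (c i) t (galerkin m phi dphi u_0 (1 + eta_0) i (fun j => c j t))).
Proof.
intros Hb HT Cge Cgu Ee Eu [eta_ht [u_ht [He [Hu [Hw [Hpe Hpu]]]]]].
set (cl := clamp 0 T).
assert (Hcl : forall t, 0 <= t <= T -> cl t = t) by (intros; now apply clamp_id).
set (k := fun i t => pair_coef m phi (eta_h t) (u_h t) i).
set (kt := fun i t => pair_coef m phi (eta_ht t) (u_ht t) i).
assert (Hk : forall i t, (i < m + m)%nat -> interval 0 T t ->
  is_derive_on (interval 0 T) (k i) t (kt i t)).
{ intros i t Hi Ht. unfold k, kt, pair_coef. destruct (lt_dec i m) as [L|L].
  - apply (coef_derive S m phi dphi T eta_h eta_ht); auto.
  - apply (coef_derive S m phi dphi T u_h u_ht); auto. lia. }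
assert (Sp : forall t, interval 0 T t -> S (eta_h t) /\ S (eta_ht t) /\ S (u_h t) /\ S (u_ht t)).
{ intros t Ht. destruct He as [He _]. destruct Hu as [Hu _].
  specialize (He t Ht). specialize (Hu t Ht). tauto. }
assert (El : forall v w : R -> R, S v -> forall x, 0 <= x <= 1 ->
  v x = comb m phi (fun j => pair_coef m phi v w j) x).
{ intros v w Hv x Hx. rewrite (sb_coef S m phi dphi v Hb Hv x Hx).
  apply comb_ext. intros j Hj. now rewrite pair_coef_l. }
assert (Er : forall v w : R -> R, S v -> forall x, 0 <= x <= 1 ->
  v x = comb m phi (fun j => pair_coef m phi w v (m + j)) x).
{ intros v w Hv x Hx. rewrite (sb_coef S m phi dphi v Hb Hv x Hx).
  apply comb_ext. intros j Hj. now rewrite pair_coef_r. }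
assert (Hode : forall t, interval 0 T t -> forall i, (i < m + m)%nat ->
  kt i t = galerkin m phi dphi u_0 (1 + eta_0) i (fun j => k j t)).
{ intros t Ht. destruct (Sp t Ht) as [S1 [S2 [S3 S4]]].
  apply (weak_form_ode S m phi dphi eta_0 u_0 (eta_h t) (u_h t) (eta_ht t) (u_ht t)
    (fun j => k j t) (fun j => kt j t) Hb).
  - now apply El.
  - now apply Er.
  - now apply El.
  - now apply Er.
  - intros psi Hpsi. exact (Hw t Ht psi Hpsi). }
(* The coordinates are frozen outside [0,T] to be continuous on R, as the uniqueness theorem for the
   ordinary differential equation expects. *)
exists (fun i t => k i (cl t)). split.
- intros t x Ht Hx. rewrite Hcl by exact Ht. destruct (Sp t Ht) as [S1 [S2 [S3 S4]]].
  split; [now apply El|now apply Er].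
- intros i Hi. split; [|split].
  + apply (continuous_on_clamp 0 T (k i)); [lra|].
    apply (is_derive_on_continuous T (k i) (kt i) HT). intros t Ht. now apply Hk.
  + rewrite Hcl by lra. assert (H0 : interval 0 T 0) by (unfold interval; lra).
    destruct (Sp 0 H0) as [S1 [S2 [S3 S4]]].
    unfold k, pair_coef. destruct (lt_dec i m) as [L|L].
    * apply (proj1 (comb_projection S m phi dphi _ ge Hb Cge Ee _ S1) Hpe). exact L.
    * apply (proj1 (comb_projection S m phi dphi _ gu Hb Cgu Eu _ S3) Hpu). lia.
  + intros t Ht. rewrite (Hcl t) by lra.
    apply (is_derive_clamp 0 T (k i)); [exact Ht|].
    rewrite <- Hode by (try assumption; unfold interval; lra).
    apply (is_derive_on_open 0 T); [exact Ht|]. apply Hk; [exact Hi|unfold interval; lra].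
Qed.

Lemma coords_semidiscrete S m phi dphi T eta_0 u_0 e_init u_init (ge gu : R -> R)
    (z dz : nat -> R -> R) :
  sh_basis S m phi dphi -> 0 < T -> cont ge -> cont gu ->
  (forall x, 0 < x < 1 -> e_init x - eta_0 = ge x) ->
  (forall x, 0 < x < 1 -> u_init x - u_0 = gu x) ->
  (forall i, (i < m + m)%nat -> z i 0 = pair_coef m phi ge gu i /\ cont (dz i) /\
     (forall t, is_derive (z i) t (dz i t)) /\
     forall t, 0 <= t <= T ->
       dz i t = galerkin m phi dphi u_0 (1 + eta_0) i (fun j => z j t)) ->
  is_semidiscrete_solution S T eta_0 u_0 e_init u_init
    (fun t => comb m phi (fun j => z j t)) (fun t => comb m phi (fun j => z (m + j)%nat t)).
Proof.
intros Hb HT Cge Cgu Ee Eu Hz.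
assert (Hpc : forall d, S (comb m phi d)) by apply (sb_mem _ _ _ _ Hb).
assert (Hpr : forall d j, (j < m)%nat -> proj_coef phi (comb m phi d) j = d j).
{ intros d j Hj. unfold proj_coef.
  assert (Hc := sb_cont _ _ _ _ Hb).
  rewrite (RI_ext _ (fun x => phi j x * comb m phi d x)) by (try lra; intros; ring).
  rewrite inner_comb by auto. rewrite (rsum_single m j); [|exact Hj|].
  - rewrite (sb_orth _ _ _ _ Hb) by assumption. destruct (Nat.eq_dec j j); [Rring|lia].
  - intros i Hi Hij. rewrite (sb_orth _ _ _ _ Hb) by assumption.
    destruct (Nat.eq_dec j i); [lia|Rring]. }
exists (fun t => comb m phi (fun j => dz j t)), (fun t => comb m phi (fun j => dz (m + j)%nat t)).
split; [|split; [|split; [|split]]].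
- apply (comb_C1_in_time S m phi dphi T z dz Hb). intros j Hj. split; apply Hz; lia.
- apply (comb_C1_in_time S m phi dphi T (fun j => z (m + j)%nat) (fun j => dz (m + j)%nat) Hb).
  intros j Hj. split; apply Hz; lia.
- intros t Ht.
  apply (weak_form_ode S m phi dphi eta_0 u_0 _ _ _ _
    (fun j => z j t) (fun j => dz j t) Hb); try reflexivity.
  intros i Hi. now apply Hz.
- apply (proj2 (comb_projection S m phi dphi _ ge Hb Cge Ee _ (Hpc _))).
  intros j Hj. rewrite Hpr by exact Hj.
  destruct (Hz j ltac:(lia)) as [-> _]. now apply pair_coef_l.
- apply (proj2 (comb_projection S m phi dphi _ gu Hb Cgu Eu _ (Hpc _))).
  intros j Hj. rewrite Hpr by exact Hj.
  destruct (Hz (m + j)%nat ltac:(lia)) as [-> _]. apply pair_coef_r.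
Qed.

Lemma pair_coef_derive m phi T (De et Du ut : R -> R -> R) i :
  (forall j, (j < m)%nat -> cont (phi j)) -> (i < m + m)%nat ->
  cont2 De -> cont2 et -> cont2 Du -> cont2 ut ->
  (forall x t, 0 < t < T -> is_derive (fun s => De x s) t (et x t)) ->
  (forall x t, 0 < t < T -> is_derive (fun s => Du x s) t (ut x t)) ->
  cont (fun t => pair_coef m phi (fun x => De x t) (fun x => Du x t) i) /\
  cont (fun t => pair_coef m phi (fun x => et x t) (fun x => ut x t) i) /\
  forall t, 0 < t < T ->
    is_derive (fun t => pair_coef m phi (fun x => De x t) (fun x => Du x t) i) t
      (pair_coef m phi (fun x => et x t) (fun x => ut x t) i).
Proof.
intros Hc Hi C1 C2 C3 C4 D1 D2.
assert (K : forall j f ft, (j < m)%nat -> cont2 f -> cont2 ft ->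
  (forall x t, 0 < t < T -> is_derive (fun s => f x s) t (ft x t)) ->
  cont (fun t => proj_coef phi (fun x => f x t) j) /\
  cont (fun t => proj_coef phi (fun x => ft x t) j) /\
  forall t, 0 < t < T -> is_derive (fun t => proj_coef phi (fun x => f x t) j) t
      (proj_coef phi (fun x => ft x t) j)).
{ intros j f ft Hj Cf Cft Hd.
  assert (Cp : cont2 (fun x _ => phi j x)) by now apply cont2_1, Hc.
  assert (Cg : cont2 (fun x t => f x t * phi j x)) by now apply (cont2_mult f).
  assert (Cgt : cont2 (fun x t => ft x t * phi j x)) by now apply (cont2_mult ft).
  split; [exact (cont_RI_param _ Cg)|]. split; [exact (cont_RI_param _ Cgt)|].
  apply (is_derive_RI_param _ _ T Cg Cgt). intros x t _ Ht.
  eapply is_derive_eq.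
  - apply (is_derive_Rmult (fun s => f x s) (fun _ => phi j x)); [now apply Hd|].
    apply (is_derive_const (phi j x)).
  - unfold zero; simpl. ring. }
unfold pair_coef. destruct (lt_dec i m) as [L|L]; apply K; auto; lia.
Qed.

(** * From the initial-boundary-value problem to the error bound *)

Lemma smooth_data_mono r T M M' D Dt : M <= M' -> smooth_data r T M D Dt ->
  smooth_data r T M' D Dt.
Proof.
intros HM [H1 H2 H3 H4 H5 H6 H7]. split; auto.
- intros k x t Hk. specialize (H2 k x t Hk). lra.
- intros x t. specialize (H5 x t). lra.
Qed.

(** Uniqueness of one-sided derivatives identifies each [Derive_on] in the equations with the
    corresponding smooth datum. Since all data are clamped in time, the resulting equations hold for
    every [t]. *)
Lemma ibvp_smooth_data r T eta_0 u_0 e_init u_init eta u : (3 <= r)%nat -> 0 < T ->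
  Ck_rect r T eta -> Ck_rect r T u -> is_ibvp_solution T eta_0 u_0 e_init u_init eta u ->
  exists M De et Du ut, 0 <= M /\ smooth_data r T M De et /\ smooth_data r T M Du ut /\
  (forall x t, 0 <= x <= 1 -> 0 <= t <= T -> De O x t = eta x t /\ Du O x t = u x t) /\
  (forall k x t, De k x (clamp 0 T t) = De k x t /\ Du k x (clamp 0 T t) = Du k x t) /\
  (forall x t, 0 < x < 1 ->
     et x t + u_0 * De 1%nat x t + (1 + eta_0) * Du 1%nat x t
       + (De 1%nat x t * Du O x t + De O x t * Du 1%nat x t) = 0 /\
     ut x t + De 1%nat x t + u_0 * Du 1%nat x t + Du O x t * Du 1%nat x t = 0).
Proof.
intros Hr HT Ce Cu [Hpde [Hinit Hbc]].
destruct (smooth_data_of_rect r T eta) as [M1 [De [et [HM1 [S1 [E1 [D1 [P1 Q1]]]]]]]];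
  [lia|exact HT|exact Ce|intros t Ht; now apply Hbc|].
destruct (smooth_data_of_rect r T u) as [M2 [Du [ut [HM2 [S2 [E2 [D2 [P2 Q2]]]]]]]];
  [lia|exact HT|exact Cu|intros t Ht; now apply Hbc|].
set (cT := clamp 0 T).
assert (H2 : forall t, 0 <= cT t <= T) by (intros; apply clamp_in; lra).
assert (I2 : forall t, cT (cT t) = cT t) by (intros; now apply clamp_id).
exists (M1 + M2), De, et, Du, ut. split; [lra|].
split; [apply smooth_data_mono with M1; [lra|exact S1]|].
split; [apply smooth_data_mono with M2; [lra|exact S2]|].
split; [intros; split; auto|]. split.
- intros k x t.
  rewrite <- (P1 k x t), <- (P1 k x (cT t)), <- (P2 k x t), <- (P2 k x (cT t)).
  change (clamp 0 T) with cT. now rewrite I2.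
- intros x t Hx. assert (Hx' : 0 <= x <= 1) by lra.
  assert (Hc1 : clamp 0 1 x = x) by now apply clamp_id.
  rewrite <- (Q1 x t), <- (Q2 x t), <- (P1 O x t), <- (P1 1%nat x t), <- (P2 O x t),
    <- (P2 1%nat x t). rewrite Hc1. fold (cT t). specialize (H2 t).
  set (s := cT t) in *. clearbody s.
  destruct (D1 x s Hx' H2) as [A1 A2]. destruct (D2 x s Hx' H2) as [B1 B2].
  destruct (Hpde x s Hx' H2) as [F1 F2].
  unfold Defs.Dx in F1, F2.
  rewrite (Derive_on_unique 0 1 _ x _ Rlt_0_1 Hx' A1) in F1, F2.
  rewrite (Derive_on_unique 0 1 _ x _ Rlt_0_1 Hx' B1) in F1, F2.
  rewrite (Derive_on_unique 0 T _ s _ HT H2 A2) in F1.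
  rewrite (Derive_on_unique 0 T _ s _ HT H2 B2) in F2.
  (* The product rule is applied at an interior [x], where the one-sided derivatives of the factors
     are ordinary ones. *)
  assert (AB : is_derive_on (interval 0 1) (fun y => eta y s * u y s) x
    (De 1%nat x s * u x s + eta x s * Du 1%nat x s)).
  { apply is_derive_on_of; [lra|exact Hx'|].
    apply (is_derive_Rmult (fun y => eta y s) (fun y => u y s)).
    - now apply (is_derive_on_open 0 1).
    - now apply (is_derive_on_open 0 1). }
  rewrite (Derive_on_unique 0 1 _ x _ Rlt_0_1 Hx' AB) in F1.
  rewrite (E1 x s Hx' H2), (E2 x s Hx' H2). split; [exact F1|exact F2].
Qed.

Theorem proposition2p1 :
  forall r : nat, (3 <= r)%nat ->
  exists m : nat,
  forall (T eta_0 u_0 : R) (eta_init u_init : R -> R) (eta u : R -> R -> R)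
         (alpha beta kappa : R),
    0 < T -> 0 < 1 + eta_0 -> 0 < u_0 -> sqrt (1 + eta_0) < u_0 ->
    Ck_rect m T eta -> Ck_rect m T u ->
    is_ibvp_solution T eta_0 u_0 eta_init u_init eta u ->
    0 < alpha -> 0 < beta ->
    (forall x t, 0 <= x <= 1 -> 0 <= t <= T ->
       1 + eta x t + eta_0 >= beta /\
       u x t + u_0 >= 2 * alpha /\
       1 + eta x t + eta_0 <=
         (u x t + u_0 - alpha) * (u x t + u_0 - 2 * alpha / 3)) ->
    1 <= kappa ->
    exists h0 C : R, 0 < h0 /\ 0 < C /\
    forall (N : nat) (xs : nat -> R),
      is_partition N xs ->
      max_step N xs <= h0 ->
      max_step N xs <= kappa * min_step N xs ->
      exists eta_h u_h : R -> R -> R,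
        is_semidiscrete_solution (Sh r N xs) T eta_0 u_0 eta_init u_init
          eta_h u_h /\
        (forall eta_h' u_h' : R -> R -> R,
           is_semidiscrete_solution (Sh r N xs) T eta_0 u_0 eta_init u_init
             eta_h' u_h' ->
           forall t x, 0 <= t <= T -> 0 <= x <= 1 ->
             eta_h' t x = eta_h t x /\ u_h' t x = u_h t x) /\
        (forall t, 0 <= t <= T ->
           L2norm (fun x => eta x t - eta_h t x)
             + L2norm (fun x => u x t - u_h t x)
           <= C * max_step N xs ^ (r - 1)).
Proof.
(* [r] space derivatives are what Taylor polynomials of degree [r - 1] require; the same smoothness
   provides the first time derivative. *)
intros r Hr. exists r.
intros T eta_0 u_0 eta_init u_init eta u alpha beta kappa HT _ _ _ Ceta Cu Hib
  Hal Hbe Hpos Hka.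
destruct (ibvp_smooth_data r T eta_0 u_0 eta_init u_init eta u Hr HT Ceta Cu Hib)
  as [M [De [et [Du [ut [HM [SDe [SDu [E0 [Ecl Hpde]]]]]]]]]].
set (b := 1 + eta_0) in *.
assert (Hpos' : forall x t, 0 <= x <= 1 ->
  0 < u_0 + Du O x t /\ beta <= b + De O x t <= (u_0 + Du O x t) ^ 2).
{ intros x t Hx. assert (Ht : 0 <= clamp 0 T t <= T) by (apply clamp_in; lra).
  destruct (Ecl O x t) as [<- <-]. destruct (E0 x _ Hx Ht) as [-> ->].
  destruct (Hpos x _ Hx Ht) as [P1 [P2 P3]]. unfold b.
  set (U := u x (clamp 0 T t) + u_0) in *.
  replace (u_0 + u x (clamp 0 T t)) with U by (unfold U; ring).
  (* The difference of the two sides is [alpha * (5 * U - 2 * alpha) / 3], which is nonnegative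
     since [U >= 2 * alpha]. This turns the third assumption into the supercritical condition at the
     outflow end. *)
  assert ((U - alpha) * (U - 2 * alpha / 3) <= U ^ 2).
  { assert (0 <= alpha * (U - 2 * alpha)) by (apply Rmult_le_pos; lra).
    assert (0 <= alpha * alpha) by (apply Rmult_le_pos; lra). lra. }
  split; [lra|]. split; lra. }
destruct (energy_estimate r kappa T M beta u_0 b Hr Hka (Rlt_le _ _ HT) HM Hbe) as [C [HC Hen]].
destruct (proj_error r kappa Hr Hka) as [Cp [HCp Hproj]].
(* The squared error is at most twice that of the projection plus twice that of the spline part. *)
set (C0 := 2 * (Cp * M ^ 2) + 2 * C).
assert (HCpM : 0 <= Cp * M ^ 2) by (apply Rmult_le_pos; [exact HCp|apply pow2_ge_0]).
assert (HC0 : 0 <= C0) by (unfold C0; lra).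
(* The second entry ensures [C * h <= 1], the smallness that makes the truncation inactive. *)
assert (Hh0 : 0 < Rmin 1 (/ (C + 1))).
{ apply Rmin_glb_lt; [lra|]. apply Rinv_0_lt_compat. lra. }
exists (Rmin 1 (/ (C + 1))), (2 * sqrt C0 + 1).
assert (Qs := sqrt_pos C0). split; [exact Hh0|]. split; [lra|].
intros N xs Hpart Hhm Hq. set (h := max_step N xs) in *.
assert (Hm := partition_mesh N xs kappa Hpart Hka Hq). fold h in Hm.
assert (Hh : 0 < h) by now destruct Hm.
assert (Hh1 : h <= 1) by (eapply Rle_trans; [exact Hhm|apply Rmin_l]).
assert (HhC : C * h <= 1).
{ assert (H : h <= / (C + 1)) by (eapply Rle_trans; [exact Hhm|apply Rmin_r]).
  apply Rmult_le_compat_l with (r := C + 1) in H; [|lra].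
  rewrite Rinv_r in H by lra. lra. }
destruct (basis_exists r N (extended N xs h) Hr) as [m [phi [dphi Hb]]].
assert (Hsb := sh_basis_of_basis r N xs kappa h m phi dphi ltac:(lia) ltac:(lra) Hm Hb).
assert (Hc := sb_cont _ _ _ _ Hsb). assert (Hdc := sb_dcont _ _ _ _ Hsb).
assert (Ho := sb_orth _ _ _ _ Hsb).
assert (HF : loc_lip (m + m) (galerkin m phi dphi u_0 b))
  by (apply galerkin_loc_lip; intros i Hi; split; auto).
set (c := fun i t => pair_coef m phi (fun x => De O x t) (fun x => Du O x t) i).
set (dc := fun i t => pair_coef m phi (fun x => et x t) (fun x => ut x t) i).
assert (CDe0 : cont2 (De O)) by (apply (sd_cont _ _ _ _ _ SDe); lia).
assert (CDu0 : cont2 (Du O)) by (apply (sd_cont _ _ _ _ _ SDu); lia).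
assert (Hcc : forall i, (i < m + m)%nat -> cont (c i) /\ cont (dc i) /\
  forall t, 0 < t < T -> is_derive (c i) t (dc i t)).
{ intros i Hi. apply (pair_coef_derive m phi T (De O) et (Du O) ut i); auto.
  - apply (sd_contt _ _ _ _ _ SDe).
  - apply (sd_contt _ _ _ _ _ SDu).
  - apply (sd_dt _ _ _ _ _ SDe).
  - apply (sd_dt _ _ _ _ _ SDu). }
(* This is [h^(3/2)], written without a real exponent. *)
set (rho := h * sqrt h).
assert (Hrho : 0 < rho) by (apply Rmult_lt_0_compat; [exact Hh|now apply sqrt_lt_R0]).
assert (Hrho2 : rho ^ 2 = h ^ 3).
{ unfold rho. rewrite Rpow_mult_distr, pow2_sqrt by lra. ring. }
destruct (truncated_ode (m + m) _ c dc T rho HF (Rlt_le _ _ HT) Hrho) as [y [dy Hy]].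
{ intros j Hj. destruct (Hcc j Hj) as [K1 [K2 _]]. now split. }
assert (Hest := Hen h N (extended N xs h) m phi dphi Hm Hh1 Hb De et Du ut SDe SDu Hpde Hpos'
  y dy rho Hrho Hrho2 Hy).
set (g := h ^ (r - 1)) in *.
assert (Hg0 : 0 <= g) by (apply pow_le; lra).
(* Since [r - 1 >= 2], the estimate gives at most [C * h ^ 4 = (C * h) * h ^ 3], and this is below
   [rho ^ 2 = h ^ 3]. *)
assert (Hg : C * g ^ 2 <= rho ^ 2).
{ rewrite Hrho2. assert (g <= h ^ 2).
  { unfold g. replace (r - 1)%nat with (2 + (r - 3))%nat by lia. rewrite pow_add.
    assert (h ^ (r - 3) <= 1) by (rewrite <- (pow1 (r - 3)); apply pow_incr; lra).
    assert (0 < h ^ 2) by now apply pow_lt. nra. }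
  assert (g ^ 2 <= (h ^ 2) ^ 2) by (apply pow_incr; lra).
  apply Rle_trans with (C * (h ^ 2) ^ 2); [now apply Rmult_le_compat_l|].
  replace (C * (h ^ 2) ^ 2) with (C * h * h ^ 3) by ring.
  assert (0 < h ^ 3) by now apply pow_lt. nra. }
assert (Htr : forall t, 0 <= t <= T -> trunc (m + m) rho (fun j => y j t) = 1).
{ intros t Ht. unfold trunc. apply Rmax_left.
  assert (0 < rho ^ 2) by now apply pow_lt.
  apply Rle_div_l; [assumption|]. specialize (Hest t Ht). lra. }
(* On [0,T] this is [c - y]. The coordinates [c] are known to be differentiable only for
   [0 < t < T]; rebuilding them from the integral of [dc] yields a function with a derivative at
   every [t]. *)
set (z := fun i t => c i 0 + RInt (dc i) 0 t - y i t).
set (dz := fun i t => dc i t - dy i t).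
assert (Hzc : forall i t, (i < m + m)%nat -> 0 <= t <= T -> z i t = c i t - y i t).
{ intros i t Hi Ht. destruct (Hcc i Hi) as [K1 [K2 K3]]. unfold z.
  rewrite (FTC_open (c i) (dc i) 0 t); [ring|lra|exact K1|exact K2|].
  intros s Hs. apply K3. lra. }
assert (Hz : forall i, (i < m + m)%nat ->
  z i 0 = pair_coef m phi (fun x => De O x 0) (fun x => Du O x 0) i /\ cont (dz i) /\
  (forall t, is_derive (z i) t (dz i t)) /\
  forall t, 0 <= t <= T -> dz i t = galerkin m phi dphi u_0 b i (fun j => z j t)).
{ intros i Hi. destruct (Hcc i Hi) as [K1 [K2 K3]].
  destruct (Hy i Hi) as [Y0 [Y1 [Y2 Y3]]]. split; [|split; [|split]].
  - rewrite Hzc by (try lra; exact Hi). rewrite Y0. unfold c. ring.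
  - now apply cont_minus.
  - intros t. apply is_derive_Rminus; [|apply Y2].
    eapply is_derive_eq.
    + apply is_derive_Rplus; [apply (is_derive_const (c i 0))|now apply is_derive_RI].
    + unfold zero; simpl. ring.
  - intros t Ht. unfold dz. rewrite Y3 by exact Ht.
    replace (dc i t - (dc i t - galerkin m phi dphi u_0 b i
       (fun j => c j t - y j t / trunc (m + m) rho (fun j => y j t))))
      with (galerkin m phi dphi u_0 b i
       (fun j => c j t - y j t / trunc (m + m) rho (fun j => y j t))) by ring.
    apply galerkin_ext; [exact Hi|]. intros j Hj. rewrite Htr, Hzc by assumption. field. }
assert (Cge : cont (fun x => De O x 0)) by now apply cont2_x.
assert (Cgu : cont (fun x => Du O x 0)) by now apply cont2_x.
assert (Ee : forall x, 0 < x < 1 -> eta_init x - eta_0 = De O x 0).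
{ intros x Hx. destruct (E0 x 0) as [-> _]; try lra.
  destruct Hib as [_ [Hi _]]. destruct (Hi x ltac:(unfold interval; lra)) as [-> _].
  reflexivity. }
assert (Eu : forall x, 0 < x < 1 -> u_init x - u_0 = Du O x 0).
{ intros x Hx. destruct (E0 x 0) as [_ ->]; try lra.
  destruct Hib as [_ [Hi _]]. destruct (Hi x ltac:(unfold interval; lra)) as [_ ->].
  reflexivity. }
exists (fun t => comb m phi (fun j => z j t)), (fun t => comb m phi (fun j => z (m + j)%nat t)).
split; [|split].
- apply (coords_semidiscrete (Sh r N xs) m phi dphi T eta_0 u_0 eta_init u_init
    (fun x => De O x 0) (fun x => Du O x 0) z dz Hsb HT Cge Cgu Ee Eu Hz).
- intros eta_h' u_h' Hsol t x Ht Hx.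
  destruct (semidiscrete_coords (Sh r N xs) m phi dphi T eta_0 u_0 eta_init u_init
    eta_h' u_h' (fun x => De O x 0) (fun x => Du O x 0) Hsb HT Cge Cgu Ee Eu Hsol)
    as [k [Hk1 Hk2]].
  destruct (Hk1 t x Ht Hx) as [-> ->].
  assert (HU : forall j s, (j < m + m)%nat -> 0 <= s <= T -> k j s = z j s).
  { apply (ode_unique (m + m) _ k z T HF (Rlt_le _ _ HT)).
    - intros j Hj. destruct (Hk2 j Hj) as [K1 [K2 _]]. destruct (Hz j Hj) as [Z1 [_ [Z3 _]]].
      split; [exact K1|]. split; [now apply is_derive_cont with (dz j)|].
      now rewrite K2, Z1.
    - intros j s Hj Hs. destruct (Hk2 j Hj) as [_ [_ K3]].
      destruct (Hz j Hj) as [_ [_ [Z3 Z4]]]. split; [now apply K3|].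
      rewrite <- Z4 by lra. apply Z3. }
  split; apply comb_ext; intros j Hj; apply HU; auto; lia.
- intros t Ht. fold g.
  (* The offset [k] is 0 for the first unknown and [m] for the second, so that one argument bounds
     both errors. *)
  assert (Hbound : forall (D : nat -> R -> R -> R) Dt v k,
    smooth_data r T M D Dt -> (forall x, 0 <= x <= 1 -> D O x t = v x) ->
    (forall j, (j < m)%nat -> z (k + j)%nat t = proj_coef phi (fun x => D O x t) j
       - y (k + j)%nat t) ->
    rsum m (fun j => y (k + j)%nat t ^ 2) <= C * g ^ 2 ->
    L2norm (fun x => v x - comb m phi (fun j => z (k + j)%nat t) x) <= sqrt C0 * g).
  { intros D Dt v k SD Ev Ez Hs.
    assert (CD : cont (fun x => D O x t))
      by (apply cont2_x; apply (sd_cont _ _ _ _ _ SD); lia).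
    destruct (Hproj h N (extended N xs h) m phi dphi Hm Hh1 Hb (fun k x => D k x t) M)
      as [Hp _].
    - split; intros; [apply cont2_x|]; now apply SD.
    - exact HM.
    - intros x _. apply (sd_bound _ _ _ _ _ SD). lia.
    - apply (sd_0 _ _ _ _ _ SD).
    - cbv beta in Hp. set (p := proj_coef phi (fun x => D O x t)) in *.
      set (yy := fun j => y (k + j)%nat t).
      assert (Cp1 := cont_comb m phi p Hc). assert (Cy1 := cont_comb m phi yy Hc).
      unfold L2norm, inner. rewrite <- (sqrt_pow2 g Hg0), <- sqrt_mult_alt by exact HC0.
      apply sqrt_le_1_alt.
      rewrite (RI_ext _ (fun x => ((D O x t - comb m phi p x) + comb m phi yy x) ^ 2)).
      + eapply Rle_trans; [apply (RI_sqr_plus (fun x => D O x t - comb m phi p x)); cont|].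
        rewrite (norm_comb m phi yy Hc Ho). fold yy in Hs. unfold C0. fold g in Hp.
        change (rsum m (fun j => y (k + j)%nat t ^ 2)) with (rsum m (fun j => yy j ^ 2)) in Hs.
        lra.
      + lra.
      + intros x Hx. rewrite <- Ev by lra.
        rewrite (comb_ext m phi (fun j => z (k + j)%nat t) (fun j => p j - yy j)).
        * rewrite comb_minus. ring.
        * intros j Hj. now apply Ez. }
  assert (Hsplit := rsum_split m m (fun j => y j t ^ 2)).
  assert (Hy1 : 0 <= rsum m (fun j => y j t ^ 2))
    by (apply rsum_nonneg; intros; apply pow2_ge_0).
  assert (Hy2 : 0 <= rsum m (fun j => y (m + j)%nat t ^ 2))
    by (apply rsum_nonneg; intros; apply pow2_ge_0).
  specialize (Hest t Ht).
  assert (N1 := Hbound De et (fun x => eta x t) O SDe).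
  assert (N2 := Hbound Du ut (fun x => u x t) m SDu).
  simpl Nat.add in N1.
  assert (M1 : L2norm (fun x => eta x t - comb m phi (fun j => z j t) x) <= sqrt C0 * g).
  { apply N1.
    - intros x Hx. now apply E0.
    - intros j Hj. rewrite Hzc by (try assumption; lia). unfold c. now rewrite pair_coef_l.
    - lra. }
  assert (M2 : L2norm (fun x => u x t - comb m phi (fun j => z (m + j)%nat t) x) <= sqrt C0 * g).
  { apply N2.
    - intros x Hx. now apply E0.
    - intros j Hj. rewrite Hzc by (try assumption; lia). unfold c. now rewrite pair_coef_r.
    - lra. }
  lra.
Qed.
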